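(* Consider the isentropic gas dynamics equations on $0<x<1$, $$\rho_t+(\rho u)_x=0,\qquad (\rho u)_t+(\rho u^2+p(\rho))_x=\nu u_{xx},\qquad \rho>0,\quad p'>0,\ p''>0,$$ with boundary conditions $\rho(0)=\rho_0$, $u(0)=u_0$, $u(1)=u_1$, where $\rho_0,u_0,u_1>0$. For each boundary data $(\rho_0,u_0,u_1)$ there exists a unique limiting steady configuration consisting of: (i) a single boundary layer at the left or right endpoint; (ii) a single interior standing shock; or (iii) a double boundary layer connecting from each boundary to a ''characteristic point'' $u=c$, with $c=\sqrt{p'(\rho)}$ denoting sound speed. These determine a unique inviscid solution up to location of the interior shock. The unique viscous steady solution converges, as the viscosity $\nu\to0$, to an inviscid one with particular interior shock location, at sharp rates $\nu^{1/p}$ in $L^p$, $1<p<\infty$, and $\nu\log\nu$ in $L^1$.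
   Context: In the convergence rates the exponent $p$ of $L^p=L^p(0,1)$ is a number, not the pressure function $p(\rho)$. Viscous steady solutions. Put $m=\rho_0u_0>0$ and $\psi(\rho)=m^2/\rho+p(\rho)$, a convex function. Steady solutions $(\hat\rho,\hat u)$ of the viscous problem are given by $m\nu\hat\rho'=\hat\rho^2(b-\psi(\hat\rho))$, $\hat u=m/\hat\rho$, $\hat\rho(0)=\rho_0$, where the constant $b$ is determined implicitly by $\hat\rho(1)=m/u_1$; for each $\nu>0$ there is exactly one. The characteristic point is the minimizer $\rho_*$ of $\psi$, where $m^2/\rho_*^2=p'(\rho_* )$, i.e. $u_*:=m/\rho_*=\sqrt{p'(\rho_* )}$. Limiting (inviscid, $\nu=0$) steady configurations. Formally setting $\nu=0$ in the steady equations gives patterns with $\rho u\equiv m$ that are constant on smooth portions, separated by standing shocks in the interior and boundary layers at the endpoints. These elements are described by viscous profiles, i.e. solutions of the profile equation $m\nu\rho'=\rho^2(b-\psi(\rho))$ for some constant $b$: a standing shock is a jump whose left and right states are the limits at $-\infty$ and $+\infty$ of a profile on the whole line; a left boundary layer is a profile on $[0,+\infty)$ equal to the boundary value $\rho_0$ at $x=0$ and converging at $+\infty$ to the adjacent interior state; a right boundary layer is a profile on a half-line ending at the right endpoint, equal to the boundary value $m/u_1$ there and converging at $-\infty$ to the adjacent interior state. A double boundary layer is the concatenation of a left and a right boundary layer with the characteristic state $\rho_*$ as common intermediate interior state. *)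

(* Defs.v *)
From HB Require Import structures.
From mathcomp Require Import all_boot all_order all_algebra.
From mathcomp Require Import all_classical all_reals all_analysis.
Set Implicit Arguments.
Unset Strict Implicit.
Unset Printing Implicit Defensive.
Import Order.TTheory GRing.Theory Num.Theory.
Import numFieldNormedType.Exports.
Local Open Scope ring_scope.
Local Open Scope classical_set_scope.

(* The pressure is only constrained on the physical range rho > 0. *)
Definition pressure_law (R : realType) (p : R -> R) : Prop :=
  forall r : R, 0 < r ->
    [/\ derivable p r 1, derivable (derive1 p) r 1, 0 < derive1 p r &
        0 < derive1 (derive1 p) r].

Definition sound_speed (R : realType) (p : R -> R) (r : R) : R :=
  Num.sqrt (derive1 p r).

(* The state of density r and velocity m / r satisfies u = c. *)
Definition characteristic (R : realType) (p : R -> R) (m r : R) : Prop :=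
  m / r = sound_speed p r.

(* Time-independent solutions of
     rho_t + (rho u)_x = 0,  (rho u)_t + (rho u^2 + p(rho))_x = nu u_xx
   on ]0, 1[, with the boundary values attained continuously. *)
Definition viscous_steady_solution (R : realType) (p : R -> R)
    (nu rho0 u0 u1 : R) (rho u : R -> R) : Prop :=
  [/\ {within `[0, 1], continuous rho} /\ {within `[0, 1], continuous u},
      [/\ rho 0 = rho0, u 0 = u0 & u 1 = u1],
      (forall x, 0 <= x <= 1 -> 0 < rho x),
      (forall x, 0 < x < 1 ->
         [/\ derivable rho x 1, derivable u x 1 & derivable (derive1 u) x 1]) &
      (forall x, 0 < x < 1 ->
         derive1 (fun y => rho y * u y) x = 0 /\
         derive1 (fun y => rho y * u y ^+ 2 + p (rho y)) x =
           nu * derive1 (derive1 u) x)].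

Definition psi (R : realType) (p : R -> R) (m r : R) : R := m ^+ 2 / r + p r.

Definition profile_eq (R : realType) (p : R -> R) (m nu b : R)
    (rho : R -> R) (x : R) : Prop :=
  [/\ 0 < rho x, derivable rho x 1 &
      m * nu * derive1 rho x = rho x ^+ 2 * (b - psi p m (rho x))].

(* A jump has distinct sides, which excludes the constant profiles here;
   constant profiles are allowed in the two boundary layer relations, where
   they express the absence of a layer. *)
Definition standing_shock (R : realType) (p : R -> R) (m nu rl rr : R) : Prop :=
  rl != rr /\
  exists (b : R) (rho : R -> R),
    [/\ forall x, profile_eq p m nu b rho x,
        rho x @[x --> -oo] --> rl & rho x @[x --> +oo] --> rr].

Definition left_boundary_layer (R : realType) (p : R -> R)
    (m nu rbd rin : R) : Prop :=
  exists (b : R) (rho : R -> R),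
    [/\ {within `[0, +oo[, continuous rho}, rho 0 = rbd,
        forall x, 0 < x -> profile_eq p m nu b rho x &
        rho x @[x --> +oo] --> rin].

Definition right_boundary_layer (R : realType) (p : R -> R)
    (m nu rin rbd : R) : Prop :=
  exists (b : R) (rho : R -> R),
    [/\ {within `]-oo, 1], continuous rho}, rho 1 = rbd,
        forall x, x < 1 -> profile_eq p m nu b rho x &
        rho x @[x --> -oo] --> rin].

(* A steady configuration is encoded by the sequence s of its interior
   densities, from left to right; the velocities are the m / s`_i. *)
Definition limiting_configuration (R : realType) (p : R -> R)
    (m nu rhoL rhoR : R) (s : seq R) : Prop :=
  [/\ (0 < size s)%N, (forall r, r \in s -> 0 < r),
      left_boundary_layer p m nu rhoL (head 0 s),
      (forall i, (i.+1 < size s)%N -> standing_shock p m nu s`_i s`_i.+1) &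
      right_boundary_layer p m nu (last 0 s) rhoR].

Definition single_boundary_layer (R : realType) (p : R -> R)
    (m nu rhoL rhoR : R) (s : seq R) : Prop :=
  (s = [:: rhoR] /\ left_boundary_layer p m nu rhoL rhoR) \/
  (s = [:: rhoL] /\ right_boundary_layer p m nu rhoL rhoR).

Definition single_interior_shock (R : realType) (p : R -> R)
    (m nu rhoL rhoR : R) (s : seq R) : Prop :=
  s = [:: rhoL; rhoR] /\ standing_shock p m nu rhoL rhoR.

Definition double_boundary_layer (R : realType) (p : R -> R)
    (m nu rhoL rhoR : R) (s : seq R) : Prop :=
  exists a : R,
    [/\ s = [:: a], characteristic p m a, a != rhoL /\ a != rhoR,
        left_boundary_layer p m nu rhoL a &
        right_boundary_layer p m nu a rhoR].

(* (rho, u) takes on ]0, 1[ the successive states of a limiting configuration,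
   jumping at the points of z; nothing is required at the points of z. *)
Definition inviscid_solution (R : realType) (p : R -> R)
    (m nu rhoL rhoR : R) (z : seq R) (rho u : R -> R) : Prop :=
  exists s : seq R,
    [/\ limiting_configuration p m nu rhoL rhoR s,
        size s = (size z).+1, sorted <%R z,
        (forall y, y \in z -> 0 < y < 1) &
        (forall x, 0 < x < 1 -> x \notin z ->
           rho x = s`_(count (fun y => y < x) z) /\ u x = m / rho x)].

Definition Lq_dist01 (R : realType) (q : R) (f g : R -> R) : \bar R :=
  Lnorm lebesgue_measure q%:E (EFin \o ((f \- g) \_ `]0, 1[)).

Definition upper_rate (R : realType) (E : R -> \bar R) (g : R -> R) : Prop :=
  exists2 C : R, 0 < C & \forall nu \near 0^'+, (E nu <= (C * g nu)%:E)%E.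

Definition lower_rate (R : realType) (E : R -> \bar R) (g : R -> R) : Prop :=
  exists2 c : R, 0 < c & \forall nu \near 0^'+, ((c * g nu)%:E <= E nu)%E.

(* Main.v *)
Require Import Defs.
From HB Require Import structures.
From mathcomp Require Import all_boot all_order all_algebra.
From mathcomp Require Import all_classical all_reals all_analysis.
From mathcomp Require Import measurable_realfun ring lra.
Set Implicit Arguments.
Unset Strict Implicit.
Unset Printing Implicit Defensive.
Import Order.TTheory GRing.Theory Num.Theory.
Import numFieldNormedType.Exports.
Local Open Scope ring_scope.
Local Open Scope classical_set_scope.

(** Write [m = rho0 * u0], [P = psi p m] and [rho1 = m / u1]. All profiles, viscous or limiting,
    solve the scalar equation m nu rho' = rho^2 (b - P rho) with [P] strictly convex, so everything
    is decided by the shape of [P] between the boundary densities [rho0] and [rho1].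

    Limiting configurations. A half-line profile joins [c] to [A] exactly when b = P A and the field
    points from [c] to [A] at every density in between ([half_profile_direction],
    [half_profile_exists]). Convexity turns this into inequalities on values of [P] and the sign of
    P' ([left_boundary_layerP], [right_boundary_layerP], [standing_shockP]). What survives is the
    following ([limiting_configurationP]). If rho0 < rho1, the interior state is the end density
    with the larger [P], and in case of equality a shock joins the two. If rho1 <= rho0, it is the
    minimizer of [P] on [rho1, rho0], which is characteristic when it lies strictly inside. None of
    this depends on nu.

    Viscous solutions. Integrating the equations once leaves an unknown constant [b]. Uniqueness
    comes from a one-sided comparison of velocities after ordering the two constants
    ([boundary_value_zero], [viscous_steady_unique]). Existence is shooting in [b]: after reflecting
    x when the density decreases, the problem reads nu y' = g(y) (d + th(y)), where g(r) = r^2 / m,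
    [th >= 0] is the gap between [P] and its extreme value on the interval, and [d > 0] is the
    excess of [b] beyond that value. The crossing time runs from 0 to infinity as [d] runs from
    infinity to 0 ([increasing_two_point_solution]).

    Rates. Errors are compared with [majorant z nu x], that is nu / (nu + |x - z|), whose L^q norm
    has order nu^(1/q) and whose L^1 norm has order nu |ln nu|. For layers, a quadratic lower bound
    on [th] gives decay at least as fast as the majorant ([crossing_layer_upper]). For a shock, the
    times spent near the two end states are multiples of -nu ln d up to O(nu) and add up to one;
    eliminating ln d locates the shock up to O(nu) ([crossing_shock]). Conversely y' = O(1/nu), so
    an error of fixed size persists over a length of order nu, which gives the lower bound in L^q.
    At a characteristic state [th] is also at most quadratic and d = O(nu^2)
    ([crossing_parameter_quadratic]), so near one end the error is bounded below by a multiple of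
    the majorant itself ([crossing_characteristic_lower_left]), which gives the logarithm in L^1. *)

(** * Calculus of one-variable derivatives and monotonicity *)

Section PointwiseDerivatives.
Context {R : realType}.
Implicit Types (f g : R -> R) (x a b c : R).

Lemma is_derive1D f g x a b : is_derive x 1 f a -> is_derive x 1 g b ->
  is_derive x 1 (fun t => f t + g t) (a + b).
Proof. by move=> ? ?; exact: is_deriveD. Qed.

Lemma is_derive1_cst c x : is_derive x 1 (fun=> c) 0.
Proof. exact: (is_derive_cst c x 1). Qed.

Lemma is_derive1_id x : is_derive x 1 (fun t : R => t) 1.
Proof. exact: (is_derive_id x 1). Qed.

Lemma is_derive1B f g x a b : is_derive x 1 f a -> is_derive x 1 g b ->
  is_derive x 1 (fun t => f t - g t) (a - b).
Proof. by move=> ? ?; exact: is_deriveB. Qed.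

Lemma is_derive1N f x a : is_derive x 1 f a ->
  is_derive x 1 (fun t => - f t) (- a).
Proof. by move=> ?; exact: is_deriveN. Qed.

Lemma is_derive1M f g x a b : is_derive x 1 f a -> is_derive x 1 g b ->
  is_derive x 1 (fun t => f t * g t) (a * g x + f x * b).
Proof.
move=> df dg; have := is_deriveM df dg.
by rewrite /GRing.scale /= addrC (mulrC a).
Qed.

Lemma is_derive1Z c f x a : is_derive x 1 f a ->
  is_derive x 1 (fun t => c * f t) (c * a).
Proof.
move=> df; have := is_derive1M (is_derive_cst c x 1) df.
by rewrite mul0r add0r.
Qed.

Lemma is_derive1V f x a : is_derive x 1 f a -> f x != 0 ->
  is_derive x 1 (fun t => (f t)^-1) (- a / f x ^+ 2).
Proof.
move=> df f0; have := is_deriveV f0 df.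
by rewrite /GRing.scale /= mulNr mulrC mulNr.
Qed.

Lemma is_derive1_ln_comp f x a : is_derive x 1 f a -> 0 < f x ->
  is_derive x 1 (fun t => ln (f t)) (a / f x).
Proof.
move=> df f0; rewrite mulrC.
by apply: (@is_derive1_comp _ (@ln R) f); exact: is_derive1_ln.
Qed.

Lemma is_derive1_expR_comp f x a : is_derive x 1 f a ->
  is_derive x 1 (fun t => expR (f t)) (expR (f x) * a).
Proof. by move=> df; apply: (@is_derive1_comp _ (@expR R) f). Qed.

Lemma is_derive1_eq f x a b : is_derive x 1 f a -> a = b -> is_derive x 1 f b.
Proof. by move=> df <-. Qed.

Lemma is_derive1_continuous f x a : is_derive x 1 f a -> {for x, continuous f}.
Proof.
by move=> [df _]; apply/differentiable_continuous/derivable1_diffP.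
Qed.

Lemma is_derive1E f x a : is_derive x 1 f a -> derive1 f x = a.
Proof. by move=> df; rewrite derive1E derive_val. Qed.

Lemma within_continuous (A : set R) f :
  (forall x, A x -> {for x, continuous f}) -> {within A, continuous f}.
Proof. by move=> cf; apply: continuous_in_subspaceT => x; rewrite inE => /cf. Qed.

Lemma within_continuousI f x y a b : {within `[x, y], continuous f} ->
  x <= a -> b <= y -> {within `[a, b], continuous f}.
Proof.
move=> cf xa yb; apply: continuous_subspaceW cf; apply: subset_itv;
by rewrite bnd_simp.
Qed.

Lemma within_comp_continuous (A : set R) f g : {within A, continuous f} ->
  (forall x, A x -> {for f x, continuous g}) ->
  {within A, continuous (fun x => g (f x))}.
Proof.
move=> /subspace_continuousP cf cg; apply/subspace_continuousP => x Ax.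
exact: cvg_comp (cf x Ax) (cg x Ax).
Qed.

Lemma derive_ge0_le f f' a b : a <= b -> {within `[a, b], continuous f} ->
  (forall x, a < x < b -> is_derive x 1 f (f' x)) ->
  (forall x, a < x < b -> 0 <= f' x) -> f a <= f b.
Proof.
move=> ab cf df f0; have [abE|altb] := eqVneq a b; first by rewrite abE.
have ltab : a < b by rewrite lt_neqAle altb.
have dfi : forall x, x \in `]a, b[%R -> is_derive x 1 f (f' x).
  by move=> x; rewrite in_itv/=; exact: df.
have [c] := MVT ltab dfi cf.
rewrite in_itv/= => cab E; rewrite -subr_ge0 E mulr_ge0 ?subr_ge0//; exact: f0.
Qed.

Lemma derive_gt0_lt f f' a b : a < b -> {within `[a, b], continuous f} ->
  (forall x, a < x < b -> is_derive x 1 f (f' x)) ->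
  (forall x, a < x < b -> 0 < f' x) -> f a < f b.
Proof.
move=> ab cf df f0.
have dfi : forall x, x \in `]a, b[%R -> is_derive x 1 f (f' x).
  by move=> x; rewrite in_itv/=; exact: df.
have [c] := MVT ab dfi cf.
rewrite in_itv/= => cab E; rewrite -subr_gt0 E mulr_gt0 ?subr_gt0//; exact: f0.
Qed.

End PointwiseDerivatives.

(** * Primitives on an open interval *)

Section Primitive.
Context {R : realType}.
Notation mu := (@lebesgue_measure R).

Lemma primitive_open_interval (h : R -> R) (A B : R) :
  (forall r, A < r < B -> {for r, continuous h}) ->
  exists H : R -> R, forall r, A < r < B -> is_derive r 1 H (h r).
Proof.
move=> ch; have [AB|BA] := ltP A B; last first.
  exists (cst 0) => r /andP[Ar rB]; have := lt_trans Ar rB.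
  by rewrite ltNge BA.
pose c := (A + B) / 2.
(* Of the two integrals one has an empty or one-point domain, so the difference is the oriented
   integral from the midpoint [c] to [r]. *)
exists (fun r => (\int[mu]_(t in `[c, r]) h t) - (\int[mu]_(t in `[r, c]) h t)).
move=> r rAB; pose a := (A + Num.min c r) / 2; pose b := (B + Num.max c r) / 2.
have acr : [/\ A < a, a < c, a < r & [/\ c < b, r < b & b < B]].
  rewrite /a /b /c; move: rAB => /andP[Ar rB].
  by rewrite /Num.min /Num.max; case: (ltP _ r) => cr; split; try split; lra.
case: acr => Aa ac ar [cb rb bB].
have iab u v : a <= u -> v <= b -> mu.-integrable `[u, v] (EFin \o h).
  move=> au vb; apply: continuous_compact_integrable; first exact: segment_compact.
  apply: within_continuous => x/=; rewrite in_itv/= => /andP[ux xv].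
  by apply: ch; lra.
pose F x := (\int[mu]_(t in `[a, x]) h t)%R.
have [dF F'] : derivable F r 1 /\ derive1 F r = h r.
  apply: (@continuous_FTC1_closed _ h a r b) => //; last exact: ch.
  exact: iab.
have dFr : is_derive r 1 (fun x => F x - F c) (h r).
  have dFr : is_derive r 1 F (h r) by split; [exact: dF|rewrite -F' derive1E].
  by have := is_derive1B dFr (is_derive1_cst (F c) r); rewrite subr0.
apply: near_eq_is_derive dFr.
near=> x.
have ax : a < x by near: x; apply: lt_nbhsr.
have xb : x < b by near: x; apply: lt_nbhsl.
have spl u v : a < u -> u <= v -> v <= b ->
    F v - F u = \int[mu]_(t in `[u, v]) h t.
  move=> au uv vb; rewrite /F.
  rewrite (@Rintegral_itvB _ h (BLeft a) (BRight v) u) ?bnd_simp//; [|exact: iab|exact: ltW].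
  rewrite Rintegral_itv_obnd_cbnd//.
  apply: integrableS (iab u v _ _) => //; last exact: ltW.
  by apply: subset_itv; rewrite bnd_simp.
have [cx|xc] := leP c x.
  rewrite -spl//; last exact: ltW.
  move: cx; rewrite le_eqVlt => /predU1P[<-|cx].
    by rewrite set_itv1 Rintegral_set1 subr0.
  have -> : \int[mu]_(t in `[x, c]) h t = 0.
    by rewrite set_itv_ge ?Rintegral_set0// bnd_simp -ltNge.
  by rewrite subr0.
rewrite -(spl x c)//; [|exact: ltW|exact: ltW].
have -> : \int[mu]_(t in `[c, x]) h t = 0.
  by rewrite set_itv_ge ?Rintegral_set0// bnd_simp -ltNge.
by rewrite sub0r opprB.
Unshelve. all: by end_near. Qed.

End Primitive.

(** * Global orbits of an autonomous scalar equation *)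

Section ScalarODE.
Context {R : realType}.

(** Separation of variables: a primitive [X] of 1 / F gives the time at which each value is reached,
    and [y] is its inverse. The linear bounds on [F] at the two ends make [X] diverge there at least
    logarithmically, so the orbit exists for all times and tends to the ends. *)
Lemma heteroclinic_orbit (F : R -> R) (A B L c x0 : R) : A < c < B ->
  (forall r, A < r < B -> {for r, continuous F}) ->
  (forall r, A < r < B -> 0 < F r) ->
  (forall r, A < r < B -> F r <= L * (B - r)) ->
  (forall r, A < r < B -> F r <= L * (r - A)) ->
  exists y : R -> R, [/\ y x0 = c, {homo y : x1 x2 / x1 < x2},
    forall x, A < y x < B /\ is_derive x 1 y (F (y x)),
    y x @[x --> +oo] --> B & y x @[x --> -oo] --> A].
Proof.
move=> /andP[Ac cB] cF F0 FB FA.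
have L0 : 0 < L.
  have := lt_le_trans (F0 c _) (FB c _); rewrite Ac cB => /(_ isT isT).
  by rewrite pmulr_lgt0 // subr_gt0.
have cVF r : A < r < B -> {for r, continuous (fun r => (F r)^-1)}.
  by move=> rAB; apply: cvgV; [rewrite gt_eqF// F0|exact: cF].
have [X0 dX0] := primitive_open_interval cVF.
pose X r := X0 r - X0 c + x0.
have dX r : A < r < B -> is_derive r 1 X (F r)^-1.
  move=> /dX0 d; rewrite /X.
  have := is_derive1D (is_derive1B d (is_derive1_cst (X0 c) r)) (is_derive1_cst x0 r).
  by rewrite subr0 addr0.
have Xc : X c = x0 by rewrite /X subrr add0r.
have Xlt r s : A < r -> r < s -> s < B -> X r < X s.
  move=> Ar rs sB; apply: (@derive_gt0_lt _ X (fun r => (F r)^-1)) => //.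
  - apply: within_continuous => t /=; rewrite in_itv/= => /andP[rt ts].
    by apply: is_derive1_continuous (dX t _); lra.
  - by move=> t /andP[rt ts]; apply: dX; lra.
  - by move=> t /andP[rt ts]; rewrite invr_gt0; apply: F0; lra.
have Xhi K : 0 < K -> exists2 r, c < r < B & x0 + K <= X r.
  (* This [r] solves ln ((B - c) / (B - r)) = L K. Since F <= L (B - t), the function X + ln (B - t)
     / L is nondecreasing, and comparing its values at [c] and [r] gives the claim. *)
  move=> K0; pose r := B - (B - c) * expR (- (L * K)).
  have e1 : expR (- (L * K)) < 1 by rewrite expR_lt1 oppr_lt0 mulr_gt0.
  have e0 := expR_gt0 (- (L * K)).
  have cB0 : 0 < B - c by rewrite subr_gt0.
  have rcB : c < r < B.
    have := mulr_gt0 cB0 e0; have : (B - c) * expR (- (L * K)) < (B - c) * 1.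
      by rewrite ltr_pM2l.
    by rewrite /r; lra.
  exists r => //; move/andP: (rcB) => [cr rB].
  have dQ t : A < t < B -> is_derive t 1 (fun t => X t + L^-1 * ln (B - t))
      ((F t)^-1 + L^-1 * ((0 - 1) / (B - t))).
    move=> tAB; have Bt : 0 < B - t by lra.
    have d := is_derive1B (is_derive1_cst B t) (is_derive1_id t).
    exact: (is_derive1D (dX t tAB) (is_derive1Z L^-1 (is_derive1_ln_comp d Bt))).
  have : X c + L^-1 * ln (B - c) <= X r + L^-1 * ln (B - r).
    apply: (@derive_ge0_le _ (fun t => X t + L^-1 * ln (B - t))
      (fun t => (F t)^-1 + L^-1 * ((0 - 1) / (B - t)))); first exact: ltW.
    - apply: within_continuous => t /=; rewrite in_itv/= => /andP[rt ts].
      by apply: is_derive1_continuous (dQ t _); lra.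
    - by move=> t /andP[rt ts]; apply: dQ; lra.
    - move=> t /andP[ct tr]; have tAB : A < t < B by lra.
      have tB : 0 < B - t by lra.
      rewrite sub0r mulN1r mulrN -invfM subr_ge0 lef_pV2 ?posrE ?mulr_gt0//.
        exact: FB.
      exact: F0.
  have -> : ln (B - r) = ln (B - c) - L * K.
    by rewrite /r subKr lnM ?posrE// expRK.
  by rewrite mulrBr mulKf ?gt_eqF// Xc; lra.
have Xlo K : 0 < K -> exists2 r, A < r < c & X r <= x0 - K.
  move=> K0; pose r := A + (c - A) * expR (- (L * K)).
  have e1 : expR (- (L * K)) < 1 by rewrite expR_lt1 oppr_lt0 mulr_gt0.
  have e0 := expR_gt0 (- (L * K)).
  have cA0 : 0 < c - A by rewrite subr_gt0.
  have rAc : A < r < c.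
    have := mulr_gt0 cA0 e0; have : (c - A) * expR (- (L * K)) < (c - A) * 1.
      by rewrite ltr_pM2l.
    by rewrite /r; lra.
  exists r => //; move/andP: (rAc) => [Ar rc].
  have dQ t : A < t < B -> is_derive t 1 (fun t => X t - L^-1 * ln (t - A))
      ((F t)^-1 - L^-1 * ((1 - 0) / (t - A))).
    move=> tAB; have tA : 0 < t - A by lra.
    have d := is_derive1B (is_derive1_id t) (is_derive1_cst A t).
    exact: (is_derive1B (dX t tAB) (is_derive1Z L^-1 (is_derive1_ln_comp d tA))).
  have : X r - L^-1 * ln (r - A) <= X c - L^-1 * ln (c - A).
    apply: (@derive_ge0_le _ (fun t => X t - L^-1 * ln (t - A))
      (fun t => (F t)^-1 - L^-1 * ((1 - 0) / (t - A)))); first exact: ltW.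
    - apply: within_continuous => t /=; rewrite in_itv/= => /andP[rt ts].
      by apply: is_derive1_continuous (dQ t _); lra.
    - by move=> t /andP[rt ts]; apply: dQ; lra.
    - move=> t /andP[ct tr]; have tAB : A < t < B by lra.
      have tB : 0 < t - A by lra.
      rewrite subr0 mul1r -invfM subr_ge0 lef_pV2 ?posrE ?mulr_gt0//.
        exact: FA.
      exact: F0.
  have -> : ln (r - A) = ln (c - A) - L * K.
    by rewrite /r addrC addKr lnM ?posrE// expRK.
  by rewrite mulrBr mulKf ?gt_eqF// Xc; lra.
have surjX x : exists r, A < r < B /\ X r = x.
  have K0 : 0 < `|x - x0| + 1 by rewrite ltr_wpDl.
  have [r1 /andP[Ar1 r1c] Xr1] := Xlo _ K0; have [r2 /andP[cr2 r2B] Xr2] := Xhi _ K0.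
  have xK1 : x0 - (`|x - x0| + 1) <= x by have := ler_norm (- (x - x0)); rewrite normrN; lra.
  have xK2 : x <= x0 + (`|x - x0| + 1) by have := ler_norm (x - x0); lra.
  have [|||r] := @IVT _ X r1 r2 x.
  - by apply: ltW; apply: lt_trans r1c cr2.
  - apply: within_continuous => t /=; rewrite in_itv/= => /andP[rt ts].
    by apply: is_derive1_continuous (dX t _); lra.
  - by rewrite ge_min le_max (le_trans Xr1 xK1) (le_trans xK2 Xr2) orbT.
  - by rewrite in_itv/= => /andP[? ?] <-; exists r; split=> //; lra.
have [y yP] := choice surjX.
have yX r : A < r < B -> y (X r) = r.
  move=> /andP[Ar rB]; have [/andP[Ay yB] E] := yP (X r).
  have [lt|lt|//] := ltgtP (y (X r)) r.
  - by have := Xlt _ _ Ay lt rB; rewrite E ltxx.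
  - by have := Xlt _ _ Ar lt yB; rewrite E ltxx.
have yinc : {homo y : x1 x2 / x1 < x2}.
  move=> x1 x2 x12; rewrite ltNge; apply/negP => le.
  have [/andP[A1 B1] E1] := yP x1; have [/andP[A2 B2] E2] := yP x2.
  move: le; rewrite le_eqVlt => /predU1P[E|lt].
    by move: x12; rewrite -E1 -E2 E ltxx.
  by have := Xlt _ _ A2 lt B1; rewrite E1 E2 ltNge (ltW x12).
exists y; split=> //.
- by rewrite -Xc yX// Ac cB.
- move=> x; have [rAB E] := yP x; split=> //.
  rewrite -{1}E -(invrK (F (y x))).
  have nearAB : \forall z \near y x, A < z < B.
    by near=> z; apply/andP; split; near: z; [apply: lt_nbhsr|apply: lt_nbhsl]; case/andP: rAB.
  apply: is_derive_inverse.
  + by near=> z; apply: yX; near: z.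
  + by near=> z; apply: is_derive1_continuous (dX z _); near: z.
  + exact: dX.
  + by rewrite invr_eq0 gt_eqF// F0.
- suff H (e : R) : 0 < e -> \forall x \near +oo, `|B - y x| < e.
    by apply/cvgrPdist_lt => e e0; exact: H.
  move=> e0; pose r := Num.max c (B - e / 2).
  have rB : A < r < B by rewrite /r; case: (leP c) => ?; lra.
  near=> x.
  have : y (X r) < y x by apply: yinc; near: x; apply: nbhs_pinfty_gt; rewrite num_real.
  rewrite yX// => rx; have [/andP[_ yB] _] := yP x.
  rewrite ger0_norm; last by rewrite subr_ge0 ltW.
  by move: rx; rewrite /r; case: (leP c) => ?; lra.
- suff H (e : R) : 0 < e -> \forall x \near -oo, `|A - y x| < e.
    by apply/cvgrPdist_lt => e e0; exact: H.
  move=> e0; pose r := Num.min c (A + e / 2).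
  have rB : A < r < B by rewrite /r; case: (leP c) => ?; lra.
  near=> x.
  have : y x < y (X r) by apply: yinc; near: x; apply: nbhs_ninfty_lt; rewrite num_real.
  rewrite yX// => rx; have [/andP[Ay _] _] := yP x.
  rewrite ler0_norm; last by rewrite subr_le0 ltW.
  by move: rx; rewrite /r; case: (leP c) => ?; lra.
Unshelve. all: by end_near. Qed.

End ScalarODE.

(** * Comparison principles for scalar equations *)

Section ScalarODE.
Context {R : realType}.

(** The function w^2 exp (2 L t) is nondecreasing and w^2 exp (-2 L t) is nonincreasing. Comparing
    with their value 0 at [c], the first handles points to the left of [c] and the second points to
    the right. *)
Lemma gronwall_zero (w w' : R -> R) (a b c L : R) : a <= c <= b ->
  {within `[a, b], continuous w} ->
  (forall x, a < x < b -> is_derive x 1 w (w' x)) ->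
  (forall x, a < x < b -> `|w' x| <= L * `|w x|) ->
  w c = 0 -> forall x, a <= x <= b -> w x = 0.
Proof.
move=> /andP[ac cb] cw dw bw wc0 x /andP[ax xb].
have ww' t : a < t < b -> `|w t * w' t| <= L * (w t * w t).
  move=> tab; rewrite normrM mulrC -[w t * w t]ger0_norm; last first.
    by rewrite -expr2 sqr_ge0.
  by rewrite normrM mulrA; apply: ler_wpM2r (bw t tab).
pose f s t := w t * w t * expR (2 * (s * L) * t).
have df s t : a < t < b -> is_derive t 1 (f s)
   (2 * (w t * w' t + s * L * (w t * w t)) * expR (2 * (s * L) * t)).
  move=> tab; have d := dw t tab.
  apply: (is_derive1_eq (is_derive1M (is_derive1M d d)
    (is_derive1_expR_comp (is_derive1Z (2 * (s * L)) (is_derive1_id t))))); ring.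
have cf s u v : a <= u -> v <= b -> {within `[u, v], continuous (f s)}.
  move=> au vb; have cw' := within_continuousI cw au vb.
  move=> t; apply: cvgM; first by apply: cvgM; exact: cw'.
  have ce : {within `[u, v], continuous (fun t => expR (2 * (s * L) * t))}.
    apply: within_continuous => z _; exact: (is_derive1_continuous
      (is_derive1_expR_comp (is_derive1Z (2 * (s * L)) (is_derive1_id z)))).
  exact: ce.
suff : w x * w x <= 0.
  by rewrite -expr2 => h; apply/eqP; rewrite -sqrf_eq0 eq_le h sqr_ge0.
have f0 s : f s c = 0 by rewrite /f wc0 !mul0r.
have fx s : f s x <= 0 -> w x * w x <= 0 by rewrite /f pmulr_lle0 ?expR_gt0.
have [xc|cx] := leP x c.
  apply: (fx 1); rewrite -(f0 1); apply: (@derive_ge0_le _ (f 1) (fun t => 2 * (w t * w' t + 1 * L * (w t * w t)) *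
    expR (2 * (1 * L) * t)) x c xc (cf _ _ _ ax cb)).
    by move=> t tab; apply: df; lra.
  move=> t tab; rewrite mulr_ge0 ?expR_ge0// mulr_ge0//.
  have tab' : a < t < b by lra.
  by have := ww' t tab'; rewrite ler_norml; lra.
apply: (fx (-1)); rewrite -oppr_ge0.
have := @derive_ge0_le _ (fun t => - f (-1) t) (fun t =>
   - (2 * (w t * w' t + -1 * L * (w t * w t)) * expR (2 * (-1 * L) * t))) c x (ltW cx).
rewrite f0 oppr0; apply.
- by move=> t; apply: cvgN; exact: (cf _ _ _ ac xb).
- by move=> t tab; apply: is_derive1N; apply: df; lra.
- move=> t tab; rewrite oppr_ge0 pmulr_lle0 ?expR_gt0//.
  have tab' : a < t < b by lra.
  by have := ww' t tab'; rewrite ler_norml; lra.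
Qed.


(** If F r < 0, take a bump [h] supported where F < 0 and a primitive [phi] of it. Along the orbit
    phi (y x) has derivative h F <= 0, whereas moving from below [r] to above [r] increases [phi]
    strictly. *)
Lemma upcrossing_ge0 (F y : R -> R) (x1 x2 r : R) : x1 <= x2 ->
  {within `[x1, x2], continuous y} ->
  (forall x, x1 < x < x2 -> is_derive x 1 y (F (y x))) ->
  {for r, continuous F} -> y x1 < r < y x2 -> 0 <= F r.
Proof.
move=> x12 cy dy cF /andP[y1r ry2]; rewrite leNgt; apply/negP => Fr.
have [e e0 Fe] : exists2 e : R, 0 < e & forall v, `|v - r| < e -> F v < 0.
  have /nbhs_ballP[e /= e0 He] : \forall v \near r, F v < 0 by exact: (cvgr_lt _ cF).
  by exists e => // v; rewrite distrC => /He.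
have [ymax ymaxI Hmax] := EVT_max x12 cy; have [ymin yminI Hmin] := EVT_min x12 cy.
pose h v := Num.max 0 (e * e - (v - r) * (v - r)).
have ch v : {for v, continuous h}.
  apply: continuous_max; first exact: cvg_cst.
  have d := is_derive1B (is_derive1_id v) (is_derive1_cst r v).
  exact: (is_derive1_continuous (is_derive1B (is_derive1_cst (e * e) v) (is_derive1M d d))).
have [phi dphi] := @primitive_open_interval _ h (y ymin - 1 - e) (y ymax + 1 + e)
  (fun v _ => ch v).
have yI x : x1 <= x <= x2 -> y ymin - 1 - e < y x < y ymax + 1 + e.
  by move=> xI; have := Hmax x xI; have := Hmin x xI; lra.
have I1 := yI x1; have I2 := yI x2; rewrite !lexx x12 in I1 I2.
have {}I1 := I1 isT; have {}I2 := I2 isT.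
have h0 v : 0 <= h v by rewrite /h le_max lexx.
have phile u v : y ymin - 1 - e < u -> u <= v -> v < y ymax + 1 + e -> phi u <= phi v.
  move=> mu uv vM; apply: (@derive_ge0_le _ phi h) => //.
    apply: within_continuous => t /=; rewrite in_itv/= => /andP[rt ts].
    by apply: is_derive1_continuous (dphi t _); lra.
  by move=> t tuv; apply: dphi; lra.
have phiy : phi (y x2) <= phi (y x1).
  rewrite -lerN2.
  apply: (@derive_ge0_le _ (fun x => - phi (y x)) (fun x => - (h (y x) * F (y x)))) => //.
  - apply: (@within_comp_continuous _ _ y (fun v => - phi v) cy) => x.
    rewrite /= in_itv/= => /yI yxI.
    exact: (is_derive1_continuous (is_derive1N (dphi _ yxI))).
  - move=> x xI; have yxI : y ymin - 1 - e < y x < y ymax + 1 + e by apply: yI; lra.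
    exact: (is_derive1N (is_derive1_comp (dphi _ yxI) (dy x xI))).
  - move=> x xI; rewrite oppr_ge0.
    have [he|he] := ltP `|y x - r| e.
      by rewrite mulr_ge0_le0// ltW// Fe.
    rewrite /h (_ : Num.max _ _ = 0) ?mul0r//; apply/max_idPl.
    rewrite subr_le0 -!expr2 -[(_ - r) ^+ 2]real_normK ?num_real//.
    by rewrite ler_pXn2r// nnegrE// ltW.
pose s := Num.max (y x1) (r - e / 2).
have sr : s < r by rewrite /s gt_max y1r/=; lra.
have es : r - e < s by rewrite /s lt_max; apply/orP; right; lra.
have ys : y x1 <= s by rewrite /s le_max lexx.
have : phi s < phi r.
  apply: (@derive_gt0_lt _ phi h) => //.
  - apply: within_continuous => t /=; rewrite in_itv/= => /andP[rt ts].
    by apply: is_derive1_continuous (dphi t _); lra.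
  - by move=> t tuv; apply: dphi; lra.
  - move=> t /andP[st tr]; rewrite /h lt_max; apply/orP; right.
    have -> : e * e - (t - r) * (t - r) = (e - (r - t)) * (e + (r - t)) by ring.
    by apply: mulr_gt0; lra.
have p1 : phi (y x1) <= phi s by apply: phile => //; lra.
have p2 : phi r <= phi (y x2) by apply: phile; lra.
by lra.
Qed.

(** Only a lower bound on w' is assumed: this is what remains when two solutions carry different
    integration constants. At a negative minimum of w exp (-(L+1) t) one has w' = (L+1) w, which is
    below L w; at a positive maximum of w exp ((L+1) t) one has w' = -(L+1) w, which is below -L w.
    Both contradict the bound. *)
Lemma boundary_value_zero (w w' : R -> R) (L : R) :
  {within `[(0 : R), 1], continuous w} ->
  (forall x : R, 0 < x < 1 -> is_derive x 1 w (w' x)) ->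
  (forall x : R, 0 < x < 1 -> - (L * `|w x|) <= w' x) ->
  w 0 = 0 -> w 1 = 0 -> forall x : R, 0 <= x <= 1 -> w x = 0.
Proof.
move=> cw dw bw w0 w1.
pose f (s t : R) := w t * expR (s * (L + 1) * t).
have df (s t : R) : 0 < t < 1 ->
    is_derive t 1 (f s) ((w' t + s * (L + 1) * w t) * expR (s * (L + 1) * t)).
  move=> tI; apply: (is_derive1_eq (is_derive1M (dw t tI)
    (is_derive1_expR_comp (is_derive1Z (s * (L + 1)) (is_derive1_id t))))); ring.
have df' (s t : R) : t \in `]0, 1[%R -> derivable (f s) t 1.
  by rewrite in_itv/= => tI; have [] := df s t tI.
have cf s : {within `[(0 : R), 1], continuous (f s)}.
  have ce : {within `[(0 : R), 1], continuous (fun t : R => expR (s * (L + 1) * t))}.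
    apply: within_continuous => z _; exact: (is_derive1_continuous
      (is_derive1_expR_comp (is_derive1Z (s * (L + 1)) (is_derive1_id z)))).
  by move=> t; apply: cvgM; [exact: cw|exact: ce].
have f0 s : f s 0 = 0 by rewrite /f w0 mul0r.
have f1 s : f s 1 = 0 by rewrite /f w1 mul0r.
have crit (s t : R) : t \in `]0, 1[%R -> is_derive t 1 (f s) 0 ->
    w' t = - (s * (L + 1) * w t).
  rewrite in_itv/= => tI d0; have [_ e1] := df s t tI; have [_ e2] := d0.
  move: e1; rewrite e2 => /esym/eqP; rewrite mulf_eq0 expR_eq0 orbF addr_eq0.
  by move/eqP.
have interior (s t : R) : t \in `[0, 1]%R -> f s t != 0 -> t \in `]0, 1[%R.
  rewrite !in_itv/= => /andP[t0 t1] ft.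
  rewrite lt_neqAle t0 lt_neqAle t1 !andbT; apply/andP; split.
    by apply: contra_neq ft => <-.
  by apply: contra_neq ft => ->.
have w_ge0 (x : R) : 0 <= x <= 1 -> 0 <= w x.
  move=> xI; have [c cI cmin] := EVT_min ler01 (cf (-1)).
  have := cmin x xI; have [fc0 fcx|fc0 _] := leP 0 (f (-1) c).
    by move: (le_trans fc0 fcx); rewrite /f pmulr_lge0 ?expR_gt0.
  have cI' := interior _ _ cI (ltr0_neq0 fc0).
  have := @derive1_at_min _ (f (-1)) 0 1 c ler01 (df' (-1)) cI' _.
  have cmin' (t : R) : t \in `]0, 1[%R -> f (-1) c <= f (-1) t.
    by move=> tI; apply: cmin; apply: subset_itv_oo_cc tI.
  move=> /(_ cmin') /(crit _ _ cI').
  have wc : w c < 0 by move: fc0; rewrite /f pmulr_llt0 ?expR_gt0.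
  rewrite in_itv/= in cI'; have := bw c cI'.
  by rewrite ltr0_norm// => + E; rewrite E; lra.
have w_le0 (x : R) : 0 <= x <= 1 -> w x <= 0.
  move=> xI; have [c cI cmax] := EVT_max ler01 (cf 1).
  have := cmax x xI; have [fc0 fcx|fc0 _] := leP (f 1 c) 0.
    by move: (le_trans fcx fc0); rewrite /f pmulr_lle0 ?expR_gt0.
  have cI' := interior _ _ cI (lt0r_neq0 fc0).
  have := @derive1_at_max _ (f 1) 0 1 c ler01 (df' 1) cI' _.
  have cmax' (t : R) : t \in `]0, 1[%R -> f 1 t <= f 1 c.
    by move=> tI; apply: cmax; apply: subset_itv_oo_cc tI.
  move=> /(_ cmax') /(crit _ _ cI').
  have wc : 0 < w c by move: fc0; rewrite /f pmulr_lgt0 ?expR_gt0.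
  rewrite in_itv/= in cI'; have := bw c cI'.
  by rewrite gtr0_norm// => + E; rewrite E; lra.
by move=> x xI; apply/eqP; rewrite eq_le w_le0// w_ge0.
Qed.

End ScalarODE.

(** * Convexity of psi *)

Section Pressure.
Context {R : realType} {p : R -> R} {m : R}.
Hypotheses (hp : pressure_law p) (m0 : 0 < m).
Implicit Types (r s t a : R).

(** The derivative of psi. It equals c^2 - u^2 for density [r] and velocity [m / r], hence is
    negative at supersonic states, zero at characteristic ones and positive at subsonic ones. *)
Definition dpsi (R : realType) (p : R -> R) (m r : R) : R :=
  derive1 p r - m ^+ 2 / r ^+ 2.

Local Notation P := (psi p m).
Local Notation D := (dpsi p m).

Lemma is_derive_pressure r : 0 < r -> is_derive r 1 p (derive1 p r).
Proof. by move=> /hp[dp _ _ _]; rewrite derive1E; exact: derivableP. Qed.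

Lemma is_derive_dpressure r : 0 < r ->
  is_derive r 1 (derive1 p) (derive1 (derive1 p) r).
Proof. by move=> /hp[_ dp _ _]; rewrite [X in is_derive _ _ _ X]derive1E; exact: derivableP. Qed.

Lemma is_derive_psi r : 0 < r -> is_derive r 1 P (D r).
Proof.
move=> r0; rewrite /psi.
have d := is_derive1Z (m ^+ 2) (is_derive1V (is_derive1_id r) (lt0r_neq0 r0)).
apply: (is_derive1_eq (is_derive1D d (is_derive_pressure r0))).
by rewrite /dpsi; ring.
Qed.

Lemma continuous_psi r : 0 < r -> {for r, continuous P}.
Proof. by move=> r0; exact: (is_derive1_continuous (is_derive_psi r0)). Qed.

Lemma dpressure_lt r s : 0 < r -> r < s -> derive1 p r < derive1 p s.
Proof.
move=> r0 rs; apply: (@derive_gt0_lt _ _ (derive1 (derive1 p))) => //.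
- apply: within_continuous => t /=; rewrite in_itv/= => /andP[rt _].
  exact: (is_derive1_continuous (is_derive_dpressure (lt_le_trans r0 rt))).
- by move=> t /andP[rt _]; exact: (is_derive_dpressure (lt_trans r0 rt)).
- by move=> t /andP[rt _]; have [] := hp (lt_trans r0 rt).
Qed.

Lemma dpressure_le r s : 0 < r -> r <= s -> derive1 p r <= derive1 p s.
Proof.
by move=> r0; rewrite le_eqVlt => /predU1P[->//|rs]; rewrite ltW// dpressure_lt.
Qed.

Lemma pressure_tangent r s : 0 < r -> 0 < s ->
  p r + derive1 p r * (s - r) <= p s.
Proof.
move=> r0 s0.
pose f t := p t - derive1 p r * t.
have df t : 0 < t -> is_derive t 1 f (derive1 p t - derive1 p r * 1).
  move=> t0; exact: (is_derive1B (is_derive_pressure t0)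
    (is_derive1Z (derive1 p r) (is_derive1_id t))).
suff : f r <= f s by rewrite /f; lra.
have cf u v : 0 < u -> {within `[u, v], continuous f}.
  move=> u0; apply: within_continuous => t /=; rewrite in_itv/= => /andP[ut _].
  exact: (is_derive1_continuous (df _ (lt_le_trans u0 ut))).
have [rs|sr] := leP r s.
  apply: (@derive_ge0_le _ f (fun t => derive1 p t - derive1 p r * 1) r s rs (cf _ _ r0)).
    by move=> t /andP[rt _]; apply: df; exact: lt_trans rt.
  by move=> t /andP[rt _]; rewrite mulr1 subr_ge0 dpressure_le// ltW.
rewrite -lerN2; apply: (@derive_ge0_le _ (fun t => - f t)
  (fun t => - (derive1 p t - derive1 p r * 1)) s r (ltW sr)).
- apply: within_comp_continuous (cf _ _ s0) _ => t _.
  exact: (is_derive1_continuous (is_derive1N (is_derive1_id (f t)))).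
- by move=> t /andP[st _]; apply: is_derive1N; apply: df; exact: lt_trans st.
- move=> t /andP[st tr]; rewrite mulr1 oppr_ge0 subr_le0 dpressure_le//.
    exact: lt_trans st.
  exact: ltW.
Qed.

(* The term m^2/r of psi makes it uniformly convex on bounded intervals, even
   though p'' need not be continuous. *)
Lemma psi_tangent r s : 0 < r -> 0 < s ->
  P r + D r * (s - r) + m ^+ 2 * (s - r) ^+ 2 / (s * r ^+ 2) <= P s.
Proof.
move=> r0 s0; have := pressure_tangent r0 s0.
have -> : P r + D r * (s - r) + m ^+ 2 * (s - r) ^+ 2 / (s * r ^+ 2) =
   m ^+ 2 / s + (p r + derive1 p r * (s - r)).
  by rewrite /psi /dpsi; field; rewrite !gt_eqF.
by rewrite /psi lerD2l.
Qed.

Lemma psi_tangent_le r s : 0 < r -> 0 < s -> P r + D r * (s - r) <= P s.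
Proof.
move=> r0 s0; apply: le_trans (psi_tangent r0 s0); rewrite lerDl.
by rewrite divr_ge0// mulr_ge0// ?sqr_ge0// ltW.
Qed.

Lemma psi_tangent_lt r s : 0 < r -> 0 < s -> r != s -> P r + D r * (s - r) < P s.
Proof.
move=> r0 s0 rs; apply: lt_le_trans (psi_tangent r0 s0); rewrite ltrDl.
have sr : 0 < (s - r) ^+ 2 by rewrite exprn_even_gt0//= subr_eq0 eq_sym.
by apply: divr_gt0; apply: mulr_gt0 => //; exact: exprn_gt0.
Qed.

Lemma dpsi_lt r s : 0 < r -> r < s -> D r < D s.
Proof.
move=> r0 rs; have s0 := lt_trans r0 rs; rewrite /dpsi; apply: ltr_leB.
  exact: dpressure_lt.
rewrite ler_pM2l ?exprn_gt0// lef_pV2 ?posrE ?exprn_gt0//.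
by rewrite ler_pXn2r// ?nnegrE ltW.
Qed.

Lemma dpsi_le r s : 0 < r -> r <= s -> D r <= D s.
Proof.
by move=> r0; rewrite le_eqVlt => /predU1P[->//|rs]; rewrite ltW// dpsi_lt.
Qed.

Lemma dpsi_zero_exists : exists2 a, 0 < a & D a = 0.
Proof.
have p1 : 0 < derive1 p 1 by have [] := hp (@ltr01 R).
pose k := m ^+ 2 / derive1 p 1.
have k0 : 0 < k by rewrite divr_gt0// exprn_gt0.
have kE : m ^+ 2 = k * derive1 p 1 by rewrite /k divfK// gt_eqF.
pose q t := derive1 p t * t ^+ 2 - m ^+ 2.
(* The point [s] lies below both 1 and [k], so s^2 <= k and p'(s) <= p'(1); symmetrically t^2 >= k
   and p'(t) >= p'(1). Hence [q] changes sign between them. *)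
pose s := k / (1 + k); pose t := 1 + k.
have k1 : 0 < 1 + k by lra.
have s0 : 0 < s by rewrite divr_gt0.
have s1 : s < 1 by rewrite ltr_pdivrMr// mul1r; lra.
have sk : s < k by rewrite ltr_pdivrMr// ltr_pMr//; lra.
have t1 : 1 < t by rewrite /t; lra.
have st : s <= t by lra.
have [||a] := @IVT _ q s t 0 st.
- apply: within_continuous => z /=; rewrite in_itv/= => /andP[sz _].
  have z0 := lt_le_trans s0 sz.
  exact: (is_derive1_continuous (is_derive1B (is_derive1M (is_derive_dpressure z0)
    (is_derive1M (is_derive1_id z) (is_derive1_id z))) (is_derive1_cst (m ^+ 2) z))).
- have qs : q s <= 0.
    have e1 := dpressure_le s0 (ltW s1).
    have : derive1 p s * s ^+ 2 <= derive1 p 1 * k.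
      apply: ler_pM => //; [by have [_ _ /ltW] := hp s0|exact: sqr_ge0|].
      have : s * s <= k * 1 by apply: ler_pM; lra.
      by rewrite expr2 mulr1.
    by rewrite /q kE mulrC; lra.
  have qt : 0 <= q t.
    have e1 := dpressure_le (@ltr01 R) (ltW t1).
    have : derive1 p 1 * k <= derive1 p t * t ^+ 2.
      apply: ler_pM => //; [exact: ltW|exact: ltW|].
      have : k * 1 <= t * t by apply: ler_pM; rewrite /t; lra.
      by rewrite expr2 mulr1.
    by rewrite /q kE mulrC; lra.
  by rewrite ge_min le_max qs qt orbT.
- rewrite in_itv/= => /andP[sa _] qa; have a0 := lt_le_trans s0 sa.
  exists a => //; apply/eqP; have := qa; rewrite /q /dpsi => /eqP.
  rewrite !subr_eq0 eq_sym => /eqP mE.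
  by rewrite mE mulfK// sqrf_eq0 gt_eqF.
Qed.

Lemma characteristicP a : 0 < a -> characteristic p m a <-> D a = 0.
Proof.
move=> a0; have [_ _ pa _] := hp a0.
have ma : 0 < m / a by rewrite divr_gt0.
rewrite /characteristic /sound_speed /dpsi -expr_div_n; split => [->|/eqP].
  by rewrite sqr_sqrtr ?subrr// ltW.
by rewrite subr_eq0 => /eqP ->; rewrite sqrtr_sqr gtr0_norm.
Qed.

Lemma psi_lipschitz lo hi : 0 < lo -> lo <= hi -> exists2 L, 0 < L &
  forall r s, lo <= r <= hi -> lo <= s <= hi -> `|P r - P s| <= L * `|r - s|.
Proof.
move=> lo0 lohi; pose L := derive1 p hi + m ^+ 2 / lo ^+ 2.
have hi0 := lt_le_trans lo0 lohi.
have [_ _ ph _] := hp hi0.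
have mlo : 0 < m ^+ 2 / lo ^+ 2 by rewrite divr_gt0// exprn_gt0.
exists L; first by rewrite /L; lra.
have DL r : lo <= r <= hi -> `|D r| <= L.
  move=> /andP[lr rh]; have r0 := lt_le_trans lo0 lr.
  have := dpressure_le r0 rh; have [_ _ pr _] := hp r0.
  have : m ^+ 2 / r ^+ 2 <= m ^+ 2 / lo ^+ 2.
    rewrite ler_pM2l ?exprn_gt0// lef_pV2 ?posrE ?exprn_gt0//.
    by rewrite ler_pXn2r// ?nnegrE ltW.
  have : 0 < m ^+ 2 / r ^+ 2 by rewrite divr_gt0// exprn_gt0.
  by rewrite /dpsi /L ler_norml; lra.
have half r s : lo <= r <= hi -> lo <= s <= hi -> P r - P s <= L * `|r - s|.
  move=> rI sI.
  have r0 : 0 < r by case/andP: rI => lr _; exact: lt_le_trans lr.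
  have s0 : 0 < s by case/andP: sI => ls _; exact: lt_le_trans ls.
  have := psi_tangent_le r0 s0.
  have : D r * (r - s) <= L * `|r - s|.
    apply: le_trans (ler_norm _) _; rewrite normrM; apply: ler_wpM2r => //.
    exact: DL.
  by lra.
move=> r s rI sI; rewrite ler_norml half// andbT lerNl opprB distrC.
exact: half.
Qed.

(** Strict quasiconvexity: the tangent at [t] is nondecreasing towards one of the two ends, and psi
    lies strictly above it there. *)
Lemma psi_between r t s : 0 < r -> r < t -> t < s -> P t < Num.max (P r) (P s).
Proof.
move=> r0 rt ts; have t0 := lt_trans r0 rt; have s0 := lt_trans t0 ts.
rewrite lt_max; have [Dt|Dt] := leP 0 (D t).
  apply/orP; right; apply: le_lt_trans (psi_tangent_lt t0 s0 _); rewrite ?lt_eqF//.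
  by rewrite lerDl mulr_ge0// subr_ge0 ltW.
apply/orP; left; have tr : t != r by rewrite gt_eqF.
have := psi_tangent_lt t0 r0 tr.
have : 0 <= D t * (r - t) by apply: mulr_le0; [exact: ltW|rewrite subr_le0 ltW].
by lra.
Qed.

End Pressure.

(** * Orbits on a half-line and across a compact interval *)

Section OrbitConstruction.
Context {R : realType}.
Implicit Types (F g th : R -> R).

(** Here only [hi] acts as an equilibrium. The field is continued to the left of [lo] and cut down
    to an artificial zero at [lo - 1], where [K] is large enough to leave it unchanged on [lo, hi);
    the orbit through [lo] at time 0 then never sees the modification at positive times. *)
Lemma half_line_orbit F (lo hi L : R) : lo < hi ->
  (forall r, lo <= r < hi -> {for r, continuous F}) ->
  (forall r, lo <= r < hi -> 0 < F r) ->
  (forall r, lo <= r < hi -> F r <= L * (hi - r)) ->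
  exists y : R -> R, [/\ y 0 = lo, forall x, {for x, continuous y},
    forall x : R, 0 < x -> lo <= y x < hi,
    forall x : R, 0 < x -> is_derive x 1 y (F (y x)) & y x @[x --> +oo] --> hi].
Proof.
move=> lohi cF F0 FL.
have L0 : 0 < L.
  have := lt_le_trans (F0 lo _) (FL lo _); rewrite lexx lohi => /(_ isT isT).
  by rewrite pmulr_lgt0// subr_gt0.
pose A := lo - 1; pose K := L * (hi - lo) + L.
have Llohi : 0 < L * (hi - lo) by rewrite mulr_gt0// subr_gt0.
pose G r := Num.min (F (Num.max lo r)) (K * (r - A)).
have maxI r : r < hi -> lo <= Num.max lo r < hi.
  by move=> rh; rewrite le_max lexx/= gt_max lohi rh.
have GF r : lo <= r < hi -> G r = F r.
  move=> /[dup] rI /andP[lr rh]; rewrite /G (max_idPr lr); apply/min_idPl.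
  apply: le_trans (FL r rI) _.
  have : L * (hi - r) <= L * (hi - lo) by rewrite ler_pM2l//; lra.
  have : K * 1 <= K * (r - A) by rewrite ler_pM2l /K ?/A; lra.
  by rewrite /K; lra.
have loI : A < lo < hi by rewrite lohi andbT /A; lra.
have [||||y [y0 yinc dy yhi _]] := @heteroclinic_orbit _ G A hi K lo 0 loI.
- move=> r /andP[Ar rh]; apply: continuous_min.
    apply: (@continuous_comp _ _ _ (fun r => Num.max lo r) F).
      by apply: continuous_max; [exact: cvg_cst|exact: cvg_id].
    exact: (cF _ (maxI r rh)).
  exact: (is_derive1_continuous (is_derive1Z K
    (is_derive1B (is_derive1_id r) (is_derive1_cst A r)))).
- move=> r /andP[Ar rh]; rewrite /G lt_min F0 ?maxI//= mulr_gt0//; first by rewrite /K; lra.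
  by rewrite subr_gt0.
- move=> r /andP[Ar rh]; rewrite /G ge_min; apply/orP; left.
  apply: le_trans (FL _ (maxI r rh)) _; apply: le_trans (_ : L * (hi - r) <= _).
    by rewrite ler_pM2l// lerB// le_max lexx orbT.
  by rewrite ler_pM2r ?subr_gt0// /K; lra.
- by move=> r _; rewrite /G ge_min lexx orbT.
have ylo (x : R) : 0 < x -> lo <= y x < hi.
  move=> x0; have [/andP[_ ->] _] := dy x; rewrite andbT -y0 ltW//; exact: yinc.
exists y; split=> //.
- by move=> x; have [_ d] := dy x; exact: (is_derive1_continuous d).
- by move=> x x0; have [_] := dy x; rewrite GF// ylo.
Qed.

(** The same device at both ends: the field is frozen outside [lo, hi] and cut down to zero at [A]
    and [B]. The orbit is then global, monotone and confined to (A, B), and it follows [F] during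
    its passage from [lo] to [hi]. *)
Lemma transit_orbit F (A lo hi B : R) : A < lo -> lo < hi -> hi < B ->
  (forall r, lo <= r <= hi -> {for r, continuous F}) ->
  (forall r, lo <= r <= hi -> 0 < F r) ->
  exists (y : R -> R) (T : R), [/\ 0 < T, y 0 = lo /\ y T = hi,
    {homo y : x1 x2 / x1 < x2},
    (forall x, A < y x < B /\ {for x, continuous y}) &
    (forall x : R, 0 <= x <= T -> is_derive x 1 y (F (y x)))].
Proof.
move=> Alo lohi hiB cF F0.
have cFw : {within `[lo, hi], continuous F}.
  by apply: within_continuous => r; rewrite /= in_itv/=; exact: cF.
have [c cI Fc] := EVT_max (ltW lohi) cFw.
pose d := Num.min (lo - A) (B - hi); pose K := F c / d.
have d0 : 0 < d by rewrite lt_min !subr_gt0 Alo.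
have Fc0 : 0 < F c by apply: F0; rewrite in_itv/= in cI.
have K0 : 0 < K by rewrite divr_gt0.
have KF u : d <= u -> F c <= K * u.
  by move=> du; rewrite /K mulrAC ler_pdivlMr// ler_pM2l.
pose clamp r := Num.max lo (Num.min hi r).
have clI r : lo <= clamp r <= hi.
  by rewrite /clamp le_max lexx/= ge_max (ltW lohi) ge_min lexx.
have clE r : lo <= r <= hi -> clamp r = r.
  by move=> /andP[lr rh]; rewrite /clamp (min_idPr rh) (max_idPr lr).
pose G r := Num.min (F (clamp r)) (Num.min (K * (r - A)) (K * (B - r))).
have GF r : lo <= r <= hi -> G r = F r.
  move=> rI; rewrite /G clE//; apply/min_idPl; rewrite le_min.
  have Fr : F r <= F c by apply: Fc; rewrite in_itv.
  case/andP: rI => lr rh; apply/andP; split; apply: le_trans Fr _; apply: KF.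
    by rewrite /d ge_min; apply/orP; left; rewrite lerD2r.
  by rewrite /d ge_min; apply/orP; right; rewrite lerB.
have loI : A < lo < B by rewrite Alo (lt_trans lohi).
have [||||y [y0 yinc dy yB _]] := @heteroclinic_orbit _ G A B K lo 0 loI.
- move=> r _; apply: continuous_min; last apply: continuous_min.
  + apply: (@continuous_comp _ _ _ clamp F).
      apply: continuous_max; first exact: cvg_cst.
      by apply: continuous_min; [exact: cvg_cst|exact: cvg_id].
    exact: (cF _ (clI r)).
  + exact: (is_derive1_continuous (is_derive1Z K
      (is_derive1B (is_derive1_id r) (is_derive1_cst A r)))).
  + exact: (is_derive1_continuous (is_derive1Z K
      (is_derive1B (is_derive1_cst B r) (is_derive1_id r)))).
- move=> r /andP[Ar rB]; rewrite /G !lt_min (F0 _ (clI r))/=.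
  by apply/andP; split; apply: mulr_gt0; rewrite ?subr_gt0.
- by move=> r _; rewrite /G !ge_min lexx !orbT.
- by move=> r _; rewrite /G !ge_min lexx !orbT.
have cy x : {for x, continuous y}.
  by have [_ d'] := dy x; exact: (is_derive1_continuous d').
have [X hX] : exists X, hi < y X.
  have yX : \forall x \near +oo, hi < y x by exact: (cvgr_gt _ yB).
  have [M [_ MX]] := yX; by exists (M + 1); apply: MX; rewrite ltrDl ltr01.
have X0 : 0 < X.
  rewrite ltNge; apply/negP; rewrite le_eqVlt => /predU1P[XE|X0].
    by move: hX; rewrite XE y0 ltNge (ltW lohi).
  by have := lt_trans hX (yinc _ _ X0); rewrite y0 ltNge (ltW lohi).
have [||T TI yT] := @IVT _ y 0 X hi (ltW X0).
- by apply: within_continuous => x _; exact: cy.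
- by rewrite y0 ge_min le_max (ltW lohi) (ltW hX) orbT.
have T0 : 0 < T.
  rewrite lt_neqAle; move: TI; rewrite in_itv/= => /andP[-> _]; rewrite andbT.
  by apply/eqP => T0; move: lohi; rewrite -y0 -yT T0 ltxx.
exists y, T; split=> //.
- by move=> x; have [? _] := dy x; split.
- move=> x /andP[x0 xT]; have [_] := dy x; rewrite GF//.
  have ymono u v : u <= v -> y u <= y v.
    by rewrite le_eqVlt => /predU1P[->//|/yinc/ltW].
  by rewrite -y0 -yT !ymono.
Qed.

Lemma derive_bounded_le (f f' : R -> R) (a b K : R) : a <= b ->
  {within `[a, b], continuous f} ->
  (forall x, a < x < b -> is_derive x 1 f (f' x)) ->
  (forall x, a < x < b -> `|f' x| <= K) -> `|f b - f a| <= K * (b - a).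
Proof.
move=> ab cf df f0; have [abE|altb] := eqVneq a b.
  by rewrite abE !subrr normr0 mulr0.
have ltab : a < b by rewrite lt_neqAle altb.
have dfi : forall x, x \in `]a, b[%R -> is_derive x 1 f (f' x).
  by move=> x; rewrite in_itv/=; exact: df.
have [c] := MVT ltab dfi cf.
rewrite in_itv/= => cab ->; rewrite normrM (@ger0_norm _ (b - a)) ?subr_ge0//.
by apply: ler_wpM2r; [rewrite subr_ge0|exact: f0].
Qed.

Lemma lipschitz_at_continuous (f : R -> R) (x e C : R) : 0 < e -> 0 <= C ->
  (forall t, `|x - t| < e -> `|f x - f t| <= C * `|x - t|) ->
  {for x, continuous f}.
Proof.
move=> e0 C0 H; suff G (d : R) : 0 < d -> \forall t \near x, `|f x - f t| < d.
  by apply/cvgrPdist_lt => d d0; exact: G.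
move=> d0; have C1 : 0 < C + 1 by lra.
near=> t.
have te : `|x - t| < e by near: t; exact: nbhsx_ballx.
have td : `|x - t| < d / (C + 1).
  by near: t; apply: nbhsx_ballx; rewrite divr_gt0.
apply: le_lt_trans (H t te) _; apply: le_lt_trans (_ : (C + 1) * `|x - t| < _).
  by rewrite ler_wpM2r// lerDl.
by rewrite -ltr_pdivlMl// mulrC.
Unshelve. all: by end_near. Qed.

End OrbitConstruction.

(** * Shooting: solving the two-point problem by tuning [d] *)

Section TwoPointProblem.
Context {R : realType}.

(* The time needed to cross [lo, hi] is continuous in d, tends to 0 as d grows,
   and diverges logarithmically as d tends to 0, since th vanishes at a. *)
Lemma increasing_two_point_solution (g th : R -> R) (A lo a hi B L nu : R) :
  A < lo -> lo < hi -> hi < B -> lo <= a <= hi -> 0 < nu -> 0 < L ->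
  (forall r, lo <= r <= hi -> {for r, continuous g} /\ {for r, continuous th}) ->
  (forall r, lo <= r <= hi -> 0 < g r) ->
  (forall r, lo <= r <= hi -> 0 <= th r <= L * `|r - a|) ->
  exists (d : R) (y : R -> R), [/\ 0 < d, y 0 = lo /\ y 1 = hi,
    {homo y : x1 x2 / x1 < x2},
    (forall x, A < y x < B /\ {for x, continuous y}) &
    (forall x : R, 0 <= x <= 1 ->
       is_derive x 1 y (nu^-1 * (g (y x) * (d + th (y x)))))].
Proof.
move=> Alo lohi hiB /andP[loa ahi] nu0 L0 cgth g0 thL.
pose cl r := Num.max lo (Num.min hi r).
have clI r : lo <= cl r <= hi.
  by rewrite /cl le_max lexx/= ge_max (ltW lohi) ge_min lexx.
have clE r : lo <= r <= hi -> cl r = r.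
  by move=> /andP[lr rh]; rewrite /cl (min_idPr rh) (max_idPr lr).
have ccl r : {for r, continuous cl}.
  apply: continuous_max; first exact: cvg_cst.
  by apply: continuous_min; [exact: cvg_cst|exact: cvg_id].
have th0 r : 0 <= th (cl r) by have /andP[] := thL _ (clI r).
have cgw : {within `[lo, hi], continuous g}.
  by apply: within_continuous => r; rewrite /= in_itv/= => /cgth[].
have [rm rmI Hm] := EVT_min (ltW lohi) cgw; have [rM rMI HM] := EVT_max (ltW lohi) cgw.
rewrite !in_itv/= in rmI rMI.
pose gm := g rm; pose gM := g rM.
have gm0 : 0 < gm by exact: g0.
have gM0 : 0 < gM by exact: g0.
have gmP r : gm <= g (cl r) by apply: Hm; rewrite in_itv/=.
have gMP r : g (cl r) <= gM by apply: HM; rewrite in_itv/=.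
pose h d r := (g (cl r) * (d + th (cl r)))^-1.
have dth d r : 0 < d -> 0 < d + th (cl r) by move=> d0; rewrite ltr_wpDr.
have hpos d r : 0 < d -> 0 < g (cl r) * (d + th (cl r)).
  by move=> d0; rewrite mulr_gt0 ?dth// g0.
have ch d r : 0 < d -> {for r, continuous (h d)}.
  move=> d0; apply: cvgV; first by rewrite gt_eqF ?hpos.
  have [cg cth] := cgth _ (clI r).
  apply: cvgM; first exact: (@continuous_comp _ _ _ cl g _ (ccl r) cg).
  apply: cvgD; first exact: cvg_cst.
  exact: (@continuous_comp _ _ _ cl th _ (ccl r) cth).
have /choice[H dH] : forall d, exists H : R -> R, 0 < d ->
    forall r, lo - 1 < r < hi + 1 -> is_derive r 1 H (h d r).
  move=> d; have [d0|d0] := ltP 0 d; last first.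
    by exists (cst 0).
  have [H dH] := @primitive_open_interval _ (h d) (lo - 1) (hi + 1) (fun r _ => ch d r d0).
  by exists H => _.
have dH' d r : 0 < d -> lo <= r <= hi -> is_derive r 1 (H d) (h d r).
  by move=> d0 rI; apply: dH => //; lra.
have cH d u v : 0 < d -> lo <= u -> v <= hi -> {within `[u, v], continuous (H d)}.
  move=> d0 lu vh; apply: within_continuous => r /=; rewrite in_itv/= => rI.
  by apply: is_derive1_continuous (dH' d r d0 _); lra.
have Hmono d u v : 0 < d -> lo <= u -> u <= v -> v <= hi -> H d u <= H d v.
  move=> d0 lu uv vh; apply: (@derive_ge0_le _ _ (h d)) => //; first exact: cH.
    by move=> r rI; apply: dH' => //; lra.
  by move=> r rI; rewrite invr_ge0 ltW// hpos.
(* The crossing time at unit viscosity; crossing in unit time at viscosity [nu] means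
   [T d = nu^-1]. *)
pose T d := H d hi - H d lo.
have Tup d : 0 < d -> T d <= (gm * d)^-1 * (hi - lo).
  move=> d0; apply: le_trans (ler_norm _) _.
  apply: (@derive_bounded_le _ (H d) (h d)); [exact: ltW|exact: cH| |].
    by move=> r rI; apply: dH' => //; lra.
  move=> r rI; rewrite gtr0_norm ?invr_gt0 ?hpos// lef_pV2 ?posrE ?hpos ?mulr_gt0//.
  by apply: ler_pM => //; [exact: ltW|exact: ltW|rewrite lerDl].
have Tlip k d e : 0 < k -> k <= d -> k <= e ->
    `|T d - T e| <= (gm * k * k)^-1 * (hi - lo) * `|d - e|.
  move=> k0 kd ke; have d0 := lt_le_trans k0 kd; have e0 := lt_le_trans k0 ke.
  have -> : T d - T e = (H d hi - H e hi) - (H d lo - H e lo) by rewrite /T; ring.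
  have -> : (gm * k * k)^-1 * (hi - lo) * `|d - e| =
    (`|d - e| * (gm * k * k)^-1) * (hi - lo) by ring.
  apply: (@derive_bounded_le _ (fun r => H d r - H e r) (fun r => h d r - h e r)).
  - exact: ltW.
  - by move=> t; apply: cvgB; exact: cH.
  - by move=> r rI; apply: is_derive1B; apply: dH' => //; lra.
  - move=> r rI.
    have D0 := dth d r d0; have E0 := dth e r e0; have G0 := g0 _ (clI r).
    have -> : h d r - h e r =
        (e - d) * (g (cl r) * (d + th (cl r)) * (e + th (cl r)))^-1.
      by rewrite /h; field; rewrite !gt_eqF.
    rewrite normrM distrC; apply: ler_wpM2l => //.
    rewrite gtr0_norm ?invr_gt0 ?mulr_gt0// lef_pV2 ?posrE ?mulr_gt0//.
    have := th0 r => t0.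
    apply: ler_pM; [by rewrite mulr_ge0// ltW|exact: ltW| |by lra].
    by apply: ler_pM; [exact: ltW|exact: ltW|exact: gmP|lra].
have cT d : 0 < d -> {for d, continuous T}.
  move=> d0; have k0 : 0 < d / 2 by lra.
  apply: (@lipschitz_at_continuous _ T d (d / 2) ((gm * (d / 2) * (d / 2))^-1 * (hi - lo))) => //.
    by rewrite mulr_ge0 ?invr_ge0 ?mulr_ge0 ?subr_ge0 ?ltW.
  move=> t; rewrite ltr_norml => td; apply: Tlip => //; lra.
pose c := (gM * L)^-1; have c0 : 0 < c by rewrite invr_gt0 mulr_gt0.
(* Only the part of [lo, hi] on one side of [a] is kept, of length [l]: the right one if a < hi,
   otherwise the left one. There th <= L |r - a|, so the integrand is at least c L / (d + L |r -
   a|), whose integral is a logarithm. *)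
have [l l0 Tlow] : exists2 l : R, 0 < l & forall d, 0 < d -> c * (ln (L * l) - ln d) <= T d.
  have lnle d l : 0 < d -> 0 < l -> c * ln (L * l) <= c * ln (d + L * l).
    move=> d0 l0; have Ll : 0 < L * l by rewrite mulr_gt0.
    by rewrite ler_pM2l// ler_ln ?posrE//; lra.
  have hlow d r u : 0 < d -> 0 < u -> `|cl r - a| <= u -> 0 <= h d r - c * (L / (d + L * u)).
    move=> d0 u0 ru; have Lu : 0 < L * u by rewrite mulr_gt0.
    have -> : c * (L / (d + L * u)) = (gM * (d + L * u))^-1.
      by rewrite /c; field; rewrite !gt_eqF//; lra.
    rewrite subr_ge0 lef_pV2 ?posrE ?hpos ?mulr_gt0//; last by lra.
    apply: ler_pM; [by rewrite ltW// g0|by rewrite ltW// dth|exact: gMP|].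
    rewrite lerD2l; have /andP[_ H1] := thL _ (clI r).
    by apply: le_trans H1 _; rewrite ler_pM2l.
  have [ah|ha] := ltP a hi.
    exists (hi - a); first by rewrite subr_gt0.
    move=> d d0; pose f r := H d r - c * ln (d + L * (r - a)).
    have df r : a <= r <= hi -> is_derive r 1 f (h d r - c * ((0 + L * (1 - 0)) / (d + L * (r - a)))).
      move=> rI; have p0 : 0 <= L * (r - a) by apply: mulr_ge0; lra.
      have rI' : lo <= r <= hi by lra.
      have di := is_derive1D (is_derive1_cst d r)
        (is_derive1Z L (is_derive1B (is_derive1_id r) (is_derive1_cst a r))).
      have dp : 0 < d + L * (r - a) by lra.
      exact: (is_derive1B (dH' d r d0 rI') (is_derive1Z c (is_derive1_ln_comp di dp))).
    have : f a <= f hi.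
      apply: (@derive_ge0_le _ f _ _ _ ahi _ (fun r rI => df r _)) => [|r /andP[/ltW->/ltW->]//|r rI].
        apply: within_continuous => r /=; rewrite in_itv/= => rI.
        exact: (is_derive1_continuous (df r rI)).
      rewrite add0r subr0 mulr1; apply: hlow => //; first by rewrite subr_gt0; lra.
      by rewrite clE ?gtr0_norm ?subr_gt0//; lra.
    have := Hmono d lo a d0 (lexx _) loa ahi.
    have := lnle d (hi - a) d0; rewrite subr_gt0 => /(_ ah).
    by rewrite /f subrr mulr0 addr0 /T; lra.
  have la : lo < a by rewrite (lt_le_trans lohi).
  exists (a - lo); first by rewrite subr_gt0.
  move=> d d0; pose f r := H d r + c * ln (d + L * (a - r)).
  have df r : lo <= r <= a -> is_derive r 1 f (h d r + c * ((0 + L * (0 - 1)) / (d + L * (a - r)))).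
    move=> rI; have p0 : 0 <= L * (a - r) by apply: mulr_ge0; lra.
    have rI' : lo <= r <= hi by lra.
    have di := is_derive1D (is_derive1_cst d r)
      (is_derive1Z L (is_derive1B (is_derive1_cst a r) (is_derive1_id r))).
    have dp : 0 < d + L * (a - r) by lra.
    exact: (is_derive1D (dH' d r d0 rI') (is_derive1Z c (is_derive1_ln_comp di dp))).
  have : f lo <= f a.
    apply: (@derive_ge0_le _ f _ _ _ loa _ (fun r rI => df r _)) => [|r /andP[/ltW->/ltW->]//|r rI].
      apply: within_continuous => r /=; rewrite in_itv/= => rI.
      exact: (is_derive1_continuous (df r rI)).
    have -> : 0 + L * (0 - 1) = - L :> R by ring.
    rewrite mulNr mulrN; apply: hlow => //; first by rewrite subr_gt0; lra.
    by rewrite clE ?ltr0_norm ?subr_lt0//; lra.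
  have := Hmono d a hi d0 loa ahi (lexx _).
  have := lnle d (a - lo) d0; rewrite subr_gt0 => /(_ la).
  by rewrite /f subrr mulr0 addr0 /T; lra.
have nuV0 : 0 < nu^-1 by rewrite invr_gt0.
(* At [d1] the speed is at least nu (hi - lo), so [T d1 <= nu^-1]. The value [d2] below is small
   enough for the logarithmic lower bound to reach [nu^-1], and the intermediate value theorem
   applies between the two. *)
pose d1 := nu * (hi - lo) / gm.
have d10 : 0 < d1 by rewrite divr_gt0// mulr_gt0// subr_gt0.
have Td1 : T d1 <= nu^-1.
  apply: le_trans (Tup _ d10) _; rewrite /d1 le_eqVlt; apply/orP; left; apply/eqP.
  by field; rewrite !gt_eqF// subr_gt0.
pose d2 := Num.min d1 (L * l * expR (- (nu * c)^-1)).
have Ll0 : 0 < L * l by rewrite mulr_gt0.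
have d20 : 0 < d2 by rewrite lt_min d10 mulr_gt0 ?expR_gt0.
have Td2 : nu^-1 <= T d2.
  apply: le_trans (Tlow _ d20).
  have : ln d2 <= ln (L * l) - (nu * c)^-1.
    rewrite -[X in _ - X]opprK opprK -[X in _ <= _ + X]expRK -lnM ?posrE ?expR_gt0//.
    rewrite ler_ln ?posrE ?mulr_gt0 ?expR_gt0//.
    by rewrite /d2 ge_min lexx orbT.
  have -> : nu^-1 = c * (nu * c)^-1 by field; rewrite !gt_eqF.
  by rewrite ler_pM2l//; lra.
have d21 : d2 <= d1 by rewrite /d2 ge_min lexx.
have [||d dI Td] := @IVT _ T d2 d1 nu^-1 d21.
- apply: within_continuous => d /=; rewrite in_itv/= => /andP[d2d _].
  by apply: cT; exact: lt_le_trans d2d.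
- by rewrite ge_min le_max Td1 Td2 orbT.
have d0 : 0 < d by move: dI; rewrite in_itv/= => /andP[d2d _]; exact: lt_le_trans d2d.
have [||y [t [t0 [y0 yt] yinc yAB dy]]] :=
    @transit_orbit _ (fun r => nu^-1 * (g r * (d + th r))) A lo hi B Alo lohi hiB.
- move=> r rI; have [cg cth] := cgth _ rI.
  by apply: cvgM; [exact: cvg_cst|apply: cvgM => //; apply: cvgD => //; exact: cvg_cst].
- move=> r rI; rewrite mulr_gt0// mulr_gt0 ?g0// ltr_wpDr//.
  by have /andP[] := thL _ rI.
have ymono u v : u <= v -> y u <= y v by rewrite le_eqVlt => /predU1P[->//|/yinc/ltW].
(* The quantity H d (y x) - x / nu is constant along the orbit, so the transit time [t] equals nu T
   d = 1. *)
have dHy x : 0 <= x <= t -> is_derive x 1 (fun x => H d (y x) - nu^-1 * x) 0.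
  move=> xI; have yI : lo <= y x <= hi.
    by case/andP: xI => x0 xt; rewrite -y0 -yt !ymono.
  apply: (is_derive1_eq (is_derive1B (is_derive1_comp (dH' d _ d0 yI) (dy x xI))
    (is_derive1Z nu^-1 (is_derive1_id x)))).
  have := hpos d (y x) d0; rewrite /h clE// => hp0.
  by field; rewrite !gt_eqF//; move: hp0; rewrite pmulr_rgt0// g0.
have : `|(H d (y t) - nu^-1 * t) - (H d (y 0) - nu^-1 * 0)| <= 0 * (t - 0).
  apply: (@derive_bounded_le _ (fun x => H d (y x) - nu^-1 * x) (fun=> 0)).
  - exact: ltW.
  - apply: within_continuous => x /=; rewrite in_itv/= => xI.
    exact: (is_derive1_continuous (dHy x xI)).
  - by move=> x xI; apply: dHy; lra.
  - by move=> x _; rewrite normr0.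
rewrite mul0r normr_le0 yt y0 mulr0 subr0 => /eqP E.
have tE : t = 1.
  have : nu^-1 * t = nu^-1 * 1 by rewrite mulr1; move: E Td; rewrite /T; lra.
  by move/mulfI; apply; rewrite gt_eqF.
by rewrite tE in yt dy; exists d, y; split.
Qed.

End TwoPointProblem.

(** * Convergent half-line orbits: necessary and sufficient sign conditions *)

Section HalfLineOrbits.
Context {R : realType}.

(** On a unit time interval far out, the increment of [y] is by the mean value theorem a value of F
    (y) close to F A, while convergence makes the same increment small. *)
Lemma limit_equilibrium (F y : R -> R) (A : R) : {for A, continuous F} ->
  (forall x : R, 0 < x -> is_derive x 1 y (F (y x))) ->
  y x @[x --> +oo] --> A -> F A = 0.
Proof.
move=> cF dy yA; apply/eqP/negPn/negP => FA0.
pose e := `|F A| / 4; have e0 : 0 < e by rewrite divr_gt0// normr_gt0.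
have FyA : F (y x) @[x --> +oo] --> F A by exact: (cvg_comp _ _ yA cF).
have [M [_ HM]] : \forall x \near +oo, `|A - y x| < e /\ `|F A - F (y x)| < e.
  near=> x; split; near: x.
    by move/cvgrPdist_lt : yA; exact.
  by move/cvgrPdist_lt : FyA; exact.
pose X := Num.max M 0 + 1.
have X0 : 0 < X by rewrite ltr_wpDl// le_max lexx orbT.
have HX x : X <= x -> `|A - y x| < e /\ `|F A - F (y x)| < e.
  move=> Xx; apply: HM; apply: lt_le_trans Xx.
  by rewrite /X; apply: le_lt_trans (_ : Num.max M 0 < _); rewrite ?le_max ?lexx// ltrDl.
have dyX x : X <= x -> is_derive x 1 y (F (y x)).
  by move=> Xx; apply: dy; exact: lt_le_trans Xx.
have XX : X < X + 1 by rewrite ltrDl.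
have dyI x : x \in `]X, X + 1[%R -> is_derive x 1 y (F (y x)).
  by rewrite in_itv/= => /andP[/ltW/dyX].
have cy : {within `[X, X + 1], continuous y}.
  apply: within_continuous => x; rewrite /= in_itv/= => /andP[Xx _].
  exact: (is_derive1_continuous (dyX x Xx)).
have [c] := MVT XX dyI cy.
rewrite in_itv/= => /andP[Xc _] E.
have [yX _] := HX X (lexx _); have [yX1 _] := HX (X + 1) (ltW XX).
have [_ Fc] := HX c (ltW Xc).
have : `|F A| <= `|F A - F (y c)| + `|y (X + 1) - A| + `|A - y X|.
  have FE : F A = (F A - F (y c)) + (y (X + 1) - A) + (A - y X).
    have -> : F (y c) = y (X + 1) - y X by rewrite E; ring.
    by ring.
  rewrite {1}FE; apply: le_trans (ler_normD _ _) _; rewrite lerD2r.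
  exact: ler_normD.
rewrite (distrC (y (X + 1))) => H.
have : `|F A| = 4 * e by rewrite /e; field.
by lra.
Unshelve. all: by end_near. Qed.

(** The orbit takes every value in [c, A). It cannot take the value of an equilibrium, since
    Gronwall would keep it there forever, and upward crossing forces F >= 0. The starting value [c]
    is not crossed from below, so it is handled by continuity: F c < 0 would make [F] negative
    slightly above [c]. *)
Let increasing_direction (F y : R -> R) (c A : R) :
  {within `[0, +oo[, continuous y} -> y 0 = c ->
  (forall x : R, 0 < x -> is_derive x 1 y (F (y x))) ->
  y x @[x --> +oo] --> A ->
  (forall r, c <= r < A -> {for r, continuous F}) ->
  (forall r X, c <= r < A -> F r = 0 -> 0 < X -> exists L, forall x,
     0 < x < X -> `|F (y x)| <= L * `|y x - r|) ->
  forall r, c <= r < A -> 0 < F r.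
Proof.
move=> cy y0 dy yA cF lipF.
have escape r : r < A -> exists2 X, 0 < X & r < y X.
  move=> rA; have [M [_ HM]] : \forall x \near +oo, r < y x by exact: (cvgr_gt _ yA).
  exists (Num.max M 0 + 1); first by rewrite ltr_wpDl// le_max lexx orbT.
  apply: HM; apply: le_lt_trans (_ : Num.max M 0 < _); last by rewrite ltrDl.
  by rewrite le_max lexx.
have cyX X : {within `[0, X], continuous y}.
  by apply: continuous_subspaceW cy; apply: subset_itv; rewrite bnd_simp.
have nonzero r : c <= r < A -> F r != 0.
  move=> /[dup] rI /andP[cr rA]; apply/eqP => Fr.
  have [X X0 rX] := escape r rA; have [L HL] := lipF r X rI Fr X0.
  have [|t] := @IVT _ y 0 X r (ltW X0) (cyX X).
    by rewrite y0 ge_min le_max cr (ltW rX) orbT.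
  rewrite in_itv/= => tI yt.
  have cw : {within `[0, X], continuous (fun x => y x - r)}.
    by move=> x; apply: cvgB; [exact: cyX|exact: cvg_cst].
  have dw x : 0 < x < X -> is_derive x 1 (fun x => y x - r) (F (y x)).
    move=> /andP[x0 _].
    by have := is_derive1B (dy x x0) (is_derive1_cst r x); rewrite subr0.
  have yt0 : y t - r = 0 by rewrite yt subrr.
  have := gronwall_zero tI cw dw HL yt0.
  move=> /(_ X); rewrite lexx (ltW X0) => /(_ isT) /eqP.
  by rewrite subr_eq0 => /eqP E; move: rX; rewrite E ltxx.
have ge0 r : c < r < A -> 0 <= F r.
  move=> /andP[cr rA]; have [X X0 rX] := escape r rA.
  apply: (@upcrossing_ge0 _ F y 0 X r (ltW X0) (cyX X)).
  - by move=> x /andP[x0 _]; exact: dy.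
  - by apply: cF; rewrite (ltW cr).
  - by rewrite y0 cr.
move=> r /[dup] rI /andP[cr rA]; rewrite lt_neqAle eq_sym nonzero//=.
have [cEr|cNr] := eqVneq c r; last by apply: ge0; rewrite lt_neqAle cNr cr.
rewrite leNgt; apply/negP => Fr.
have /nbhs_ballP[e /= e0 He] : \forall v \near r, F v < 0 by exact: (cvgr_lt _ (cF r rI)).
pose s := Num.min (r + e / 2) ((r + A) / 2).
have e0' : (0 : R) < e by [].
have rs : r < s by rewrite /s lt_min; apply/andP; split; lra.
have sA : s < A by rewrite /s gt_min; apply/orP; right; lra.
have se : s < r + e by rewrite /s gt_min; apply/orP; left; lra.
have := ge0 s; rewrite cEr rs sA => /(_ isT); rewrite leNgt => /negP; apply.
by apply: He; rewrite /ball/= distrC gtr0_norm; lra.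
Qed.

Lemma half_line_direction (F y : R -> R) (c A : R) :
  {within `[0, +oo[, continuous y} -> y 0 = c ->
  (forall x : R, 0 < x -> is_derive x 1 y (F (y x))) ->
  y x @[x --> +oo] --> A ->
  (forall r, (c <= r < A) || (A < r <= c) -> {for r, continuous F}) ->
  (forall r X, (c <= r < A) || (A < r <= c) -> F r = 0 -> 0 < X ->
     exists L, forall x, 0 < x < X -> `|F (y x)| <= L * `|y x - r|) ->
  forall r, (c <= r < A) || (A < r <= c) -> 0 < F r * (A - c).
Proof.
move=> cy y0 dy yA cF lipF r /orP[rI|rI].
  have cA : 0 < A - c by rewrite subr_gt0; case/andP: rI => cr rA; exact: le_lt_trans rA.
  rewrite mulr_gt0//; apply: (increasing_direction cy y0 dy yA) rI.
    by move=> s sI; apply: cF; rewrite sI.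
  by move=> s X sI; apply: lipF; rewrite sI.
have cA : A - c < 0 by rewrite subr_lt0; case/andP: rI => Ar rc; exact: lt_le_trans rc.
(* A decreasing approach is the increasing one for - y and the field - F (- v). *)
have flip s : (- c <= s < - A) = (A < - s <= c).
  by rewrite lerNl ltrNr andbC.
have cNy : {within `[0, +oo[, continuous (fun x => - y x)}.
  by move=> x; apply: cvgN; exact: cy.
have dNy (x : R) : 0 < x -> is_derive x 1 (fun x => - y x) (- F (- - y x)).
  by move=> x0; rewrite opprK; apply: is_derive1N; exact: dy.
have Ny0 : - y 0 = - c by rewrite y0.
have NyA : - y x @[x --> +oo] --> - A by exact: cvgN.
have cG s : - c <= s < - A -> {for s, continuous (fun v => - F (- v))}.
  rewrite flip => sI; have cFs : {for - s, continuous F} by apply: cF; rewrite sI orbT.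
  apply: (@continuousN _ _ _ (fun v => F (- v))).
  apply: (@continuous_comp _ _ _ (fun v : R => - v) F) => //.
  exact: (is_derive1_continuous (is_derive1N (is_derive1_id s))).
have := @increasing_direction (fun v => - F (- v)) (fun x => - y x) (- c) (- A)
  cNy Ny0 dNy NyA cG _ (- r).
rewrite flip !opprK rI => H.
rewrite nmulr_lgt0// -oppr_gt0; apply: H => //.
move=> s X; rewrite flip => sI /eqP; rewrite oppr_eq0 => /eqP Fs X0.
have [|L HL] := lipF (- s) X _ Fs X0; first by rewrite sI orbT.
exists L => x xI; rewrite normrN opprK.
by rewrite (_ : - y x - s = - (y x - - s)) ?normrN ?HL//; ring.
Qed.

Lemma half_line_orbit_towards (F : R -> R) (c A L : R) : c != A ->
  (forall r, (c <= r < A) || (A < r <= c) -> {for r, continuous F}) ->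
  (forall r, (c <= r < A) || (A < r <= c) -> 0 < F r * (A - c)) ->
  (forall r, (c <= r < A) || (A < r <= c) -> `|F r| <= L * `|A - r|) ->
  exists y : R -> R, [/\ y 0 = c, forall x, {for x, continuous y},
    forall x : R, 0 < x -> (c <= y x < A) || (A < y x <= c),
    forall x : R, 0 < x -> is_derive x 1 y (F (y x)) & y x @[x --> +oo] --> A].
Proof.
move=> cneA cF F0 FL; have [cA|Ac|cA] := ltgtP c A; last by rewrite cA eqxx in cneA.
  have [|||y [y0 cy yI dy yA]] := @half_line_orbit _ F c A L cA.
  - by move=> r rI; apply: cF; rewrite rI.
  - by move=> r rI; have := F0 r; rewrite rI pmulr_lgt0 ?subr_gt0//; exact.
  - move=> r rI; apply: le_trans (ler_norm _) _; have := FL r; rewrite rI => /(_ isT).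
    by rewrite (@gtr0_norm _ (A - r))// subr_gt0; case/andP: rI.
  by exists y; split=> // x x0; rewrite yI.
have flip s : (- c <= s < - A) = (A < - s <= c) by rewrite lerNl ltrNr andbC.
have NcA : - c < - A by rewrite ltrN2.
have [|||y [y0 cy yI dy yA]] := @half_line_orbit _ (fun v => - F (- v)) (- c) (- A) L NcA.
- move=> s; rewrite flip => sI.
  have cFs : {for - s, continuous F} by apply: cF; rewrite sI orbT.
  apply: (@continuousN _ _ _ (fun v => F (- v))).
  apply: (@continuous_comp _ _ _ (fun v : R => - v) F) => //.
  exact: (is_derive1_continuous (is_derive1N (is_derive1_id s))).
- move=> s; rewrite flip => sI; rewrite oppr_gt0.
  by have := F0 (- s); rewrite sI orbT nmulr_lgt0 ?subr_lt0//; exact.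
- move=> s; rewrite flip => sI; apply: le_trans (ler_norm _) _; rewrite normrN.
  have := FL (- s); rewrite sI orbT opprK => /(_ isT).
  have As : A + s < 0 by rewrite -ltrBrDr sub0r; case/andP: sI.
  by rewrite (ltr0_norm As) opprD.
exists (fun x => - y x); split.
- by rewrite y0 opprK.
- by move=> x; apply: (@continuousN _ _ _ y); exact: cy.
- by move=> x x0; rewrite -flip yI// orbT.
- by move=> x x0; have := is_derive1N (dy x x0); rewrite opprK.
- by rewrite -[A]opprK; exact: cvgN.
Qed.

End HalfLineOrbits.

(** * Half-line profiles of the steady equation *)

Section Layers.
Context {R : realType} {p : R -> R} {m nu : R}.
Hypotheses (hp : pressure_law p) (m0 : 0 < m) (nu0 : 0 < nu).
Implicit Types (r s c A b lo hi : R).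

Local Notation P := (psi p m).
Local Notation D := (dpsi p m).

Let F b r := (m * nu)^-1 * (r ^+ 2 * (b - P r)).

Let mnu0 : 0 < m * nu. Proof. exact: mulr_gt0. Qed.

Let mnuV0 : 0 < (m * nu)^-1. Proof. by rewrite invr_gt0. Qed.

Lemma profile_eqP b rho x :
  profile_eq p m nu b rho x <-> 0 < rho x /\ is_derive x 1 rho (F b (rho x)).
Proof.
split=> [[r0 dr E]|[r0 dr]].
  split=> //; rewrite /F -E mulKf ?gt_eqF// derive1E; exact: derivableP.
have [dr1 _] := dr; split=> //.
by rewrite (is_derive1E dr) /F mulVKf// gt_eqF.
Qed.

Let F_eq0 (sg b s : R) : sg != 0 -> 0 < s -> sg * F b s = 0 -> b = P s.
Proof.
move=> sg0 s0 /eqP; have k0 : sg * ((m * nu)^-1 * s ^+ 2) != 0.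
  by apply: mulf_neq0 => //; apply: mulf_neq0; rewrite ?expf_neq0 ?gt_eqF.
have -> : sg * F b s = sg * ((m * nu)^-1 * s ^+ 2) * (b - P s) by rewrite /F; ring.
by rewrite mulf_eq0 (negPf k0) subr_eq0 => /eqP.
Qed.

Let cF b r : 0 < r -> {for r, continuous (F b)}.
Proof.
move=> r0; have dP := is_derive_psi (m := m) hp r0.
have -> : F b = fun t => (m * nu)^-1 * (t * t * (b - P t)) by [].
have H1 := is_derive1M (is_derive1M (is_derive1_id r) (is_derive1_id r))
    (is_derive1B (is_derive1_cst b r) dP).
have H2 := is_derive1Z (m * nu)^-1 H1.
exact (is_derive1_continuous H2).
Qed.

Let F_lipschitz lo hi : 0 < lo -> lo <= hi -> exists2 L, 0 < L &
  forall r s, lo <= r <= hi -> lo <= s <= hi -> `|F (P r) s| <= L * `|s - r|.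
Proof.
move=> lo0 lohi; have [L L0 HL] := psi_lipschitz hp m0 lo0 lohi.
have hi0 := lt_le_trans lo0 lohi.
exists ((m * nu)^-1 * (hi ^+ 2 * L)); first by rewrite !mulr_gt0// exprn_gt0.
move=> r s rI sI; rewrite /F normrM (gtr0_norm mnuV0) -[leRHS]mulrA ler_pM2l// normrM -[leRHS]mulrA.
case/andP: (sI) => ls sh.
apply: ler_pM => //; last by rewrite (distrC s); exact: HL.
rewrite ger0_norm ?sqr_ge0// ler_pXn2r// nnegrE ltW//.
exact: lt_le_trans ls.
Qed.

Lemma continuous_dpsi r : 0 < r -> {for r, continuous D}.
Proof.
move=> r0; have dr := is_derive1M (is_derive1_id r) (is_derive1_id r).
have r20 : r * r != 0 by rewrite mulf_neq0 ?gt_eqF.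
exact: (is_derive1_continuous (is_derive1B (is_derive_dpressure hp r0)
  (is_derive1Z (m ^+ 2) (is_derive1V dr r20)))).
Qed.

(* sg = 1 follows a profile to the right, sg = -1 to the left. *)
Lemma half_profile_direction (sg b c A : R) (y : R -> R) : sg != 0 -> 0 < c -> 0 < A ->
  {within `[0, +oo[, continuous y} -> y 0 = c ->
  (forall x : R, 0 < x -> 0 < y x /\ is_derive x 1 y (sg * F b (y x))) ->
  y x @[x --> +oo] --> A ->
  b = P A /\ (forall r, (c <= r < A) || (A < r <= c) -> 0 < sg * (P A - P r) * (A - c)).
Proof.
move=> sg0 c0 A0 cy y0 dy yA.
have csF r : 0 < r -> {for r, continuous (fun r => sg * F b r)}.
  by move=> r0; apply: cvgM; [exact: cvg_cst|exact: cF].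
have dy' (x : R) : 0 < x -> is_derive x 1 y (sg * F b (y x)) by move=> /dy[].
have bA : b = P A.
  exact: F_eq0 sg0 A0 (limit_equilibrium (csF A A0) dy' yA).
split=> // r rI.
have rpos s : (c <= s < A) || (A < s <= c) -> 0 < s.
  by move=> /orP[/andP[cs _]|/andP[As _]]; [exact: lt_le_trans cs|exact: lt_trans As].
have r0 := rpos r rI.
have := @half_line_direction _ (fun r => sg * F b r) y c A cy y0 dy' yA _ _ r rI.
(* On [0, X] the orbit stays in a compact set of positive densities, where the field is Lipschitz;
   at an equilibrium [s] this gives the Gronwall bound. *)
have lip s X : (c <= s < A) || (A < s <= c) -> sg * F b s = 0 -> 0 < X ->
   exists L, forall x : R, 0 < x < X -> `|sg * F b (y x)| <= L * `|y x - s|.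
  move=> /rpos s0 /(F_eq0 sg0 s0) bs X0.
  have cyX : {within `[0, X], continuous y}.
    by apply: continuous_subspaceW cy; apply: subset_itv; rewrite bnd_simp.
  have [ymax ymaxI Hmax] := EVT_max (ltW X0) cyX.
  have [ymin yminI Hmin] := EVT_min (ltW X0) cyX.
  have yp (x : R) : 0 <= x -> 0 < y x.
    by rewrite le_eqVlt => /predU1P[<-|/dy[]//]; rewrite y0.
  pose lo := Num.min s (y ymin); pose hi := Num.max s (y ymax).
  have lo0 : 0 < lo by rewrite lt_min s0 yp//; move: yminI; rewrite in_itv/= => /andP[].
  have sI : lo <= s <= hi by rewrite /lo /hi ge_min le_max !lexx.
  have lohi : lo <= hi by case/andP: sI; exact: le_trans.
  have [L L0 HL] := F_lipschitz lo0 lohi.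
  exists (`|sg| * L) => x xI; rewrite normrM bs -mulrA; apply: ler_wpM2l => //.
  apply: HL => //; have xI' : x \in `[0, X]%R by rewrite in_itv/=; lra.
  by rewrite /lo /hi ge_min le_max Hmin ?Hmax ?orbT.
move=> /(_ _ lip); rewrite /F bA.
have -> : sg * ((m * nu)^-1 * (r ^+ 2 * (P A - P r))) * (A - c) =
   ((m * nu)^-1 * r ^+ 2) * (sg * (P A - P r) * (A - c)) by ring.
have k0 : 0 < (m * nu)^-1 * r ^+ 2 by rewrite mulr_gt0// exprn_gt0.
rewrite (pmulr_rgt0 _ k0); apply.
by move=> s /rpos; rewrite -bA; exact: csF.
Qed.

Lemma half_profile_exists (sg c A : R) : 0 < c -> 0 < A -> c != A ->
  (forall r, (c <= r < A) || (A < r <= c) -> 0 < sg * (P A - P r) * (A - c)) ->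
  exists y : R -> R, [/\ y 0 = c, forall x, {for x, continuous y},
    forall x : R, 0 < x -> 0 < y x /\ is_derive x 1 y (sg * F (P A) (y x)) &
    y x @[x --> +oo] --> A].
Proof.
move=> c0 A0 cneA dir.
have rpos s : (c <= s < A) || (A < s <= c) -> 0 < s.
  by move=> /orP[/andP[cs _]|/andP[As _]]; [exact: lt_le_trans cs|exact: lt_trans As].
pose lo := Num.min c A; pose hi := Num.max c A.
have lo0 : 0 < lo by rewrite lt_min c0.
have lohi : lo <= hi by rewrite /lo /hi le_max ge_min lexx.
have [L L0 HL] := F_lipschitz lo0 lohi.
have [|||y [y0 cy yI dy yA]] :=
    @half_line_orbit_towards _ (fun r => sg * F (P A) r) c A (`|sg| * L) cneA.
- by move=> r /rpos r0; apply: cvgM; [exact: cvg_cst|exact: cF].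
- move=> r rI; rewrite /F.
  have -> : sg * ((m * nu)^-1 * (r ^+ 2 * (P A - P r))) * (A - c) =
     ((m * nu)^-1 * r ^+ 2) * (sg * (P A - P r) * (A - c)) by ring.
  have k0 : 0 < (m * nu)^-1 * r ^+ 2 by rewrite mulr_gt0// exprn_gt0// rpos.
  by rewrite (pmulr_rgt0 _ k0) dir.
- move=> r rI; rewrite normrM -mulrA; apply: ler_wpM2l => //.
  rewrite distrC; apply: HL; first by rewrite /lo /hi ge_min le_max !lexx !orbT.
  rewrite /lo /hi ge_min le_max.
  by case/orP: rI => /andP[h1 h2]; [rewrite h1 (ltW h2)|rewrite (ltW h1) h2];
    rewrite ?orbT.
exists y; split=> // x x0; split; first by apply: rpos; exact: yI.
exact: dy.
Qed.

(** Towards larger densities psi must stay below its value at [A], which by convexity is decided at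
    the starting point [c]. Towards smaller densities it must stay above that value, which is
    decided by the sign of the derivative at [A], zero included. *)
Lemma psi_below_directionP c A : 0 < c -> 0 < A -> c != A ->
  (forall r, (c <= r < A) || (A < r <= c) -> 0 < 1 * (P A - P r) * (A - c)) <->
  (c < A /\ P c < P A) \/ (A < c /\ 0 <= D A).
Proof.
move=> c0 A0 cA; split=> [H|].
  have [lt|lt|E] := ltgtP c A; last by rewrite E eqxx in cA.
    left; split=> //; have := H c; rewrite lexx lt/= => /(_ isT).
    by rewrite mul1r pmulr_lgt0 ?subr_gt0.
  right; split=> //; rewrite leNgt; apply/negP => DA.
  have /nbhs_ballP[e /= e0 He] : \forall v \near A, D v < 0.
    exact: (cvgr_lt _ (continuous_dpsi A0)).
  have e0' : (0 : R) < e by [].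
  pose r := Num.min c (A + e / 2).
  have Ar : A < r by rewrite lt_min lt; lra.
  have rc : r <= c by rewrite ge_min lexx.
  have re : r < A + e by rewrite gt_min; apply/orP; right; lra.
  have Dr : D r < 0 by apply: He; rewrite /ball/= distrC gtr0_norm; lra.
  have := H r; rewrite Ar rc orbT mul1r => /(_ isT).
  rewrite nmulr_lgt0 ?subr_lt0// => PAr.
  have r0 := lt_trans A0 Ar.
  have := psi_tangent_le (m := m) hp r0 A0.
  have : 0 < D r * (A - r) by rewrite nmulr_rgt0// subr_lt0.
  by lra.
move=> [[lt Pc] r /orP[/andP[cr rA]|/andP[Ar rc]]|[lt DA] r /orP[/andP[cr rA]|/andP[Ar rc]]].
- rewrite mul1r mulr_gt0 ?subr_gt0//; have [<-//|crN] := eqVneq c r.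
  have cr' : c < r by rewrite lt_neqAle crN.
  by have := psi_between hp m0 c0 cr' rA; rewrite lt_max => /orP[/lt_trans|//]; exact.
- by move: (lt_le_trans Ar rc); rewrite ltNge (ltW lt).
- by move: (le_lt_trans cr rA); rewrite ltNge (ltW lt).
- rewrite mul1r nmulr_lgt0 ?subr_lt0//.
  have r0 := lt_trans A0 Ar; have AnEr : A != r by rewrite lt_eqF.
  apply: le_lt_trans (psi_tangent_lt hp m0 A0 r0 AnEr).
  by rewrite lerDl mulr_ge0// subr_ge0 ltW.
Qed.

(** The mirror image for the direction -1, used for right boundary layers, which are followed
    backwards from the end point. *)
Lemma psi_above_directionP c A : 0 < c -> 0 < A -> c != A ->
  (forall r, (c <= r < A) || (A < r <= c) -> 0 < -1 * (P A - P r) * (A - c)) <->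
  (A < c /\ P c < P A) \/ (c < A /\ D A <= 0).
Proof.
move=> c0 A0 cA; split=> [H|].
  have [lt|lt|E] := ltgtP c A; last by rewrite E eqxx in cA.
    right; split=> //; rewrite leNgt; apply/negP => DA.
    have /nbhs_ballP[e /= e0 He] : \forall v \near A, 0 < D v.
      exact: (cvgr_gt _ (continuous_dpsi A0)).
    have e0' : (0 : R) < e by [].
    pose r := Num.max c (A - e / 2).
    have rA : r < A by rewrite gt_max lt/=; lra.
    have cr : c <= r by rewrite le_max lexx.
    have re : A - e < r by rewrite lt_max; apply/orP; right; lra.
    have Dr : 0 < D r by apply: He; rewrite /ball/= gtr0_norm; lra.
    have := H r; rewrite cr rA mulN1r => /(_ isT).
    rewrite pmulr_lgt0 ?subr_gt0// oppr_gt0 subr_lt0 => PAr.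
    have r0 := lt_le_trans c0 cr.
    have := psi_tangent_le (m := m) hp r0 A0.
    have : 0 < D r * (A - r) by rewrite mulr_gt0// subr_gt0.
    by lra.
  left; split=> //; have := H c; rewrite lexx lt orbT => /(_ isT).
  by rewrite mulN1r nmulr_lgt0 ?subr_lt0// oppr_lt0 subr_gt0.
move=> [[lt Pc] r /orP[/andP[cr rA]|/andP[Ar rc]]|[lt DA] r /orP[/andP[cr rA]|/andP[Ar rc]]].
- by move: (le_lt_trans cr rA); rewrite ltNge (ltW lt).
- rewrite mulN1r nmulr_lgt0 ?subr_lt0// oppr_lt0 subr_gt0.
  have [->//|rcN] := eqVneq r c.
  have rc' : r < c by rewrite lt_neqAle rcN.
  by have := psi_between hp m0 A0 Ar rc'; rewrite lt_max => /orP[//|/lt_trans]; exact.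
- rewrite mulN1r pmulr_lgt0 ?subr_gt0// oppr_gt0 subr_lt0.
  have r0 := lt_le_trans c0 cr; have AnEr : A != r by rewrite gt_eqF.
  apply: le_lt_trans (psi_tangent_lt hp m0 A0 r0 AnEr).
  by rewrite lerDl; apply: mulr_le0 => //; rewrite subr_le0 ltW.
- by move: (lt_le_trans Ar rc); rewrite ltNge (ltW lt).
Qed.

End Layers.

(** * Boundary layers and shocks in terms of psi *)

Section LayerCharacterization.
Context {R : realType} {p : R -> R} {m nu : R}.
Hypotheses (hp : pressure_law p) (m0 : 0 < m) (nu0 : 0 < nu).
Implicit Types (a b rL rR : R).

Local Notation P := (psi p m).
Local Notation D := (dpsi p m).

(** The case [a = rL] is realised by the constant profile; the other two are an increasing and a
    decreasing layer, read off from [psi_below_directionP]. *)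
Lemma left_boundary_layerP rL a : 0 < rL -> 0 < a ->
  left_boundary_layer p m nu rL a <->
  [\/ a = rL, rL < a /\ P rL < P a | a < rL /\ 0 <= D a].
Proof.
move=> rL0 a0; split=> [[b [rho [crho rho0 prho rhoa]]]|H].
  have [->|neq] := eqVneq rL a; first by constructor 1.
  have [_] := half_profile_direction hp m0 nu0 (oner_neq0 R) rL0 a0 crho rho0
    (fun x x0 => let H := (profile_eqP m0 nu0 b rho x).1 (prho x x0) in
       conj H.1 (eq_ind _ (fun d => is_derive x 1 rho d) H.2 _ (esym (mul1r _)))) rhoa.
  by move=> /(psi_below_directionP hp m0 rL0 a0 neq)[]; [constructor 2|constructor 3].
have [E|neq] := eqVneq rL a.
  exists (P a), (cst a); split.
  - by move=> x; exact: cvg_cst.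
  - by rewrite E.
  - move=> x _; split=> //=; rewrite derive1_cst subrr !mulr0 //.
  - exact: cvg_cst.
have dir : (rL < a /\ P rL < P a) \/ (a < rL /\ 0 <= D a).
  by case: H => [H|H|H]; [rewrite H eqxx in neq|left|right].
have [y [y0 cy dy ya]] := half_profile_exists hp m0 nu0 rL0 a0 neq
  ((psi_below_directionP hp m0 rL0 a0 neq).2 dir).
exists (P a), y; split=> //.
- by apply: within_continuous => x _; exact: cy.
- by move=> x /dy[yx d]; apply/(profile_eqP m0 nu0); rewrite mul1r in d.
Qed.

(** The substitution x -> 1 - x turns the profile into a half-line orbit of the opposite field, to
    which [psi_above_directionP] applies. *)
Lemma right_boundary_layerP a rR : 0 < a -> 0 < rR ->
  right_boundary_layer p m nu a rR <->
  [\/ a = rR, a < rR /\ P rR < P a | rR < a /\ D a <= 0].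
Proof.
move=> a0 rR0; have N10 : -1 != 0 :> R by rewrite oppr_eq0 oner_neq0.
have cflip (x : R) : {for x, continuous (fun t : R => 1 - t)}.
  exact: (is_derive1_continuous (is_derive1B (is_derive1_cst 1 x) (is_derive1_id x))).
have dflip (x : R) : is_derive x 1 (fun t : R => 1 - t) (0 - 1).
  exact: (is_derive1B (is_derive1_cst 1 x) (is_derive1_id x)).
split=> [[b [rho [crho rho1 prho rhoa]]]|H].
  have [->|neq] := eqVneq rR a; first by constructor 1.
  pose y x := rho (1 - x).
  have cy : {within `[0, +oo[, continuous y}.
    apply/subspace_continuousP => x /=; rewrite in_itv/= andbT => x0.
    have /subspace_continuousP/(_ (1 - x)) := crho.
    rewrite /= in_itv/= lerBlDr lerDl => /(_ x0) c.
    move=> S /c S1.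
    have S2 : \forall t \near x, `]-oo, 1]%classic (1 - t) -> S (rho (1 - t)).
      exact: (cflip x _ S1).
    rewrite /nbhs/= /within/=.
    apply: filterS S2 => t + t0; apply; move: t0.
    by rewrite /= !in_itv/= andbT lerBlDr lerDl.
  have y0 : y 0 = rR by rewrite /y subr0.
  have dy (x : R) : 0 < x -> 0 < y x /\
      is_derive x 1 y (-1 * ((m * nu)^-1 * (y x ^+ 2 * (b - P (y x))))).
    move=> x0; have x1 : 1 - x < 1 by rewrite ltrBlDr ltrDl.
    have [yp d] := (profile_eqP m0 nu0 b rho (1 - x)).1 (prho _ x1).
    have d2 : is_derive x 1 y _ := @is_derive1_comp _ rho (fun t => 1 - t) x _ _ d (dflip x).
    by split=> //; apply: (is_derive1_eq d2); rewrite /y; ring.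
  have ya : y x @[x --> +oo] --> a.
    have flipNy : (1 - x) @[x --> +oo] --> (-oo : set_system R).
      apply/cvgrNyPle => M; near=> x.
      rewrite lerBlDr -lerBlDl; near: x; apply: nbhs_pinfty_ge; exact: num_real.
    exact: (cvg_comp _ _ flipNy rhoa).
  have [_] := half_profile_direction hp m0 nu0 N10 rR0 a0 cy y0 dy ya.
  by move=> /(psi_above_directionP hp m0 rR0 a0 neq)[]; [constructor 2|constructor 3].
have [E|neq] := eqVneq rR a.
  exists (P a), (cst a); split.
  - by move=> x; exact: cvg_cst.
  - by rewrite E.
  - move=> x _; split=> //=; rewrite derive1_cst subrr !mulr0 //.
  - exact: cvg_cst.
have dir : (a < rR /\ P rR < P a) \/ (rR < a /\ D a <= 0).
  by case: H => [H|H|H]; [rewrite H eqxx in neq|left|right].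
have [y [y0 cy dy ya]] := half_profile_exists hp m0 nu0 rR0 a0 neq
  ((psi_above_directionP hp m0 rR0 a0 neq).2 dir).
exists (P a), (fun x => y (1 - x)); split.
- apply: within_continuous => x _.
  exact: (@continuous_comp _ _ _ (fun x : R => 1 - x) y x (cflip x) (cy (1 - x))).
- by rewrite subrr.
- move=> x x1; apply/(profile_eqP m0 nu0).
  have [yx d] := dy (1 - x) ltac:(by rewrite subr_gt0).
  have d2 : is_derive x 1 (fun x => y (1 - x)) _ :=
    @is_derive1_comp _ y (fun t => 1 - t) x _ _ d (dflip x).
  by split=> //; apply: (is_derive1_eq d2); ring.
- have flipy : (1 - x) @[x --> -oo] --> (+oo : set_system R).
    apply/cvgryPge => M; near=> x.
    rewrite lerBrDr -lerBrDl; near: x; apply: nbhs_ninfty_le; exact: num_real.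
  exact: (cvg_comp _ _ flipy ya).
Unshelve. all: by end_near. Qed.

(** Both limits are equilibria of one field, so b = psi rL = psi rR. By strict convexity b - psi is
    positive in between, so a profile can only increase. Conversely, between two zeros of the field
    the Lipschitz bound on psi supplies the linear bounds needed by [heteroclinic_orbit]. *)
Lemma standing_shockP rL rR : 0 < rL -> 0 < rR ->
  standing_shock p m nu rL rR <-> rL < rR /\ P rL = P rR.
Proof.
move=> rL0 rR0; split.
  move=> [neq [b [rho [prho rhoL rhoR]]]].
  have drho x := (profile_eqP m0 nu0 b rho x).1 (prho x).
  have crho x : {for x, continuous rho} by have [_ d] := drho x; exact: (is_derive1_continuous d).
  pose e := `|rL - rR| / 2.
  have e0 : 0 < e by rewrite divr_gt0// normr_gt0 subr_eq0.
  have [X [_ HX]] : \forall x \near -oo, `|rL - rho x| < e.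
    by move/cvgrPdist_lt : rhoL; exact.
  (* The profile restarted at [X - 1], where it is closer to [rL] than the midpoint of the two
     states is. If rR < rL, the midpoint then lies on its way to [rR], and the sign of the field
     there contradicts convexity. *)
  pose y x := rho (x + (X - 1)).
  have shiftd (x : R) : is_derive x 1 (fun t : R => t + (X - 1)) (1 + 0).
    exact: (is_derive1D (is_derive1_id x) (is_derive1_cst (X - 1) x)).
  have cy : {within `[0, +oo[, continuous y}.
    apply: within_continuous => x _; have [_ d] := drho (x + (X - 1)).
    exact: (is_derive1_continuous
      (@is_derive1_comp _ rho (fun t => t + (X - 1)) x _ _ d (shiftd x))).
  have dy (x : R) : 0 < x -> 0 < y x /\
      is_derive x 1 y (1 * ((m * nu)^-1 * (y x ^+ 2 * (b - P (y x))))).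
    move=> _; have [yp d] := drho (x + (X - 1)).
    have d2 : is_derive x 1 y _ :=
      @is_derive1_comp _ rho (fun t => t + (X - 1)) x _ _ d (shiftd x).
    by split=> //; apply: (is_derive1_eq d2); rewrite /y; ring.
  have yR : y x @[x --> +oo] --> rR.
    have shifty : (x + (X - 1)) @[x --> +oo] --> (+oo : set_system R).
      apply/cvgryPge => M; near=> x.
      rewrite -lerBlDr; near: x; apply: nbhs_pinfty_ge; exact: num_real.
    exact: (cvg_comp _ _ shifty rhoR).
  have y0p : 0 < y 0 by have [] := drho (0 + (X - 1)).
  have [bR dir] := half_profile_direction hp m0 nu0 (oner_neq0 R) y0p rR0 cy erefl dy yR.
  (* Reversing x makes [rL] the limit at infinity of an orbit of the opposite field. *)
  have bL : b = P rL.
    pose G (r : R) := -1 * ((m * nu)^-1 * (r * r * (b - P r))).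
    have cG : {for rL, continuous G}.
      have dP := is_derive_psi (m := m) hp rL0.
      have d1 := is_derive1M (is_derive1M (is_derive1_id rL) (is_derive1_id rL))
        (is_derive1B (is_derive1_cst b rL) dP).
      exact: (is_derive1_continuous (is_derive1Z (-1) (is_derive1Z (m * nu)^-1 d1))).
    have dNy (x : R) : 0 < x -> is_derive x 1 (fun x => rho (- x)) (G (rho (- x))).
      move=> _; have [_ d] := drho (- x).
      have d2 : is_derive x 1 (fun x => rho (- x)) _ :=
        @is_derive1_comp _ rho (fun t => - t) x _ _ d (is_derive1N (is_derive1_id x)).
      by apply: (is_derive1_eq d2); rewrite /G; ring.
    have NyL : rho (- x) @[x --> +oo] --> rL.
      have flipNy : (- x) @[x --> +oo] --> (-oo : set_system R).
        apply/cvgrNyPle => M; near=> x.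
        rewrite lerNl; near: x; apply: nbhs_pinfty_ge; exact: num_real.
      exact: (cvg_comp _ _ flipNy rhoL).
    have /eqP := limit_equilibrium cG dNy NyL.
    have k0 : (m * nu)^-1 * rL ^+ 2 != 0.
      by rewrite mulf_neq0 ?expf_neq0 ?gt_eqF// invr_gt0 mulr_gt0.
    have -> : G rL = ((m * nu)^-1 * rL ^+ 2) * (P rL - b) by rewrite /G; ring.
    by rewrite mulf_eq0 (negPf k0) subr_eq0 => /eqP.
  have PE : P rL = P rR by rewrite -bL -bR.
  split=> //; pose r := (rL + rR) / 2.
  have yX : `|rL - y 0| < e by apply: HX; lra.
  have [lt|lt|E] := ltgtP rL rR => //; last by rewrite E eqxx in neq.
  have eE : e = (rL - rR) / 2 by rewrite /e gtr0_norm ?subr_gt0.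
  have rI : (y 0 <= r < rR) || (rR < r <= y 0).
    apply/orP; right; move: yX; rewrite eE /r ltr_norml; lra.
  have := dir r rI; rewrite mul1r.
  have Rr : rR < r by rewrite /r; lra.
  have rLt : r < rL by rewrite /r; lra.
  have := psi_between hp m0 rR0 Rr rLt; rewrite PE maxxx => h1 h2.
  have cR : rR - y 0 < 0.
    by rewrite subr_lt0; move: yX; rewrite eE ltr_norml; lra.
  by move: h2; rewrite nmulr_lgt0// subr_lt0 ltNge (ltW h1).
move=> [lt PE]; split; first by rewrite lt_eqF.
have lohi : rL <= rR by exact: ltW.
have [L L0 HL] := psi_lipschitz hp m0 rL0 lohi.
pose F r := (m * nu)^-1 * (r ^+ 2 * (P rL - P r)).
have mnuV0 : 0 < (m * nu)^-1 by rewrite invr_gt0 mulr_gt0.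
pose K := (m * nu)^-1 * (rR ^+ 2 * L).
have Fup r s : rL < r < rR -> rL <= s <= rR -> P s = P rL -> F r <= K * `|s - r|.
  move=> /andP[Lr rR'] sI PsE; have r0 := lt_trans rL0 Lr.
  have h1 : P rL - P r <= L * `|s - r|.
    apply: le_trans (ler_norm _) _; rewrite -PsE.
    by apply: HL => //; rewrite (ltW Lr) (ltW rR').
  have h2 : r ^+ 2 * (P rL - P r) <= r ^+ 2 * (L * `|s - r|).
    by rewrite ler_wpM2l// sqr_ge0.
  have h3 : r ^+ 2 * (L * `|s - r|) <= rR ^+ 2 * (L * `|s - r|).
    apply: ler_wpM2r; first by rewrite mulr_ge0// ltW.
    by rewrite ler_pXn2r// ?nnegrE ltW.
  have -> : K * `|s - r| = (m * nu)^-1 * (rR ^+ 2 * (L * `|s - r|)) by rewrite /K; ring.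
  by rewrite /F ler_pM2l//; exact: le_trans h2 h3.
have midI : rL < (rL + rR) / 2 < rR by apply/andP; split; lra.
have [||||y [_ _ dy yR yL]] := @heteroclinic_orbit _ F rL rR K ((rL + rR) / 2) 0 midI.
- move=> r /andP[Lr _]; have r0 := lt_trans rL0 Lr.
  have -> : F = (fun r : R => (m * nu)^-1 * (r * r * (P rL - P r))) by [].
  have dP := is_derive_psi (m := m) hp r0.
  have d1 := is_derive1M (is_derive1M (is_derive1_id r) (is_derive1_id r))
        (is_derive1B (is_derive1_cst (P rL) r) dP).
  exact: (is_derive1_continuous (is_derive1Z (m * nu)^-1 d1)).
- move=> r /andP[Lr rR']; have r0 := lt_trans rL0 Lr.
  rewrite mulr_gt0// mulr_gt0 ?exprn_gt0// subr_gt0.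
  by have := psi_between hp m0 rL0 Lr rR'; rewrite -PE maxxx.
- move=> r rI; rewrite -[rR - r]gtr0_norm ?subr_gt0; last by case/andP: rI.
  by apply: Fup => //; rewrite lexx andbT.
- move=> r rI; rewrite -[r - rL]gtr0_norm ?subr_gt0; last by case/andP: rI.
  by rewrite distrC; apply: Fup => //; rewrite lexx.
exists (P rL), y; split=> // x; apply/(profile_eqP m0 nu0).
by have [/andP[yL' _] d] := dy x; split=> //; exact: lt_trans yL'.
Unshelve. all: by end_near. Qed.

End LayerCharacterization.

(** * Existence, uniqueness and types of limiting configurations *)

(** A description of limiting configurations that is free of viscosity. In the last case [a] is the
    minimizer of psi on [rR, rL]; this includes rL = rR, and when [a] is an end of the interval at
    most one layer is present. *)
Definition steady_states (R : realType) (p : R -> R) (m rL rR : R) (s : seq R) : Prop :=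
  [\/ [/\ rL < rR, psi p m rR < psi p m rL & s = [:: rL]],
      [/\ rL < rR, psi p m rL < psi p m rR & s = [:: rR]],
      [/\ rL < rR, psi p m rL = psi p m rR & s = [:: rL; rR]] |
      exists a : R, [/\ rR <= a <= rL, s = [:: a], a < rL -> 0 <= dpsi p m a &
                    rR < a -> dpsi p m a <= 0]].

Section SteadyConfigurations.
Context {R : realType} {p : R -> R} {m : R}.
Hypotheses (hp : pressure_law p) (m0 : 0 < m).
Implicit Types (a b rL rR nu : R).

Local Notation P := (psi p m).
Local Notation D := (dpsi p m).

Lemma steady_states_exist rL rR : 0 < rL -> 0 < rR ->
  exists s, steady_states p m rL rR s.
Proof.
move=> rL0 rR0; have [LR|RL] := ltP rL rR.
  have [lt|lt|E] := ltgtP (P rL) (P rR).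
  - by exists [:: rR]; constructor 2.
  - by exists [:: rL]; constructor 1.
  - by exists [:: rL; rR]; constructor 3.
have [a a0 Da] := dpsi_zero_exists hp m0.
(* The critical point of psi projected onto [rR, rL]. *)
pose c := Num.max rR (Num.min a rL).
exists [:: c]; constructor 4; exists c; split=> //.
- by rewrite /c le_max lexx/= ge_max RL ge_min lexx orbT.
- have ac : c < rL -> a <= c.
    by rewrite gt_max gt_min ltxx orbF => /andP[_ aL]; rewrite /c le_max (min_idPl (ltW aL)) lexx orbT.
  by move=> /ac ac'; rewrite -Da; apply: dpsi_le.
- have ca : rR < c -> c <= a /\ 0 < c.
    rewrite lt_max ltxx/= lt_min => /andP[Ra RL'].
    have mR : rR <= Num.min a rL by rewrite le_min !ltW.
    rewrite /c (max_idPr mR) ge_min lexx; split=> //.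
    by rewrite lt_min a0 rL0.
  by move=> /ca[ca' c0]; rewrite -Da; apply: dpsi_le.
Qed.

Lemma steady_states_unique rL rR s s' : 0 < rL -> 0 < rR ->
  steady_states p m rL rR s -> steady_states p m rL rR s' -> s' = s.
Proof.
move=> rL0 rR0.
have excl a : rL < rR -> rR <= a <= rL -> False.
  by move=> LR /andP[Ra aL]; move: (le_trans Ra aL); rewrite leNgt LR.
(* Two distinct minimizers would contradict the strict monotonicity of the derivative of psi. *)
have mono a b : rR <= a -> a < b -> b <= rL ->
    (a < rL -> 0 <= D a) -> (rR < b -> D b <= 0) -> False.
  move=> Ra ab bL Da Db.
  have := dpsi_lt hp m0 (lt_le_trans rR0 Ra) ab.
  have := Da (lt_le_trans ab bL); have := Db (le_lt_trans Ra ab); lra.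
case=> [[LR c1 ->]|[LR c1 ->]|[LR c1 ->]|[a [aI -> a1 a2]]];
  case=> [[LR' c2 ->]|[LR' c2 ->]|[LR' c2 ->]|[b [bI -> b1 b2]]] //;
  try (by case: (excl _ LR bI)); try (by case: (excl _ LR' aI));
  try (by exfalso; lra).
case/andP: (aI) (bI) => Ra aL /andP[Rb bL].
have [ab|ba|->//] := ltgtP a b; first by case: (mono a b).
by case: (mono b a).
Qed.

(** The Lax condition: the flow is supersonic to the left of a shock and subsonic to its right. *)
Lemma dpsi_of_shock a b : 0 < a -> a < b -> P a = P b -> D a < 0 < D b.
Proof.
move=> a0 ab E; have b0 := lt_trans a0 ab.
have anb : a != b by rewrite lt_eqF.
have bna : b != a by rewrite gt_eqF.
have := psi_tangent_lt hp m0 a0 b0 anb; have := psi_tangent_lt hp m0 b0 a0 bna.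
rewrite E => h1 h2.
have h3 : D a * (b - a) < 0 by lra.
have h4 : D b * (a - b) < 0 by lra.
have ba : 0 < b - a by rewrite subr_gt0.
have ab' : a - b < 0 by rewrite subr_lt0.
by move: h3 h4; rewrite (pmulr_llt0 _ ba) (nmulr_llt0 _ ab') => -> ->.
Qed.

(** An increasing left layer ending at [a] forces P' a > 0 and a decreasing one P' a >= 0; for right
    layers the signs are < 0 and <= 0. Hence two nonconstant layers can share a state only if both
    decrease, and then P' a = 0. A shock has P' < 0 on its left and P' > 0 on its right, so it
    admits no nonconstant layer beside it. Three interior states would give psi equal values at
    three densities, against strict convexity. *)
Lemma limiting_configurationP nu rL rR s : 0 < nu -> 0 < rL -> 0 < rR ->
  limiting_configuration p m nu rL rR s <-> steady_states p m rL rR s.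
Proof.
move=> nu0 rL0 rR0; split.
  move=> [s0 spos lbl shk rbl]; case: s => // a [|b l] in s0 spos lbl shk rbl *.
    have a0 : 0 < a by apply: spos; rewrite mem_head.
    rewrite /= in lbl rbl.
    have fwd c : 0 < c -> c < a -> P c < P a -> 0 < D a.
      move=> c0 ca Pc; have := psi_tangent_le (m := m) hp a0 c0 => h.
      have Dca : D a * (c - a) < 0 by lra.
      have ca' : c - a < 0 by rewrite subr_lt0.
      by rewrite (nmulr_llt0 _ ca') in Dca.
    have bwd c : a < c -> P c < P a -> D a < 0.
      move=> ac Pc; have := psi_tangent_le (m := m) hp a0 (lt_trans a0 ac) => h.
      have Dca : D a * (c - a) < 0 by lra.
      have ca' : 0 < c - a by rewrite subr_gt0.
      by rewrite (pmulr_llt0 _ ca') in Dca.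
    have hL := (left_boundary_layerP hp m0 nu0 rL0 a0).1 lbl.
    have hR := (right_boundary_layerP hp m0 nu0 a0 rR0).1 rbl.
    case: hL => [E|[La PL]|[aL Da]]; case: hR => [E'|[aR PR]|[Ra Da']].
    + constructor 4; exists a; split=> //; first by rewrite -E -E' lexx.
        by rewrite E ltxx.
      by rewrite E' ltxx.
    + by rewrite E in aR PR *; constructor 1.
    + constructor 4; exists a; split=> //; first by rewrite -E (ltW Ra) lexx.
      by rewrite E ltxx.
    + by rewrite E' in La PL *; constructor 2.
    + by have := lt_trans (fwd _ rL0 La PL) (bwd _ aR PR); rewrite ltxx.
    + by have := lt_le_trans (fwd _ rL0 La PL) Da'; rewrite ltxx.
    + constructor 4; exists a; split=> //; first by rewrite E' lexx -E' ltW.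
      by rewrite E' ltxx.
    + by have := le_lt_trans Da (bwd _ aR PR); rewrite ltxx.
    + by constructor 4; exists a; split=> //; rewrite !ltW.
  have a0 : 0 < a by apply: spos; rewrite mem_head.
  have b0 : 0 < b by apply: spos; rewrite !inE eqxx orbT.
  have [ab PE] := (standing_shockP hp m0 nu0 a0 b0).1 (shk 0%N isT).
  have /andP[Da Db] := dpsi_of_shock a0 ab PE.
  have aE : a = rL.
    case: ((left_boundary_layerP hp m0 nu0 rL0 a0).1 lbl) => [//|[La PL]|[_ Da']].
      have := psi_tangent_le (m := m) hp a0 rL0.
      have : 0 < D a * (rL - a) by rewrite nmulr_rgt0// subr_lt0.
      by lra.
    by move: (le_lt_trans Da' Da); rewrite ltxx.
  case: l => [|c l] in s0 spos lbl shk rbl *.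
    have bE : b = rR.
      case: ((right_boundary_layerP hp m0 nu0 b0 rR0).1 rbl) => [//|[bR PR]|[_ Db']].
        have := psi_tangent_le (m := m) hp b0 rR0.
        have : 0 < D b * (rR - b) by rewrite mulr_gt0// subr_gt0.
        by lra.
      by move: (lt_le_trans Db Db'); rewrite ltxx.
    by rewrite aE bE in ab PE *; constructor 3.
  have c0 : 0 < c by apply: spos; rewrite !inE eqxx !orbT.
  have [bc PE'] := (standing_shockP hp m0 nu0 b0 c0).1 (shk 1%N isT).
  by have := psi_between hp m0 a0 ab bc; rewrite PE -PE' maxxx ltxx.
case=> [[LR c1 ->]|[LR c1 ->]|[LR c1 ->]|[a [/andP[Ra aL] -> a1 a2]]].
- split=> //; first by move=> r; rewrite inE => /eqP->.
    by apply/(left_boundary_layerP hp m0 nu0) => //; constructor 1.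
  by apply/(right_boundary_layerP hp m0 nu0) => //; constructor 2.
- split=> //; first by move=> r; rewrite inE => /eqP->.
    by apply/(left_boundary_layerP hp m0 nu0) => //; constructor 2.
  by apply/(right_boundary_layerP hp m0 nu0) => //; constructor 1.
- split=> //; first by move=> r; rewrite !inE => /orP[] /eqP->.
  + by apply/(left_boundary_layerP hp m0 nu0) => //; constructor 1.
  + by case=> // _; apply/(standing_shockP hp m0 nu0).
  + by apply/(right_boundary_layerP hp m0 nu0) => //; constructor 1.
- have a0 := lt_le_trans rR0 Ra.
  split=> //; first by move=> r; rewrite inE => /eqP->.
    apply/(left_boundary_layerP hp m0 nu0) => //=.
    have [E|neq] := eqVneq a rL; first by constructor 1.
    have lt : a < rL by rewrite lt_neqAle neq.
    by constructor 3; split=> //; exact: a1.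
  apply/(right_boundary_layerP hp m0 nu0) => //=.
  have [E|neq] := eqVneq a rR; first by constructor 1.
  have lt : rR < a by rewrite lt_neqAle eq_sym neq.
  by constructor 3; split=> //; exact: a2.
Qed.

Lemma steady_states_type nu rL rR s : 0 < nu -> 0 < rL -> 0 < rR ->
  steady_states p m rL rR s ->
  [\/ single_boundary_layer p m nu rL rR s,
      single_interior_shock p m nu rL rR s |
      double_boundary_layer p m nu rL rR s].
Proof.
move=> nu0 rL0 rR0 conf.
have [_ _ lbl shk rbl] := (limiting_configurationP s nu0 rL0 rR0).2 conf.
move: conf => [[LR c1 E]|[LR c1 E]|[LR c1 E]|[a [/andP[Ra aL] E a1 a2]]];
  rewrite E/= in lbl shk rbl *.
- by constructor 1; right.
- by constructor 1; left.
- by constructor 2; split=> //; exact: (shk 0%N).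
- have [aE|aNL] := eqVneq a rL.
    by rewrite aE in rbl *; constructor 1; right.
  have [aE|aNR] := eqVneq a rR.
    by rewrite aE in lbl *; constructor 1; left.
  constructor 3; exists a; split=> //.
  apply/(characteristicP hp m0); first exact: lt_le_trans Ra.
  apply/eqP; rewrite eq_le a2 ?a1//.
    by rewrite lt_neqAle aNL.
  by rewrite lt_neqAle eq_sym aNR.
Qed.

Lemma steady_states_size rL rR s : steady_states p m rL rR s ->
  size s = 1%N \/ size s = 2%N.
Proof.
by case=> [[_ _ ->]|[_ _ ->]|[_ _ ->]|[a [_ -> _ _]]]; [left|left|right|left].
Qed.

Lemma inviscid_solution_positions nu rL rR s z : 0 < nu -> 0 < rL -> 0 < rR ->
  steady_states p m rL rR s ->
  (exists r v : R -> R, inviscid_solution p m nu rL rR z r v) <->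
  (size s = 1%N /\ z = [::] \/
   size s = 2%N /\ exists2 y : R, 0 < y < 1 & z = [:: y]).
Proof.
move=> nu0 rL0 rR0 conf; split.
  move=> [r [v [s' [lc sz srt zI _]]]].
  have s'E := steady_states_unique rL0 rR0 conf
    ((limiting_configurationP s' nu0 rL0 rR0).1 lc).
  rewrite s'E in sz; case: (steady_states_size conf) => E; rewrite E in sz *.
    by left; split=> //; apply/size0nil; case: sz.
  right; split=> //; case: z => [//|y [|//]] in sz srt zI *.
  by exists y => //; apply: zI; rewrite mem_head.
move=> H; exists (fun x => s`_(count (fun y => y < x) z)).
exists (fun x => m / s`_(count (fun y => y < x) z)), s; split=> //.
- by apply/(limiting_configurationP s nu0 rL0 rR0).
- by case: H => -[-> ]; [move=> ->|move=> [y _ ->]].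
- by case: H => -[_ ]; [move=> ->|move=> [y _ ->]].
- by case: H => -[_ ]; [move=> ->|move=> [y yI ->] w; rewrite inE => /eqP->].
Qed.

Lemma inviscid_solution_unique nu rL rR z (r v r' v' : R -> R) :
  0 < nu -> 0 < rL -> 0 < rR ->
  inviscid_solution p m nu rL rR z r v -> inviscid_solution p m nu rL rR z r' v' ->
  forall x : R, 0 < x < 1 -> x \notin z -> r' x = r x /\ v' x = v x.
Proof.
move=> nu0 rL0 rR0 [s [lc _ _ _ H]] [s' [lc' _ _ _ H']] x xI xz.
have E := steady_states_unique rL0 rR0 ((limiting_configurationP s nu0 rL0 rR0).1 lc)
    ((limiting_configurationP s' nu0 rL0 rR0).1 lc').
have [h1 h2] := H x xI xz; have [h1' h2'] := H' x xI xz.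
by rewrite h2 h2' h1 h1' E.
Qed.

End SteadyConfigurations.

(** * Viscous steady solutions: reduction to a profile and uniqueness *)

Section ViscousSolutions.
Context {R : realType} {p : R -> R} {rho0 u0 u1 nu : R}.
Hypotheses (hp : pressure_law p) (rho0_gt0 : 0 < rho0) (u0_gt0 : 0 < u0)
  (u1_gt0 : 0 < u1) (nu0 : 0 < nu).

Local Notation m := (rho0 * u0).
Local Notation P := (psi p m).
Local Notation D := (dpsi p m).

Let m0 : 0 < m. Proof. exact: mulr_gt0. Qed.

(** For u = m / y the profile equation becomes nu u' = P y - b, and the momentum equation is the
    derivative of this identity. *)
Lemma viscous_steady_of_profile (b : R) (y : R -> R) :
  (forall x, 0 < y x /\ {for x, continuous y}) -> y 0 = rho0 -> y 1 = m / u1 ->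
  (forall x : R, 0 <= x <= 1 ->
     is_derive x 1 y (nu^-1 * (y x ^+ 2 / m * (b - P (y x))))) ->
  viscous_steady_solution p nu rho0 u0 u1 y (fun x => m / y x).
Proof.
move=> yc y0 y1 dy.
have yp x : 0 < y x by have [] := yc x.
have yn0 x : y x != 0 by rewrite gt_eqF.
have mn0 : m != 0 by rewrite gt_eqF.
have nun0 : nu != 0 by rewrite gt_eqF.
have du (x : R) : 0 <= x <= 1 -> is_derive x 1 (fun x => m / y x) (nu^-1 * (P (y x) - b)).
  move=> /dy d; apply: (is_derive1_eq (is_derive1Z m (is_derive1V d (yn0 x)))).
  by field; rewrite !gt_eqF.
have dP (x : R) : 0 <= x <= 1 -> is_derive x 1 (fun x => P (y x))
    (D (y x) * (nu^-1 * (y x ^+ 2 / m * (b - P (y x))))).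
  by move=> /dy d; exact: (is_derive1_comp (is_derive_psi hp (yp x)) d).
have ddu (x : R) : 0 < x < 1 -> is_derive x 1 (derive1 (fun x => m / y x))
    (nu^-1 * (D (y x) * (nu^-1 * (y x ^+ 2 / m * (b - P (y x)))))).
  move=> xI; have xI' : 0 <= x <= 1 by lra.
  have d := is_derive1Z nu^-1 (is_derive1B (dP x xI') (is_derive1_cst b x)).
  rewrite subr0 in d; apply: near_eq_is_derive d.
  near=> t; rewrite (is_derive1E (du t _))//.
  by apply/andP; split; apply: ltW; near: t; [apply: lt_nbhsr|apply: lt_nbhsl]; case/andP: xI.
split.
- split; apply: within_continuous => x _; first by have [] := yc x.
  apply: cvgM; first exact: cvg_cst.
  by apply: cvgV => //; have [] := yc x.
- split=> //.
    by rewrite y0; field; rewrite gt_eqF.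
  by rewrite y1; field; rewrite !gt_eqF.
- by [].
- move=> x xI; have xI' : 0 <= x <= 1 by lra.
  split; [by have [] := dy x xI'|by have [] := du x xI'|by have [] := ddu x xI].
- move=> x xI; have xI' : 0 <= x <= 1 by lra.
  split.
    rewrite (_ : (fun t => y t * (m / y t)) = cst m) ?derive1_cst//.
    by apply/funext => t /=; field; rewrite gt_eqF.
  rewrite (is_derive1E (ddu x xI)) mulVKf//.
  rewrite (_ : (fun t => y t * (m / y t) ^+ 2 + p (y t)) = (fun t => P (y t))).
    by rewrite (is_derive1E (dP x xI')).
  by apply/funext => t; rewrite /psi; field; rewrite gt_eqF.
Unshelve. all: by end_near. Qed.

(** Mass conservation gives rho u = m, and the constant value of rho u^2 + p - nu u' is [b]. The
    result is phrased for [u] because [b] then enters additively, without the weight rho^2 of the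
    density equation; this is what the comparison of two solutions exploits. *)
Lemma viscous_steady_velocity (rho u : R -> R) :
  viscous_steady_solution p nu rho0 u0 u1 rho u ->
  [/\ {within `[(0 : R), 1], continuous u}, u 0 = u0 /\ u 1 = u1,
      (forall x : R, 0 <= x <= 1 -> 0 < u x /\ rho x = m / u x) &
      exists b, forall x : R, 0 < x < 1 -> is_derive x 1 u (nu^-1 * (P (m / u x) - b))].
Proof.
move=> [[crho cu] [rho0E u0E u1E] rhop dru eqs].
have drho (x : R) : 0 < x < 1 -> is_derive x 1 rho (derive1 rho x).
  by move=> /dru[d _ _]; rewrite derive1E; exact: derivableP.
have du (x : R) : 0 < x < 1 -> is_derive x 1 u (derive1 u x).
  by move=> /dru[_ d _]; rewrite derive1E; exact: derivableP.
have mass (x : R) : 0 <= x <= 1 -> rho x * u x = m.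
  move=> /andP[x0 x1].
  have : `|rho x * u x - rho 0 * u 0| <= 0 * (x - 0).
    apply: (@derive_bounded_le _ (fun x => rho x * u x) (fun=> 0) 0 x 0 x0).
    - have c1 := within_continuousI crho (lexx _) x1.
      have c2 := within_continuousI cu (lexx _) x1.
      by move=> t; apply: cvgM; [exact: c1|exact: c2].
    - move=> t tI; have tI' : 0 < t < 1 by lra.
      have [e _] := eqs t tI'; have d := is_derive1M (drho t tI') (du t tI').
      by rewrite -e (is_derive1E d).
    - by move=> t _; rewrite normr0.
  by rewrite mul0r normr_le0 rho0E u0E subr_eq0 => /eqP.
have up (x : R) : 0 <= x <= 1 -> 0 < u x /\ rho x = m / u x.
  move=> xI; have rx := rhop x xI; have E := mass x xI.
  have ux : 0 < u x by move: m0; rewrite -E pmulr_rgt0.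
  by split=> //; rewrite -E mulfK// gt_eqF.
split=> //.
pose f x := rho x * u x ^+ 2 + p (rho x) - nu * derive1 u x.
have df (x : R) : 0 < x < 1 -> is_derive x 1 f 0.
  move=> xI; have xI' : 0 <= x <= 1 by lra.
  have [_ e] := eqs x xI; have [_ _ ddu] := dru x xI.
  have ddu' : is_derive x 1 (derive1 u) (derive1 (derive1 u) x).
    by rewrite [X in is_derive _ _ _ X]derive1E; exact: derivableP.
  have d1 : is_derive x 1 (fun y => rho y * u y ^+ 2 + p (rho y)) _ :=
    is_derive1D (is_derive1M (drho x xI) (is_derive1M (du x xI) (du x xI)))
      (is_derive1_comp (is_derive_pressure hp (rhop x xI')) (drho x xI)).
  apply: (is_derive1_eq (is_derive1B d1 (is_derive1Z nu ddu'))).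
  by rewrite -e (is_derive1E d1) subrr.
have fcst (x : R) : 0 < x < 1 -> f x = f (2^-1).
  have le_case s t : 0 < s -> s <= t -> t < 1 -> f s = f t.
    move=> s0 st t1; have : `|f t - f s| <= 0 * (t - s).
      apply: (@derive_bounded_le _ f (fun=> 0)) => //.
      - apply: within_continuous => z /=; rewrite in_itv/= => zI.
        by apply: (is_derive1_continuous (df z _)); lra.
      - by move=> z zI; apply: df; lra.
      - by move=> z _; rewrite normr0.
    by rewrite mul0r normr_le0 subr_eq0 => /eqP.
  move=> /andP[x0 x1]; have [xh|hx] := leP x 2^-1; last first.
    by apply/esym/le_case => //; exact: ltW.
  by apply: le_case => //; lra.
exists (f 2^-1) => x xI; have xI' : 0 <= x <= 1 by lra.
apply: (is_derive1_eq (du x xI)); rewrite -(fcst x xI) /f.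
have [ux ->] := up x xI'; rewrite /psi.
by field; rewrite !gt_eqF.
Qed.

(** For w = u - u' the difference of the constants contributes b' - b >= 0 to nu w', so the
    Lipschitz bound on psi leaves w' >= -K |w|, with w = 0 at both ends. *)
Let viscous_steady_unique_half (u u' : R -> R) (b b' : R) :
  {within `[(0 : R), 1], continuous u} -> u 0 = u0 /\ u 1 = u1 ->
  (forall x : R, 0 <= x <= 1 -> 0 < u x) ->
  (forall x : R, 0 < x < 1 -> is_derive x 1 u (nu^-1 * (P (m / u x) - b))) ->
  {within `[(0 : R), 1], continuous u'} -> u' 0 = u0 /\ u' 1 = u1 ->
  (forall x : R, 0 <= x <= 1 -> 0 < u' x) ->
  (forall x : R, 0 < x < 1 -> is_derive x 1 u' (nu^-1 * (P (m / u' x) - b'))) ->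
  b <= b' -> forall x : R, 0 <= x <= 1 -> u' x = u x.
Proof.
move=> cu [u00 u11] up du cu' [u00' u11'] up' du' bb'.
have [xM xMI HM] := EVT_max ler01 cu; have [xm xmI Hm] := EVT_min ler01 cu.
have [xM' xMI' HM'] := EVT_max ler01 cu'; have [xm' xmI' Hm'] := EVT_min ler01 cu'.
rewrite !in_itv/= in xMI xmI xMI' xmI'.
pose lo := Num.min (u xm) (u' xm'); pose hi := Num.max (u xM) (u' xM').
have lo0 : 0 < lo by rewrite lt_min up// up'.
have uI (x : R) : 0 <= x <= 1 -> lo <= u x <= hi.
  by move=> xI; rewrite ge_min le_max Hm ?HM.
have uI' (x : R) : 0 <= x <= 1 -> lo <= u' x <= hi.
  by move=> xI; rewrite ge_min le_max Hm' ?HM' ?orbT.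
have lohi : lo <= hi by have := uI 0; rewrite lexx ler01 => /(_ isT)/andP[]; exact: le_trans.
have hi0 := lt_le_trans lo0 lohi.
have mI v : lo <= v <= hi -> m / hi <= m / v <= m / lo.
  move=> /andP[lv vh]; have v0 := lt_le_trans lo0 lv.
  by rewrite !ler_pM2l// !lef_pV2 ?posrE// lv vh.
have mh0 : 0 < m / hi by rewrite divr_gt0.
have mlohi : m / hi <= m / lo by rewrite ler_pM2l// lef_pV2.
have [L L0 HL] := psi_lipschitz hp m0 mh0 mlohi.
pose K := nu^-1 * (L * (m / lo ^+ 2)).
pose w x := u x - u' x.
suff w0 (x : R) : 0 <= x <= 1 -> w x = 0.
  by move=> x /w0 /eqP; rewrite subr_eq0 => /eqP.
apply: (@boundary_value_zero _ w (fun x => nu^-1 * (P (m / u x) - b) - nu^-1 * (P (m / u' x) - b')) K).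
- by move=> t; apply: cvgB; [exact: cu|exact: cu'].
- by move=> t tI; apply: is_derive1B; [exact: du|exact: du'].
- move=> t tI; have tI' : 0 <= t <= 1 by lra.
  have h1 := HL _ _ (mI _ (uI t tI')) (mI _ (uI' t tI')).
  have ut0 := up t tI'; have ut0' := up' t tI'.
  have h2 : `|m / u t - m / u' t| <= m / lo ^+ 2 * `|w t|.
    have -> : m / u t - m / u' t = (m / (u t * u' t)) * (u' t - u t).
      by field; rewrite !gt_eqF.
    have p1 : 0 < m / (u t * u' t) by apply: divr_gt0 => //; exact: mulr_gt0.
    rewrite normrM (gtr0_norm p1) distrC; apply: ler_wpM2r => //.
    rewrite ler_pM2l// lef_pV2 ?posrE ?mulr_gt0 ?exprn_gt0// expr2.
    have /andP[l1 _] := uI t tI'; have /andP[l2 _] := uI' t tI'.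
    by apply: ler_pM => //; exact: ltW.
  have h3 : `|P (m / u t) - P (m / u' t)| <= L * (m / lo ^+ 2) * `|w t|.
    by apply: le_trans h1 _; rewrite -[leRHS]mulrA ler_pM2l.
  have -> : nu^-1 * (P (m / u t) - b) - nu^-1 * (P (m / u' t) - b') =
     nu^-1 * ((P (m / u t) - P (m / u' t)) + (b' - b)) by ring.
  have -> : - (K * `|w t|) = nu^-1 * (- (L * (m / lo ^+ 2) * `|w t|)) by rewrite /K; ring.
  rewrite ler_pM2l ?invr_gt0//.
  by move: h3; rewrite ler_norml => /andP[h3 _]; lra.
- by rewrite /w u00 u00' subrr.
- by rewrite /w u11 u11' subrr.
Qed.

Lemma viscous_steady_unique (rho u rho' u' : R -> R) :
  viscous_steady_solution p nu rho0 u0 u1 rho u ->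
  viscous_steady_solution p nu rho0 u0 u1 rho' u' ->
  forall x : R, 0 <= x <= 1 -> rho' x = rho x /\ u' x = u x.
Proof.
move=> /viscous_steady_velocity[cu bu up [b du]].
move=> /viscous_steady_velocity[cu' bu' up' [b' du']].
suff E (x : R) : 0 <= x <= 1 -> u' x = u x.
  by move=> x xI; have [_ ->] := up x xI; have [_ ->] := up' x xI; rewrite E.
have up1 (t : R) : 0 <= t <= 1 -> 0 < u t by move=> /up[].
have up1' (t : R) : 0 <= t <= 1 -> 0 < u' t by move=> /up'[].
move=> xI; have [bb|bb] := leP b b'.
  exact: (viscous_steady_unique_half cu bu up1 du cu' bu' up1' du' bb xI).
apply/esym.
exact: (viscous_steady_unique_half cu' bu' up1' du' cu bu up1 du (ltW bb) xI).
Qed.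

End ViscousSolutions.

(** * Quantitative estimates on crossings of an interval *)

Section Crossings.
Context {R : realType}.
Implicit Types (g th y : R -> R) (a lo hi nu d x z k K : R).

(** Normal form of a viscous profile. In the applications [g] is r^2 / m, [th] is the gap between
    psi and its extreme value on [lo, hi], and [d] is the excess of the integration constant beyond
    that value; decreasing densities are brought to this form by x -> 1 - x. *)
Definition crossing (g th : R -> R) (lo hi nu d : R) (y : R -> R) : Prop :=
  [/\ 0 < d, y 0 = lo /\ y 1 = hi, {homo y : x1 x2 / x1 < x2},
    (forall x, {for x, continuous y}) &
    (forall x : R, 0 <= x <= 1 ->
       is_derive x 1 y (nu^-1 * (g (y x) * (d + th (y x)))))].

(** In the stretched variable t = |x - z| / nu this is 1 / (1 + t), the solution of w' = - w^2 that
    describes the algebraic decay of a characteristic layer. *)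
Definition majorant (z nu x : R) : R := nu / (nu + `|x - z|).

Lemma crossing_le g th lo hi nu d y : crossing g th lo hi nu d y ->
  {homo y : x1 x2 / x1 <= x2}.
Proof. by move=> [_ _ yi _ _] u v; rewrite le_eqVlt => /predU1P[->//|/yi/ltW]. Qed.

Lemma crossing_range g th lo hi nu d y x : crossing g th lo hi nu d y ->
  0 <= x <= 1 -> lo <= y x <= hi.
Proof.
move=> c /andP[x0 x1]; have [_ [<- <-] _ _ _] := c.
by rewrite !(crossing_le c).
Qed.

Lemma crossing_reflect g th lo hi nu d y : crossing g th lo hi nu d y ->
  crossing (fun v => g (- v)) (fun v => th (- v)) (- hi) (- lo) nu d (fun x => - y (1 - x)).
Proof.
move=> [d0 [y0 y1] yi cy dy].
have df x : is_derive x 1 (fun t : R => 1 - t) (0 - 1).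
  exact: (is_derive1B (is_derive1_cst 1 x) (is_derive1_id x)).
split=> //.
- by rewrite subr0 y1 subrr y0.
- by move=> u v uv; rewrite ltrN2; apply: yi; lra.
- move=> x; apply: (@continuousN _ _ _ (fun x => y (1 - x))).
  apply: (@continuous_comp _ _ _ (fun x : R => 1 - x) y) => //.
  exact: (is_derive1_continuous (df x)).
- move=> x xI; have xI' : 0 <= 1 - x <= 1 by lra.
  have d1 : is_derive x 1 (fun x => y (1 - x)) _ :=
    @is_derive1_comp _ y (fun t => 1 - t) x _ _ (dy _ xI') (df x).
  by apply: (is_derive1_eq (is_derive1N d1)); rewrite opprK; ring.
Qed.

(* The differential inequality nu w' >= k w^2 for w = y - a makes 1/w decrease
   at rate at least k/nu. *)
Lemma crossing_decay_right g th lo hi nu d y a k W x e :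
  crossing g th lo hi nu d y -> 0 < nu -> 0 < k -> 0 <= x -> x <= e -> e <= 1 ->
  a < y x -> y e - a <= W ->
  (forall r, y x <= r <= y e -> k * (r - a) ^+ 2 <= g r * (d + th r)) ->
  y x - a <= Num.max W k^-1 * (nu / (nu + (e - x))).
Proof.
move=> c nu0 k0 x0 xe e1 ax yeW quad; have [_ _ _ cy dy] := c.
set K := Num.max W k^-1.
have ymono := crossing_le c.
have at0 t : x <= t -> 0 < y t - a.
  by move=> /ymono xt; rewrite subr_gt0 (lt_le_trans ax).
pose f t := - (y t - a)^-1 - k / nu * t.
have df t : x <= t <= e -> is_derive t 1 f
    (- (- (nu^-1 * (g (y t) * (d + th (y t))) - 0) / (y t - a) ^+ 2) - k / nu * 1).
  move=> /andP[xt te]; have tI : 0 <= t <= 1 by lra.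
  have ta : y t - a != 0 by rewrite gt_eqF// at0.
  exact: (is_derive1B (is_derive1N (is_derive1V (is_derive1B (dy t tI)
    (is_derive1_cst a t)) ta)) (is_derive1Z (k / nu) (is_derive1_id t))).
have fle : f x <= f e.
  apply: (@derive_ge0_le _ f _ _ _ xe _ (fun t tI => df t _)) => [|t /andP[/ltW->/ltW->]//|t /andP[xt te]].
    apply: within_continuous => t /=; rewrite in_itv/= => tI.
    exact: (is_derive1_continuous (df t tI)).
  have ta := at0 t (ltW xt).
  have q : k * (y t - a) ^+ 2 <= g (y t) * (d + th (y t)).
    by apply: quad; rewrite !ymono// ltW.
  have -> : - (- (nu^-1 * (g (y t) * (d + th (y t))) - 0) / (y t - a) ^+ 2) - k / nu * 1 =
    (g (y t) * (d + th (y t)) - k * (y t - a) ^+ 2) / (nu * (y t - a) ^+ 2).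
    by field; rewrite !gt_eqF.
  by rewrite divr_ge0 ?subr_ge0// mulr_ge0 ?sqr_ge0// ltW.
have ea := at0 e xe; have xa := at0 x (lexx _).
have W0 : 0 < W by exact: lt_le_trans yeW.
have K0 : 0 < K by rewrite lt_max W0.
have kK : K^-1 <= k by rewrite -[k]invrK lef_pV2 ?posrE ?invr_gt0// le_max lexx orbT.
have WK : K^-1 <= (y e - a)^-1.
  by rewrite lef_pV2 ?posrE//; apply: le_trans yeW _; rewrite le_max lexx.
have ne0 : 0 < nu + (e - x) by lra.
have low : K^-1 * ((nu + (e - x)) / nu) <= (y x - a)^-1.
  have h1 : (y e - a)^-1 + k / nu * (e - x) <= (y x - a)^-1.
    by move: fle; rewrite /f; lra.
  apply: le_trans h1.
  have -> : K^-1 * ((nu + (e - x)) / nu) = K^-1 + K^-1 / nu * (e - x).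
    by field; rewrite !gt_eqF.
  apply: lerD => //; apply: ler_wpM2r; first by rewrite subr_ge0.
  by rewrite ler_pM2r// invr_gt0.
have low0 : 0 < K^-1 * ((nu + (e - x)) / nu) by rewrite mulr_gt0 ?invr_gt0// divr_gt0.
have -> : K * (nu / (nu + (e - x))) = (K^-1 * ((nu + (e - x)) / nu))^-1.
  by field; rewrite !gt_eqF.
by rewrite -[leLHS]invrK lef_pV2 ?posrE ?invr_gt0.
Qed.

Lemma crossing_decay_left g th lo hi nu d y a k W x e :
  crossing g th lo hi nu d y -> 0 < nu -> 0 < k -> 0 <= e -> e <= x -> x <= 1 ->
  y x < a -> a - y e <= W ->
  (forall r, y e <= r <= y x -> k * (r - a) ^+ 2 <= g r * (d + th r)) ->
  a - y x <= Num.max W k^-1 * (nu / (nu + (x - e))).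
Proof.
move=> /crossing_reflect c nu0 k0 e0 ex x1 ax yeW quad.
have := @crossing_decay_right _ _ _ _ _ _ _ (- a) k W (1 - x) (1 - e) c nu0 k0.
rewrite !subKr (_ : - y x - - a = a - y x); last by ring.
rewrite (_ : 1 - e - (1 - x) = x - e); last by ring.
apply; try lra.
move=> r rI; have -> : (r - - a) ^+ 2 = (- r - a) ^+ 2 by ring.
by apply: quad; lra.
Qed.

(** Values below [a] are compared with the left end and values above [a] with the right end: moving
    away from that end, the quadratic lower bound makes the reciprocal of the distance to [a] grow
    at rate at least k / nu. *)
Lemma crossing_layer_upper g th lo hi nu d y a k :
  crossing g th lo hi nu d y -> 0 < nu -> 0 < k -> lo <= a <= hi ->
  (forall r, lo <= r <= hi -> 0 < g r /\ k * (r - a) ^+ 2 <= g r * th r) ->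
  forall x, 0 <= x <= 1 ->
    `|y x - a| <= Num.max (hi - lo) k^-1 * majorant 0 nu x \/
    `|y x - a| <= Num.max (hi - lo) k^-1 * majorant 1 nu x.
Proof.
move=> c nu0 k0 aI quad x xI; have [d0 [y0 y1] _ _ _] := c.
have quad' r : lo <= r <= hi -> k * (r - a) ^+ 2 <= g r * (d + th r).
  move=> /quad[g0 H]; apply: le_trans H _; rewrite ler_pM2l// lerDr ltW//.
have yxI := crossing_range c xI.
have [lt|lt|E] := ltgtP (y x) a.
- left; rewrite ltr0_norm ?subr_lt0// opprB /majorant subr0 ger0_norm; last by lra.
  have := @crossing_decay_left _ _ _ _ _ _ _ a k (hi - lo) x 0 c nu0 k0.
  rewrite subr0 y0; apply; try lra.
  by move=> r rI; apply: quad'; lra.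
- right; rewrite gtr0_norm ?subr_gt0// /majorant ler0_norm ?opprB; last by lra.
  have := @crossing_decay_right _ _ _ _ _ _ _ a k (hi - lo) x 1 c nu0 k0.
  rewrite y1; apply; try lra.
  by move=> r rI; apply: quad'; lra.
- left; rewrite E subrr normr0 mulr_ge0//.
    by rewrite le_max invr_ge0 (ltW k0) orbT.
  by rewrite divr_ge0 ?addr_ge0// ltW.
Qed.

(** The speed is at least gm d / nu, and only the distance hi - lo is covered in unit time. *)
Lemma crossing_parameter_le g th lo hi nu d y gm : crossing g th lo hi nu d y ->
  0 < nu -> 0 < gm -> (forall r, lo <= r <= hi -> gm <= g r /\ 0 <= th r) ->
  d <= nu * ((hi - lo) / gm).
Proof.
move=> c nu0 gm0 gth; have [d0 [y0 y1] _ cy dy] := c.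
have df (x : R) : 0 <= x <= 1 -> is_derive x 1 (fun x => y x - nu^-1 * (gm * d) * x)
    (nu^-1 * (g (y x) * (d + th (y x))) - nu^-1 * (gm * d) * 1).
  by move=> xI; exact: (is_derive1B (dy x xI) (is_derive1Z _ (is_derive1_id x))).
have imp (x : R) : 0 < x < 1 -> 0 <= x <= 1 by move=> /andP[/ltW-> /ltW->].
have H : y 0 - nu^-1 * (gm * d) * 0 <= y 1 - nu^-1 * (gm * d) * 1.
  apply: (@derive_ge0_le _ (fun x => y x - nu^-1 * (gm * d) * x) _ 0 1 ler01 _
    (fun x xI => df x (imp x xI))).
    apply: within_continuous => t /=; rewrite in_itv/= => tI.
    exact: (is_derive1_continuous (df t tI)).
  move=> x /imp xI; have [gx tx] := gth _ (crossing_range c xI).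
  rewrite mulr1 -mulrBr mulr_ge0 ?invr_ge0 ?(ltW nu0)// subr_ge0.
  by apply: ler_pM => //; [exact: ltW|exact: ltW|rewrite lerDl].
have {}H : nu^-1 * (gm * d) <= hi - lo by rewrite -y0 -y1; lra.
have -> : nu * ((hi - lo) / gm) = (hi - lo) * (nu / gm) by ring.
have -> : d = nu^-1 * (gm * d) * (nu / gm) by field; rewrite !gt_eqF.
by rewrite ler_pM2r// divr_gt0.
Qed.

Lemma crossing_speed g th lo hi nu d y gm gM tM : crossing g th lo hi nu d y ->
  0 < nu <= 1 -> 0 < gm ->
  (forall r, lo <= r <= hi -> gm <= g r <= gM /\ 0 <= th r <= tM) ->
  forall x x', 0 <= x <= 1 -> 0 <= x' <= 1 ->
    `|y x - y x'| <= gM * ((hi - lo) / gm + tM) / nu * `|x - x'|.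
Proof.
move=> c /andP[nu0 nu1] gm0 gth; have [d0 [y0 y1] _ cy dy] := c.
set C := gM * _.
have dle : d <= nu * ((hi - lo) / gm).
  apply: (crossing_parameter_le c nu0 gm0) => r /gth[/andP[? _] /andP[? _]] //.
have lohi : lo <= hi by rewrite -y0 -y1 (crossing_le c).
have dle' : d <= (hi - lo) / gm.
  by apply: le_trans dle _; rewrite ler_piMl// divr_ge0 ?subr_ge0// ltW.
have half x x' : 0 <= x -> x <= x' -> x' <= 1 -> `|y x' - y x| <= C / nu * (x' - x).
  move=> x0 xx x1.
  apply: (@derive_bounded_le _ y (fun x => nu^-1 * (g (y x) * (d + th (y x))))) => //.
  - by apply: within_continuous => t _; exact: cy.
  - by move=> t tI; apply: dy; lra.
  - move=> t tI; have tI' : 0 <= t <= 1 by lra.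
    have [/andP[g1 g2] /andP[t1 t2]] := gth _ (crossing_range c tI').
    have g0 := lt_le_trans gm0 g1.
    rewrite ger0_norm; last first.
      by rewrite mulr_ge0 ?invr_ge0 ?(ltW nu0)// mulr_ge0 ?(ltW g0)// addr_ge0// ltW.
    rewrite [leRHS]mulrC ler_pM2l ?invr_gt0// /C.
    by apply: ler_pM; [exact: ltW|rewrite addr_ge0// ltW|exact: g2|exact: lerD].
move=> x x' /andP[x0 x1] /andP[x0' x1'].
have [xx|xx] := leP x x'.
  by rewrite distrC (distrC x) (@ger0_norm _ (x' - x)) ?subr_ge0//; exact: half.
by rewrite (@gtr0_norm _ (x - x')) ?subr_gt0//; apply: half => //; exact: ltW.
Qed.

(** The source of the lower bounds in L^q: since [y] varies at rate at most C / nu, a discrepancy at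
    [z] survives, up to a factor 2, over a length of order nu. *)
Lemma lipschitz_gap y A C eta nu z x : 0 < C -> 0 < nu ->
  `|y x - y z| <= C / nu * `|x - z| -> 2 * eta <= `|y z - A| ->
  `|x - z| <= eta / C * nu -> eta <= `|y x - A|.
Proof.
move=> C0 nu0 lip gap xz.
have h : C / nu * `|x - z| <= eta.
  have -> : eta = C / nu * (eta / C * nu) by field; rewrite !gt_eqF.
  by rewrite ler_pM2l// divr_gt0.
have : `|y z - A| <= `|y z - y x| + `|y x - A| by exact: ler_distD.
by rewrite (distrC (y z) (y x)); lra.
Qed.

(* arctan ((y - a) / sqrt d) gains at least kappa sqrt d / nu over [0, 1], but
   no more than pi. *)
Lemma crossing_parameter_quadratic g th lo hi nu d y a kappa :
  crossing g th lo hi nu d y -> 0 < nu -> 0 < kappa ->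
  (forall r, lo <= r <= hi -> kappa * (d + (r - a) ^+ 2) <= g r * (d + th r)) ->
  d <= (pi / kappa) ^+ 2 * nu ^+ 2.
Proof.
move=> c nu0 k0 quad; have [d0 [y0 y1] _ cy dy] := c.
pose s := Num.sqrt d; have s0 : 0 < s by rewrite sqrtr_gt0.
have sd : s ^+ 2 = d by rewrite sqr_sqrtr// ltW.
pose f x := atan (s^-1 * (y x - a)) - kappa * s / nu * x.
have df x : 0 <= x <= 1 -> is_derive x 1 f
   ((1 + (s^-1 * (y x - a)) ^+ 2)^-1 * (s^-1 * (nu^-1 * (g (y x) * (d + th (y x))) - 0))
     - kappa * s / nu * 1).
  move=> xI; have d1 := is_derive1Z s^-1 (is_derive1B (dy x xI) (is_derive1_cst a x)).
  have d2 : is_derive x 1 (fun x => atan (s^-1 * (y x - a))) _ :=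
    @is_derive1_comp _ (@atan R) (fun x => s^-1 * (y x - a)) x _ _ (is_derive1_atan _) d1.
  exact: (is_derive1B d2 (is_derive1Z (kappa * s / nu) (is_derive1_id x))).
have imp x : 0 < x < 1 -> 0 <= x <= 1 by move=> /andP[/ltW-> /ltW->].
have fle : f 0 <= f 1.
  apply: (@derive_ge0_le _ f _ 0 1 ler01 _ (fun x xI => df x (imp x xI))).
    apply: within_continuous => t /=; rewrite in_itv/= => tI.
    exact: (is_derive1_continuous (df t tI)).
  move=> x /imp xI; have q := quad _ (crossing_range c xI).
  have ss : 0 < s ^+ 2 + (y x - a) ^+ 2 by rewrite ltr_pwDl ?sqr_ge0// exprn_gt0.
  have p1 : 0 < 1 + (s^-1 * (y x - a)) ^+ 2 by rewrite ltr_pwDl ?sqr_ge0.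
  have -> : (1 + (s^-1 * (y x - a)) ^+ 2)^-1 * (s^-1 * (nu^-1 * (g (y x) * (d + th (y x))) - 0))
     - kappa * s / nu * 1 =
     s / nu / (s ^+ 2 + (y x - a) ^+ 2) *
       (g (y x) * (d + th (y x)) - kappa * (s ^+ 2 + (y x - a) ^+ 2)).
    by field; rewrite !gt_eqF.
  by rewrite mulr_ge0 ?divr_ge0 ?(ltW s0) ?(ltW nu0) ?(ltW ss)// subr_ge0 sd.
have A1 := atan_ltpi2 (s^-1 * (y 1 - a)); have A0 := atan_gtNpi2 (s^-1 * (y 0 - a)).
have le : kappa * s / nu <= pi by move: fle; rewrite /f mulr0 mulr1; lra.
have sle : s <= pi / kappa * nu.
  have -> : s = kappa * s / nu * (nu / kappa) by field; rewrite !gt_eqF.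
  have -> : pi / kappa * nu = pi * (nu / kappa) by ring.
  by rewrite ler_pM2r// divr_gt0.
by rewrite -sd -exprMn ler_pXn2r// nnegrE ?(ltW s0)// (le_trans (ltW s0)).
Qed.

(** With d = O(nu^2) and a quadratic gap, d + th <= (Cd + C) (a - y + nu)^2 as long as y <= a. Hence
    the reciprocal of a - y + nu grows at rate at most C3 / nu; the shift by nu serves to absorb
    [d]. *)
Lemma crossing_characteristic_lower_left g th lo hi a gM C Cd : lo < a ->
  0 < gM -> 0 < C -> 0 < Cd ->
  (forall r, lo <= r <= a -> 0 <= g r <= gM /\ 0 <= th r <= C * (r - a) ^+ 2) ->
  exists c e nu1 : R, [/\ 0 < c, 0 < e <= 1, 0 < nu1 <= 1 &
    forall nu d y, 0 < nu < nu1 -> crossing g th lo hi nu d y -> d <= Cd * nu ^+ 2 ->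
    forall x, 0 <= x <= e -> c * majorant 0 nu x <= `|y x - a|].
Proof.
move=> loa gM0 C0 Cd0 bounds.
pose w0 := a - lo; have w00 : 0 < w0 by rewrite subr_gt0.
pose C3 := gM * (Cd + C); have C30 : 0 < C3 by rewrite mulr_gt0// addr_gt0.
pose K := Num.max w0^-1 C3; have K0 : 0 < K by rewrite lt_max C30 orbT.
(* These make C3 x and nu / w0 at most 1/4 each. The bound then gives a - y + nu >= 2 nu, so half of
   the lower estimate remains once the shift by nu is removed. *)
pose e := Num.min 1 (4^-1 / C3); pose nu1 := Num.min 1 (4^-1 * w0).
exists (2^-1 / K), e, nu1.
have e0 : 0 < e by rewrite lt_min ltr01/= divr_gt0// invr_gt0.
have nu10 : 0 < nu1 by rewrite lt_min ltr01/= mulr_gt0// invr_gt0.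
split; [by rewrite divr_gt0// invr_gt0|by rewrite e0 ge_min lexx|by rewrite nu10 ge_min lexx|].
move=> nu d y /andP[nu0 nuu] c dle; have [d0 [y0 y1] _ cy dy] := c.
have ymono := crossing_le c.
have nuw : nu / w0 <= 4^-1.
  rewrite ler_pdivrMr//; apply: ltW; apply: lt_le_trans nuu _.
  by rewrite /nu1 ge_min lexx orbT.
have core x : 0 <= x <= e -> y x <= a ->
    (a - y x + nu)^-1 <= w0^-1 + C3 / nu * x.
  move=> /andP[x0 xe] ya; have x1 : x <= 1 by apply: le_trans xe _; rewrite ge_min lexx.
  have pos t : t <= x -> 0 < a - y t + nu.
    by move=> /ymono tx; rewrite ltr_wpDl// subr_ge0 (le_trans tx).
  pose f t := - (a - y t + nu)^-1 + C3 / nu * t.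
  have df t : 0 <= t <= x -> is_derive t 1 f
      (- (- ((0 - nu^-1 * (g (y t) * (d + th (y t)))) + 0) / (a - y t + nu) ^+ 2) + C3 / nu * 1).
    move=> /andP[t0 tx]; have tI : 0 <= t <= 1 by rewrite t0 (le_trans tx).
    have pt : a - y t + nu != 0 by rewrite gt_eqF// pos.
    exact: (is_derive1D (is_derive1N (is_derive1V (is_derive1D (is_derive1B (is_derive1_cst a t)
      (dy t tI)) (is_derive1_cst nu t)) pt)) (is_derive1Z (C3 / nu) (is_derive1_id t))).
  have fle : f 0 <= f x.
    apply: (@derive_ge0_le _ f _ 0 x x0 _ (fun t tI => df t _)) => [|t /andP[/ltW->/ltW->]//|t /andP[t0 tx]].
      apply: within_continuous => t /=; rewrite in_itv/= => tI.
      exact: (is_derive1_continuous (df t tI)).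
    have pt := pos t (ltW tx).
    have yt : lo <= y t <= a.
      by rewrite -y0 (ymono _ _ (ltW t0)) (le_trans (ymono _ _ (ltW tx)) ya).
    have [/andP[g0 gle] /andP[t0' tle]] := bounds _ yt.
    have -> : - (- ((0 - nu^-1 * (g (y t) * (d + th (y t)))) + 0) / (a - y t + nu) ^+ 2) + C3 / nu * 1 =
       (C3 * (a - y t + nu) ^+ 2 - g (y t) * (d + th (y t))) / (nu * (a - y t + nu) ^+ 2).
      by field; rewrite !gt_eqF.
    apply: divr_ge0; last by rewrite mulr_ge0 ?sqr_ge0// ltW.
    rewrite subr_ge0 /C3 -mulrA; apply: ler_pM => //; first by rewrite addr_ge0// ltW.
    have pt0 := ltW pt; have nu0' := ltW nu0; have [_ ya'] := andP yt.
    have ya0 : 0 <= a - y t by rewrite subr_ge0.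
    have s1 : nu ^+ 2 <= (a - y t + nu) ^+ 2.
      by rewrite ler_pXn2r ?nnegrE// lerDr.
    have s2 : (y t - a) ^+ 2 <= (a - y t + nu) ^+ 2.
      by rewrite -sqrrN opprB ler_pXn2r ?nnegrE// lerDl.
    have s3 : Cd * nu ^+ 2 <= Cd * (a - y t + nu) ^+ 2 by rewrite ler_pM2l.
    have s4 : C * (y t - a) ^+ 2 <= C * (a - y t + nu) ^+ 2 by rewrite ler_pM2l.
    by rewrite mulrDl; lra.
  have h : (a - y x + nu)^-1 <= (a - y 0 + nu)^-1 + C3 / nu * x.
    by move: fle; rewrite /f mulr0; lra.
  apply: le_trans h _; rewrite lerD2r lef_pV2 ?posrE ?y0//; first by rewrite lerDl ltW.
  by rewrite -y0 pos.
have Cx x : 0 <= x <= e -> C3 * x <= 4^-1.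
  move=> /andP[_ xe]; rewrite mulrC -ler_pdivlMr//; apply: le_trans xe _.
  by rewrite ge_min lexx orbT.
have nuB x : nu * (w0^-1 + C3 / nu * x) = nu / w0 + C3 * x.
  by field; rewrite !gt_eqF.
(* The value [a] is not passed before [e]: at a time where y = a the bound from [core] would read 1
   <= nu / w0 + C3 t, whereas the right-hand side is at most 1/2. *)
have ya x : 0 <= x <= e -> y x <= a.
  move=> /andP[x0 xe]; rewrite leNgt; apply/negP => ax.
  have [||t] := @IVT _ y 0 x a x0.
  - by apply: within_continuous => t _; exact: cy.
  - by rewrite y0 ge_min le_max (ltW loa) (ltW ax) orbT.
  rewrite in_itv/= => /andP[t0 tx] yt.
  have te : 0 <= t <= e by rewrite t0 (le_trans tx).
  have := core t te; rewrite yt subrr add0r lexx => /(_ isT) h.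
  have : 1 <= nu / w0 + C3 * t.
    by rewrite -nuB -[leLHS](mulfV (lt0r_neq0 nu0)) ler_pM2l.
  by have := Cx t te; lra.
move=> x xI; have yax := ya x xI; have h := core x xI yax.
have /andP[x0 xe] := xI.
rewrite ler0_norm ?subr_le0// opprB /majorant subr0 ger0_norm//.
set B := w0^-1 + C3 / nu * x in h.
have w0V : 0 < w0^-1 by rewrite invr_gt0.
have B0 : 0 < B.
  by rewrite ltr_pwDl//; apply: mulr_ge0 => //; rewrite ltW// divr_gt0.
have wB : B^-1 <= a - y x + nu.
  rewrite -[leRHS]invrK lef_pV2 ?posrE// invr_gt0 ltr_wpDl// subr_ge0 //.
have nuB2 : nu <= 2^-1 * B^-1.
  rewrite ler_pdivlMr// -/B nuB; have := Cx x xI; lra.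
have BK : B <= K * ((nu + x) / nu).
  have -> : K * ((nu + x) / nu) = K + K / nu * x by field; rewrite gt_eqF.
  apply: lerD; first by rewrite le_max lexx.
  apply: ler_wpM2r => //; rewrite ler_pM2r ?invr_gt0//.
  by rewrite le_max lexx orbT.
have nx : 0 < nu + x by lra.
have : (K * ((nu + x) / nu))^-1 <= B^-1.
  by rewrite lef_pV2 ?posrE// mulr_gt0// divr_gt0.
have -> : 2^-1 / K * (nu / (nu + x)) = 2^-1 * (K * ((nu + x) / nu))^-1.
  by field; rewrite !gt_eqF.
by lra.
Qed.

End Crossings.

(** * Location of the shock from the crossing times *)

Section ShockLocation.
Context {R : realType}.
Implicit Types (g th y : R -> R).

(* Near lo the flux gap behaves like d + k0 (y - lo), so the time spent between
   lo and c is nu / (g lo * k0) * ln (1 / d) + O(nu). *)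
Lemma crossing_half_time g th (lo hi nu d : R) y (c k0 kp Cg Ct gm xc : R) :
  crossing g th lo hi nu d y -> 0 < nu -> 0 < k0 -> 0 < kp -> 0 < gm ->
  0 <= Cg -> 0 <= Ct -> lo < c ->
  (forall r, lo <= r <= c -> [/\ gm <= g r, `|g r - g lo| <= Cg * (r - lo),
     kp * (r - lo) <= th r & `|th r - k0 * (r - lo)| <= Ct * (r - lo) ^+ 2]) ->
  0 <= xc <= 1 -> y xc = c ->
  `|nu / (g lo * k0) * (ln (d + k0 * (c - lo)) - ln d) - xc|
    <= (Cg / (g lo * k0 * gm) + Ct / (k0 * kp * gm)) * (c - lo) * nu.
Proof.
move=> cr nu0 k00 kp0 gm0 Cg0 Ct0 loc H /andP[xc0 xc1] yxc.
have [d0 [y0 y1] _ cy dy] := cr; have ymono := crossing_le cr.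
set Q := Cg / _ + _; pose al := (g lo * k0)^-1.
have glo : 0 < g lo.
  by have [h _ _ _] := H lo ltac:(by rewrite lexx ltW); exact: lt_le_trans h.
have yI (x : R) : 0 <= x <= xc -> lo <= y x <= c.
  by move=> /andP[x0 xx]; rewrite -y0 -yxc !ymono.
have arg0 (x : R) : 0 <= x <= xc -> 0 < d + k0 * (y x - lo).
  by move=> /yI/andP[ly _]; rewrite ltr_pwDl// mulr_ge0 ?(ltW k00)// subr_ge0.
(* The first term is the clock of the equation linearized at [lo], so [f] is its deviation from the
   true time. The bound |f'| <= Q nu y' makes both [f] + Q nu y and - [f] + Q nu y nondecreasing,
   and the total deviation is at most Q nu (c - lo). *)
pose f x := nu * al * ln (d + k0 * (y x - lo)) - x.
pose f' x := nu * al * ((0 + k0 * (nu^-1 * (g (y x) * (d + th (y x))) - 0)) / (d + k0 * (y x - lo))) - 1.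
have df (x : R) : 0 <= x <= xc -> is_derive x 1 f (f' x).
  move=> /[dup] xI /andP[x0 xx]; have xI1 : 0 <= x <= 1 by rewrite x0 (le_trans xx).
  exact: (is_derive1B (is_derive1Z (nu * al) (is_derive1_ln_comp (is_derive1D (is_derive1_cst d x)
    (is_derive1Z k0 (is_derive1B (dy x xI1) (is_derive1_cst lo x)))) (arg0 x xI))) (is_derive1_id x)).
have f'le (x : R) : 0 <= x <= xc -> `|f' x| <= Q * (g (y x) * (d + th (y x))).
  move=> xI; have A0 := arg0 x xI; have [g1 g2 t1 t2] := H _ (yI x xI).
  have /andP[ly yc] := yI x xI.
  set s := y x - lo in A0 g2 t1 t2 *; set G := g (y x) in g1 g2 *; set t := th (y x) in t1 t2 *.
  have s0 : 0 <= s by rewrite subr_ge0.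
  have t0 : 0 <= t by apply: le_trans t1; rewrite mulr_ge0 ?(ltW kp0).
  have dt0 : 0 < d + t by rewrite ltr_pwDl.
  have E : f' x = ((G - g lo) * (d + t) + g lo * (t - k0 * s)) / (g lo * (d + k0 * s)).
    by rewrite /f' -/s -/G -/t /al; field; rewrite !gt_eqF.
  have p1 : 0 < g lo * (d + k0 * s) by rewrite mulr_gt0.
  rewrite E normrM (@gtr0_norm _ (_ ^-1)) ?invr_gt0// ler_pdivrMr//.
  have n1 : `|(G - g lo) * (d + t) + g lo * (t - k0 * s)| <=
     Cg * s * (d + t) + g lo * (Ct * s ^+ 2).
    apply: le_trans (ler_normD _ _) _; rewrite !normrM (gtr0_norm dt0) (gtr0_norm glo).
    by apply: lerD; [rewrite ler_pM2r|rewrite ler_pM2l].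
  apply: le_trans n1 _.
  have -> : Q * (G * (d + t)) * (g lo * (d + k0 * s)) =
     Cg * (d + t) * ((d + k0 * s) / k0 * (G / gm)) +
     g lo * (Ct * (((d + k0 * s) / k0) * ((d + t) / kp * (G / gm)))).
    by rewrite /Q; field; rewrite !gt_eqF.
  have G1 : 1 <= G / gm by rewrite ler_pdivlMr// mul1r.
  have s1 : s <= (d + k0 * s) / k0 by rewrite ler_pdivlMr//; lra.
  have s2 : s <= (d + t) / kp by rewrite ler_pdivlMr//; lra.
  apply: lerD.
    rewrite mulrAC; apply: ler_wpM2l; first by rewrite mulr_ge0// ltW.
    by rewrite -[leLHS]mulr1; apply: ler_pM.
  apply: ler_wpM2l; first exact: ltW.
  apply: ler_wpM2l => //; rewrite expr2; apply: ler_pM => //.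
  by rewrite -[leLHS]mulr1; apply: ler_pM.
have side (sg : R) : `|sg| = 1 ->
    sg * f 0 + Q * nu * y 0 <= sg * f xc + Q * nu * y xc.
  move=> sg1.
  have d1 (x : R) : 0 <= x <= xc -> is_derive x 1 (fun x => sg * f x + Q * nu * y x)
      (sg * f' x + Q * nu * (nu^-1 * (g (y x) * (d + th (y x))))).
    move=> /[dup] xI /andP[x0 xx]; have xI1 : 0 <= x <= 1 by rewrite x0 (le_trans xx).
    exact: (is_derive1D (is_derive1Z sg (df x xI)) (is_derive1Z (Q * nu) (dy x xI1))).
  have imp (x : R) : 0 < x < xc -> 0 <= x <= xc by move=> /andP[/ltW-> /ltW->].
  apply: (@derive_ge0_le _ (fun x => sg * f x + Q * nu * y x) _ 0 xc xc0 _
    (fun x xI => d1 x (imp x xI))).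
    apply: within_continuous => t /=; rewrite in_itv/= => tI.
    exact: (is_derive1_continuous (d1 t tI)).
  move=> x /imp xI; have := f'le x xI.
  have -> : Q * nu * (nu^-1 * (g (y x) * (d + th (y x)))) = Q * (g (y x) * (d + th (y x))).
    by field; rewrite gt_eqF.
  move=> fl; have : `|sg * f' x| <= Q * (g (y x) * (d + th (y x))).
    by rewrite normrM sg1 mul1r.
  by rewrite ler_norml; lra.
have h1 := side 1 (normr1 _); have h2 := side (-1) (normrN1 _).
have -> : nu / (g lo * k0) * (ln (d + k0 * (c - lo)) - ln d) - xc = f xc - f 0.
  by rewrite /f yxc y0 subrr mulr0 addr0 subr0 /al; ring.
have -> : Q * (c - lo) * nu = Q * nu * y xc - Q * nu * y 0 by rewrite yxc y0; ring.
by rewrite ler_norml; lra.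
Qed.

Let log_bound (d D0 w : R) : 0 < d -> d <= D0 -> 0 < w ->
  `|ln (d + w)| <= `|ln w| + `|ln (D0 + w)|.
Proof.
move=> d0 dD w0.
have l1 : ln w <= ln (d + w) by rewrite ler_ln ?posrE; lra.
have l2 : ln (d + w) <= ln (D0 + w) by rewrite ler_ln ?posrE; lra.
have := ler_norm (ln (D0 + w)); have := ler_norm (- ln w); rewrite normrN.
have := normr_ge0 (ln w); have := normr_ge0 (ln (D0 + w)).
by rewrite ler_norml; lra.
Qed.

(** Only ln d can become large: ln (d + k0 (c - lo)) stays bounded because d <= D0, and it joins the
    O(nu) error. *)
Lemma crossing_half_time_asymp g th (lo hi c k0 kp Cg Ct gm D0 : R) :
  0 < k0 -> 0 < kp -> 0 < gm -> 0 <= Cg -> 0 <= Ct -> lo < c ->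
  (forall r, lo <= r <= c -> [/\ gm <= g r, `|g r - g lo| <= Cg * (r - lo),
     kp * (r - lo) <= th r & `|th r - k0 * (r - lo)| <= Ct * (r - lo) ^+ 2]) ->
  exists2 C : R, 0 <= C & forall nu d y xc, 0 < nu -> d <= D0 ->
    crossing g th lo hi nu d y -> 0 <= xc <= 1 -> y xc = c ->
    `|xc + nu * ((g lo * k0)^-1 * ln d)| <= C * nu.
Proof.
move=> k00 kp0 gm0 Cg0 Ct0 loc H.
have glo : 0 < g lo.
  by have [h _ _ _] := H lo ltac:(by rewrite lexx ltW); exact: lt_le_trans h.
pose w := k0 * (c - lo); have w0 : 0 < w by rewrite mulr_gt0// subr_gt0.
pose al := (g lo * k0)^-1; have al0 : 0 < al by rewrite invr_gt0 mulr_gt0.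
pose Q := (Cg / (g lo * k0 * gm) + Ct / (k0 * kp * gm)) * (c - lo).
have Q0 : 0 <= Q.
  rewrite mulr_ge0 ?subr_ge0 ?(ltW loc)// addr_ge0// divr_ge0//.
    by rewrite ltW// !mulr_gt0.
  by rewrite ltW// !mulr_gt0.
exists (Q + al * (`|ln w| + `|ln (D0 + w)|)).
  by rewrite addr_ge0// mulr_ge0 ?addr_ge0// ltW.
move=> nu d y xc nu0 dD cr xcI yxc; have [d0 _ _ _ _] := cr.
have := crossing_half_time cr nu0 k00 kp0 gm0 Cg0 Ct0 loc H xcI yxc.
rewrite -/Q -/w -/al => h1.
have h2 := log_bound d0 dD w0.
have E : xc + nu * (al * ln d) =
   nu * al * ln (d + w) - (nu * al * (ln (d + w) - ln d) - xc) by ring.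
rewrite -/al E; apply: le_trans (ler_normB _ _) _.
have na : 0 < nu * al by rewrite mulr_gt0.
rewrite normrM (gtr0_norm na) [leRHS]mulrDl addrC; apply: lerD => //.
rewrite [leRHS]mulrAC [al * nu]mulrC ler_pM2l//.
Qed.

(** With alpha = 1 / (g(lo) k0) and beta = 1 / (g(hi) k1), the times spent below and above level [c]
    are -alpha nu ln d and -beta nu ln d up to O(nu), and they add up to one. Eliminating ln d
    places the passage through [c] within O(nu) of alpha / (alpha + beta); decay estimates measured
    from the true passage point then transfer to this fixed one. *)
Lemma crossing_shock g th (lo c hi k0 k1 kp Cg Ct gm : R) :
  0 < k0 -> 0 < k1 -> 0 < kp -> 0 < gm -> 0 <= Cg -> 0 <= Ct -> lo < c -> c < hi ->
  (forall r, lo <= r <= c -> [/\ gm <= g r, `|g r - g lo| <= Cg * (r - lo),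
     kp * (r - lo) <= th r & `|th r - k0 * (r - lo)| <= Ct * (r - lo) ^+ 2]) ->
  (forall r, c <= r <= hi -> [/\ gm <= g r, `|g r - g hi| <= Cg * (hi - r),
     kp * (hi - r) <= th r & `|th r - k1 * (hi - r)| <= Ct * (hi - r) ^+ 2]) ->
  exists x0 K : R, [/\ 0 < x0 < 1, 0 < K & forall nu d y, 0 < nu <= 1 ->
    crossing g th lo hi nu d y -> forall x, 0 <= x <= 1 ->
    `|y x - (if x < x0 then lo else hi)| <= K * majorant x0 nu x].
Proof.
move=> k00 k10 kp0 gm0 Cg0 Ct0 loc chi HL HR.
have lohi := lt_trans loc chi.
have glo : 0 < g lo.
  by have [h _ _ _] := HL lo ltac:(by rewrite lexx ltW); exact: lt_le_trans h.
have ghi : 0 < g hi.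
  by have [h _ _ _] := HR hi ltac:(by rewrite lexx ltW); exact: lt_le_trans h.
have gth r : lo <= r <= hi -> gm <= g r /\ 0 <= th r.
  move=> rI; have [rc|cr] := leP r c.
    have [h1 _ h2 _] := HL r ltac:(lra); split=> //.
    by apply: le_trans h2; rewrite mulr_ge0 ?(ltW kp0)//; lra.
  have [h1 _ h2 _] := HR r ltac:(lra); split=> //.
  by apply: le_trans h2; rewrite mulr_ge0 ?(ltW kp0)//; lra.
pose D0 := (hi - lo) / gm.
have dD nu d y : 0 < nu <= 1 -> crossing g th lo hi nu d y -> d <= D0.
  move=> /andP[nu0 nu1] cr; apply: le_trans (crossing_parameter_le cr nu0 gm0 gth) _.
  by rewrite ler_piMl// divr_ge0 ?subr_ge0// ltW.
have [C1 C10 H1] := @crossing_half_time_asymp g th lo hi c k0 kp Cg Ct gm D0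
   k00 kp0 gm0 Cg0 Ct0 loc HL.
have NcNhi : - hi < - c by rewrite ltrN2.
have HR' r : - hi <= r <= - c -> [/\ gm <= g (- r), `|g (- r) - g (- - hi)| <= Cg * (r - - hi),
     kp * (r - - hi) <= th (- r) & `|th (- r) - k1 * (r - - hi)| <= Ct * (r - - hi) ^+ 2].
  move=> rI; rewrite !opprK; have := HR (- r) ltac:(lra).
  by rewrite opprK (addrC hi).
have [C2 C20 H2] := @crossing_half_time_asymp (fun v => g (- v)) (fun v => th (- v))
   (- hi) (- lo) (- c) k1 kp Cg Ct gm D0 k10 kp0 gm0 Cg0 Ct0 NcNhi HR'.
pose al := (g lo * k0)^-1; pose be := (g hi * k1)^-1.
have al0 : 0 < al by rewrite invr_gt0 mulr_gt0.
have be0 : 0 < be by rewrite invr_gt0 mulr_gt0.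
have ab0 : 0 < al + be by rewrite addr_gt0.
pose x0 := al / (al + be); pose C3 := (be * C1 + al * C2) / (al + be).
have C30 : 0 <= C3 by rewrite divr_ge0 ?(ltW ab0)// addr_ge0// mulr_ge0// ltW.
pose W := hi - lo; have W0 : 0 < W by rewrite subr_gt0.
(* Distances within the interval are at most [W], so the linear lower bounds on [th] imply quadratic
   ones with this constant, as the decay lemmas require. *)
pose k := gm * kp / W; have kk0 : 0 < k by rewrite divr_gt0// mulr_gt0.
pose K1 := Num.max W k^-1; have K10 : 0 < K1 by rewrite lt_max W0.
exists x0, (K1 * (1 + C3)); split.
- by rewrite divr_gt0//= ltr_pdivrMr// mul1r ltrDl.
- by rewrite mulr_gt0// ltr_pwDl.
move=> nu d y nuI cr x xI; have /andP[nu0 nu1] := nuI.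
have [d0 [y0 y1] _ cy dy] := cr; have ymono := crossing_le cr.
have [|xc] := @IVT _ y 0 1 c ler01 (within_continuous (fun x _ => cy x)).
  by rewrite y0 y1 ge_min le_max (ltW loc) (ltW chi) orbT.
rewrite in_itv/= => xcI yxc.
have h1 := H1 nu d y xc nu0 (dD nu d y nuI cr) cr xcI yxc.
have h2 : `|1 - xc + nu * ((g (- - hi) * k1)^-1 * ln d)| <= C2 * nu.
  apply: (H2 nu d (fun x => - y (1 - x)) (1 - xc) nu0 (dD nu d y nuI cr)).
  - exact: crossing_reflect.
  - by lra.
  - by rewrite subKr yxc.
rewrite opprK -/be in h2; rewrite -/al in h1.
(* Weighting the two time expansions by [be] and - [al] cancels ln d. *)
have close : `|xc - x0| <= C3 * nu.
  have -> : xc - x0 = (be * (xc + nu * (al * ln d)) - al * (1 - xc + nu * (be * ln d))) / (al + be).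
    by rewrite /x0; field; rewrite gt_eqF.
  rewrite normrM (@gtr0_norm _ (_ ^-1)) ?invr_gt0// ler_pdivrMr//.
  have -> : C3 * nu * (al + be) = be * (C1 * nu) + al * (C2 * nu).
    by rewrite /C3; field; rewrite gt_eqF.
  apply: le_trans (ler_normB _ _) _; rewrite !normrM (gtr0_norm al0) (gtr0_norm be0).
  by apply: lerD; rewrite ler_pM2l.
have C31 : 0 < 1 + C3 by rewrite ltr_pwDl.
have maj0 z : 0 < nu + `|x - z| by rewrite ltr_pwDl.
have conv : majorant xc nu x <= (1 + C3) * majorant x0 nu x.
  rewrite /majorant mulrA ler_pdivrMr// mulrAC ler_pdivlMr//.
  have t1 : `|x - x0| <= `|x - xc| + `|xc - x0| by exact: ler_distD.
  have t2 : nu + `|x - x0| <= (1 + C3) * (nu + `|x - xc|).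
    have : 0 <= C3 * `|x - xc| by rewrite mulr_ge0.
    by lra.
  have -> : (1 + C3) * nu * (nu + `|x - xc|) = nu * ((1 + C3) * (nu + `|x - xc|)) by ring.
  by rewrite ler_pM2l.
have convK : K1 * majorant xc nu x <= K1 * (1 + C3) * majorant x0 nu x.
  by rewrite -mulrA ler_pM2l.
(* Between [x0] and the true passage point the majorant at [x0] is at least 1 / (1 + C3), so the
   trivial bound by the length of the interval suffices. *)
have crude A : lo <= A <= hi -> `|x - x0| <= `|xc - x0| ->
    `|y x - A| <= K1 * (1 + C3) * majorant x0 nu x.
  move=> AI xx0; have yxI := crossing_range cr xI.
  have e1 : `|y x - A| <= K1.
    apply: le_trans (_ : W <= _); last by rewrite le_max lexx.
    by rewrite /W ler_norml; lra.
  apply: le_trans e1 _; rewrite -mulrA ler_peMr ?(ltW K10)// /majorant mulrA.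
  rewrite ler_pdivlMr// mul1r; have : `|x - x0| <= C3 * nu by exact: le_trans close.
  by lra.
have quadL r : lo <= r <= c -> k * (r - lo) ^+ 2 <= g r * (d + th r).
  move=> rI; have [g1 _ t1 _] := HL r rI.
  have r0 : 0 <= r - lo by lra.
  have e1 : gm * (kp * (r - lo)) <= g r * (d + th r).
    apply: ler_pM => //; [exact: ltW|by rewrite mulr_ge0 ?(ltW kp0)|].
    by apply: le_trans t1 _; rewrite lerDr ltW.
  apply: le_trans e1; rewrite /k (_ : gm * kp / W * (r - lo) ^+ 2 = gm * (kp * (r - lo)) * ((r - lo) / W)); last by ring.
  rewrite ler_piMr//; first by rewrite !mulr_ge0 // ltW.
  by rewrite ler_pdivrMr// mul1r /W; lra.
have quadR r : c <= r <= hi -> k * (r - hi) ^+ 2 <= g r * (d + th r).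
  move=> rI; have [g1 _ t1 _] := HR r rI.
  have r0 : 0 <= hi - r by lra.
  have e1 : gm * (kp * (hi - r)) <= g r * (d + th r).
    apply: ler_pM => //; [exact: ltW|by rewrite mulr_ge0 ?(ltW kp0)|].
    by apply: le_trans t1 _; rewrite lerDr ltW.
  apply: le_trans e1; rewrite /k (_ : gm * kp / W * (r - hi) ^+ 2 = gm * (kp * (hi - r)) * ((hi - r) / W)); last by ring.
  rewrite ler_piMr//; first by rewrite !mulr_ge0 // ltW.
  by rewrite ler_pdivrMr// mul1r /W; lra.
have [xx0|x0x] := ltP x x0; have [xxc|xcx] := leP x xc.
- apply: le_trans convK; have [ylo|ylo|<-] := ltgtP lo (y x).
  + rewrite gtr0_norm ?subr_gt0// /majorant ler0_norm ?opprB; last by lra.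
    apply: (crossing_decay_right cr) => //; try lra.
      by rewrite yxc /W; lra.
    by move=> r rI; apply: quadL; lra.
  + by have := crossing_range cr xI; lra.
  + by rewrite subrr normr0 mulr_ge0 ?(ltW K10)// divr_ge0// ltW.
- apply: crude; first by rewrite lexx ltW.
  have a1 : x - x0 <= 0 by rewrite subr_le0 ltW.
  have a2 : xc - x0 <= 0 by rewrite subr_le0 ltW// (lt_trans xcx).
  by rewrite (ler0_norm a1) (ler0_norm a2) lerN2 lerD2r ltW.
- apply: crude; first by rewrite lexx ltW.
  have a1 : 0 <= x - x0 by rewrite subr_ge0.
  have a2 : 0 <= xc - x0 by rewrite subr_ge0 (le_trans x0x).
  by rewrite (ger0_norm a1) (ger0_norm a2) lerD2r.
- apply: le_trans convK; have [yhi|yhi|->] := ltgtP (y x) hi.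
  + rewrite ltr0_norm ?subr_lt0// opprB /majorant gtr0_norm ?subr_gt0//.
    apply: (crossing_decay_left cr) => //; try lra.
      by rewrite yxc /W; lra.
    by move=> r rI; apply: quadR; lra.
  + by have := crossing_range cr xI; lra.
  + by rewrite subrr normr0 mulr_ge0 ?(ltW K10)// divr_ge0// ltW.
Qed.

End ShockLocation.

(** * Second-order bounds for psi at a point *)

Section PressureExpansions.
Context {R : realType} {p : R -> R} {m : R}.
Hypotheses (hp : pressure_law p) (m0 : 0 < m).
Implicit Types (r s a lo hi : R).

Local Notation P := (psi p m).
Local Notation D := (dpsi p m).

(** The estimate is centred at a single point because p'' need not be continuous. Differentiability
    at [a] bounds the difference quotient within distance [e]; farther away, monotonicity bounds the
    increment by [B] and the quotient by B / e. *)
Lemma dpsi_lipschitz_at a lo hi : 0 < lo -> lo <= a <= hi ->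
  exists2 C, 0 < C & forall r, lo <= r <= hi -> `|D r - D a| <= C * `|r - a|.
Proof.
move=> lo0 /andP[la ah]; have a0 := lt_le_trans lo0 la.
have hi0 := lt_le_trans a0 ah.
have aa0 : a * a != 0 by rewrite mulf_neq0 ?gt_eqF.
have da := is_derive1M (is_derive1_id a) (is_derive1_id a).
have dD := is_derive1B (is_derive_dpressure hp a0) (is_derive1Z (m ^+ 2) (is_derive1V da aa0)).
have /is_derive1_caratheodory[q [qE cq _]] := dD.
have /nbhs_ballP[e /= e0 He] : \forall v \near a, `|q v| < `|q a| + 1.
  have : `|q v| @[v --> a] --> `|q a| by exact: cvg_norm.
  by move/cvgr_lt; apply; rewrite ltrDl.
have e0' : (0 : R) < e by [].
pose B := D hi - D lo; have B0 : 0 <= B by rewrite subr_ge0 dpsi_le// (le_trans la).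
exists (`|q a| + 1 + B / e).
  by rewrite ltr_pwDl ?ltr_wpDl// divr_ge0// ltW.
move=> r /andP[lr rh]; have r0 := lt_le_trans lo0 lr.
have Be : 0 <= B / e by rewrite divr_ge0// ltW.
have [re|er] := ltP `|r - a| e.
  have -> : D r - D a = q r * (r - a) by rewrite -qE.
  rewrite normrM; apply: ler_wpM2r => //.
  have : `|q r| < `|q a| + 1 by apply: He; rewrite /ball/= distrC.
  by lra.
have l1 : D lo <= D r by exact: dpsi_le.
have l2 : D r <= D hi by exact: dpsi_le.
have l3 : D lo <= D a by exact: dpsi_le.
have l4 : D a <= D hi by exact: dpsi_le.
apply: le_trans (_ : B <= _); first by rewrite /B ler_norml; lra.
apply: le_trans (_ : B / e * `|r - a| <= _).
  by rewrite mulrAC ler_pdivlMr// ler_wpM2l.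
by apply: ler_wpM2r => //; rewrite lerDr addr_ge0.
Qed.

(** The tangent at [a] gives the lower bound, and the tangent at [r] bounds the remainder by (D r -
    D a) (r - a). *)
Lemma psi_quadratic_upper a lo hi : 0 < lo -> lo <= a <= hi ->
  exists2 C, 0 < C & forall r, lo <= r <= hi ->
    0 <= P r - P a - D a * (r - a) <= C * (r - a) ^+ 2.
Proof.
move=> lo0 aI; have [C C0 HC] := dpsi_lipschitz_at lo0 aI.
case/andP: aI => la ah; have a0 := lt_le_trans lo0 la.
exists C => // r rI; have /andP[lr rh] := rI; have r0 := lt_le_trans lo0 lr.
have := psi_tangent_le (m := m) hp a0 r0; have := psi_tangent_le (m := m) hp r0 a0.
move=> h1 h2; apply/andP; split; first by lra.
apply: le_trans (_ : (D r - D a) * (r - a) <= _); first by lra.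
apply: le_trans (ler_norm _) _; rewrite normrM -[(r - a) ^+ 2]real_normK ?num_real//.
by rewrite expr2 mulrA; apply: ler_wpM2r => //; exact: HC.
Qed.

Lemma psi_chord r s t : 0 < r -> r <= s -> s <= t ->
  (t - r) * P s <= (t - s) * P r + (s - r) * P t.
Proof.
move=> r0 rs st; have s0 := lt_le_trans r0 rs; have t0 := lt_le_trans s0 st.
have h1 : (t - s) * (P s + D s * (r - s)) <= (t - s) * P r.
  by apply: ler_wpM2l; [rewrite subr_ge0|exact: psi_tangent_le].
have h2 : (s - r) * (P s + D s * (t - s)) <= (s - r) * P t.
  by apply: ler_wpM2l; [rewrite subr_ge0|exact: psi_tangent_le].
have -> : (t - r) * P s = (t - s) * (P s + D s * (r - s)) + (s - r) * (P s + D s * (t - s)) by ring.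
exact: lerD.
Qed.

End PressureExpansions.

(** * Norms of the majorant *)

Section Integrals.
Context {R : realType}.
Notation mu := (@lebesgue_measure R).
Implicit Types (f g E : R -> R) (q nu z K : R).

Lemma Lq_dist01E q f g : q != 0 -> Lq_dist01 q f g =
  ((\int[mu]_(x in `]0%R, 1%R[) (`|f x - g x| `^ q)%:E) `^ q^-1)%E.
Proof.
move=> q0; rewrite /Lq_dist01 unlock [in RHS]integral_mkcond; congr (_ `^ _)%E.
apply: eq_integral => x _; rewrite /= /patch; case: ifPn => _ //.
by rewrite normr0 powR0.
Qed.

Lemma integral_antiderivative_le (f F : R -> R) (a b B : R) : 0 <= B ->
  (forall x, a <= x <= b -> is_derive x 1 F (f x) /\ {for x, continuous f}) ->
  F b - F a <= B -> (\int[mu]_(x in `[a, b]) (f x)%:E <= B%:E)%E.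
Proof.
move=> B0 dF FB; have [ab|ba] := ltP a b; last first.
  have [E|neq] := eqVneq a b; first by rewrite E set_itv1 integral_set1 lee_fin.
  rewrite set_itv_ge ?integral_set0 ?lee_fin// bnd_simp -ltNge lt_neqAle ba.
  by rewrite eq_sym neq.
rewrite (@continuous_FTC2 _ f F)//.
- apply: within_continuous => x /=; rewrite in_itv/= => xI.
  by have [] := dF x xI.
- split.
  + by move=> x; rewrite in_itv/= => /andP[/ltW ax /ltW xb]; have [[]] := dF x ltac:(by rewrite ax).
  + apply: cvg_at_right_filter; have [d _] := dF a ltac:(by rewrite lexx ltW).
    exact: (is_derive1_continuous d).
  + apply: cvg_at_left_filter; have [d _] := dF b ltac:(by rewrite lexx ltW).
    exact: (is_derive1_continuous d).
- move=> x; rewrite in_itv/= => /andP[/ltW ax /ltW xb].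
  by have [d _] := dF x ltac:(by rewrite ax); rewrite (is_derive1E d).
Qed.

Lemma integral_antiderivativeE (f F : R -> R) (a b : R) : a < b ->
  (forall x, a <= x <= b -> is_derive x 1 F (f x) /\ {for x, continuous f}) ->
  (\int[mu]_(x in `[a, b]) (f x)%:E = (F b - F a)%:E)%E.
Proof.
move=> ab dF; rewrite (@continuous_FTC2 _ f F)//.
- apply: within_continuous => x /=; rewrite in_itv/= => xI.
  by have [] := dF x xI.
- split.
  + by move=> x; rewrite in_itv/= => /andP[/ltW ax /ltW xb]; have [[]] := dF x ltac:(by rewrite ax).
  + apply: cvg_at_right_filter; have [d _] := dF a ltac:(by rewrite lexx ltW).
    exact: (is_derive1_continuous d).
  + apply: cvg_at_left_filter; have [d _] := dF b ltac:(by rewrite lexx ltW).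
    exact: (is_derive1_continuous d).
- move=> x; rewrite in_itv/= => /andP[/ltW ax /ltW xb].
  by have [d _] := dF x ltac:(by rewrite ax); rewrite (is_derive1E d).
Qed.

(** An antiderivative of the q-th power of the majorant on the side of [z] selected by sg = 1 or -1,
    where the majorant is 1 / G. *)
Definition primitive_majorant (q sg z nu x : R) : R :=
  let G := 1 + sg / nu * (x - z) in
  if q == 1 then sg * nu * ln G else sg * (nu / (1 - q)) * G `^ (1 - q).

Lemma primitive_majorantP q sg z nu x : 0 < nu -> sg ^+ 2 = 1 -> 0 <= sg * (x - z) ->
  is_derive x 1 (primitive_majorant q sg z nu)
    ((1 + sg / nu * (x - z)) `^ (- q)) /\
  {for x, continuous (fun x => (1 + sg / nu * (x - z)) `^ (- q))}.
Proof.
move=> nu0 sg1 xz; pose G x := 1 + sg / nu * (x - z).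
have G0 : 0 < G x.
  rewrite ltr_pwDl// (_ : sg / nu * (x - z) = sg * (x - z) / nu); last by ring.
  by rewrite divr_ge0// ltW.
have dG : is_derive x 1 G (0 + sg / nu * (1 - 0)).
  exact: (is_derive1D (is_derive1_cst 1 x) (is_derive1Z (sg / nu)
    (is_derive1B (is_derive1_id x) (is_derive1_cst z x)))).
have dpow s : is_derive x 1 (fun x => G x `^ s) (s * G x `^ (s - 1) * (0 + sg / nu * (1 - 0))).
  exact: (@is_derive1_comp _ (fun u => u `^ s) G x _ _ (is_derive1_powR s G0) dG).
split; last exact: (is_derive1_continuous (dpow (- q))).
have Gne : G x != 0 by rewrite gt_eqF.
rewrite /primitive_majorant; have [->|q1] := eqVneq q 1.
  apply: (is_derive1_eq (is_derive1Z (sg * nu) (is_derive1_ln_comp dG G0))).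
  rewrite -/(G x) powR_inv1 ?(ltW G0)//.
  have -> : sg * nu * ((0 + sg / nu * (1 - 0)) / G x) = sg ^+ 2 * (nu / nu) / G x by ring.
  by rewrite sg1 divff ?gt_eqF// !mul1r.
apply: (is_derive1_eq (is_derive1Z (sg * (nu / (1 - q))) (dpow (1 - q)))).
rewrite -/(G x) (_ : 1 - q - 1 = - q); last by ring.
have q1' : 1 - q != 0 by rewrite subr_eq0 eq_sym.
have -> : sg * (nu / (1 - q)) * ((1 - q) * G x `^ (- q) * (0 + sg / nu * (1 - 0))) =
   sg ^+ 2 * ((1 - q) / (1 - q)) * (nu / nu) * G x `^ (- q) by ring.
by rewrite sg1 (divff q1') divff ?gt_eqF// !mul1r.
Qed.

Lemma majorant_powE q sg z nu x : 0 < nu -> sg ^+ 2 = 1 -> 0 <= sg * (x - z) ->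
  majorant z nu x `^ q = (1 + sg / nu * (x - z)) `^ (- q).
Proof.
move=> nu0 sg1 xz.
have E : `|x - z| = sg * (x - z).
  rewrite -[RHS]ger0_norm// normrM (_ : `|sg| = 1) ?mul1r//.
  by apply/eqP; rewrite -sqrp_eq1// real_normK ?num_real// sg1.
have -> : majorant z nu x = (1 + sg / nu * (x - z))^-1.
  rewrite /majorant E; have p1 : 0 < nu + sg * (x - z) by rewrite ltr_pwDl.
  have e1 : 1 + sg / nu * (x - z) = (nu + sg * (x - z)) / nu by field; rewrite gt_eqF.
  by rewrite e1; field; rewrite !gt_eqF.
have p2 : 0 <= 1 + sg / nu * (x - z).
  rewrite addr_ge0// (_ : sg / nu * (x - z) = sg * (x - z) / nu); last by ring.
  by rewrite divr_ge0// ltW.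
by rewrite -powR_inv1// -powRrM mulN1r.
Qed.

Lemma majorant_gt0 z nu x : 0 < nu -> 0 < majorant z nu x.
Proof. by move=> nu0; rewrite divr_gt0// ltr_pwDl. Qed.

Lemma majorant_continuous z nu : 0 < nu -> continuous (majorant z nu).
Proof.
move=> nu0 x; apply: cvgM; first exact: cvg_cst.
apply: cvgV; first by rewrite gt_eqF// ltr_pwDl.
apply: cvgD; first exact: cvg_cst.
by apply: cvg_norm; apply: cvgB; [exact: cvg_id|exact: cvg_cst].
Qed.

Lemma measurable_majorant_pow (A : set R) z nu q : measurable A -> 0 < nu ->
  measurable_fun A (EFin \o (fun x => majorant z nu x `^ q)).
Proof.
move=> mA nu0; apply/measurable_EFinP.
apply: (measurableT_comp (measurable_powR q)).
apply: measurable_funTS; apply: continuous_measurable_fun.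
exact: majorant_continuous.
Qed.

(** Bounds the integral of the q-th power of the majorant over one side of [z], up to distance 1.
    Its power 1 / q is the origin of both rates. *)
Definition majorant_bound (q nu : R) : R :=
  if q == 1 then nu * ln (1 + nu^-1) else nu / (q - 1).

Lemma majorant_bound_ge0 q nu : 1 <= q -> 0 < nu -> 0 <= majorant_bound q nu.
Proof.
move=> q1 nu0; rewrite /majorant_bound; case: ifPn => _.
  by rewrite mulr_ge0 ?(ltW nu0)// ln_ge0// lerDl invr_ge0 ltW.
by rewrite divr_ge0 ?(ltW nu0)// subr_ge0.
Qed.

Lemma integral_majorant_side q sg z nu (a b : R) : 1 <= q -> 0 < nu -> sg ^+ 2 = 1 ->
  z - 1 <= a -> b <= z + 1 -> (forall x, a <= x <= b -> 0 <= sg * (x - z)) ->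
  (\int[mu]_(x in `[a, b]) (majorant z nu x `^ q)%:E <= (majorant_bound q nu)%:E)%E.
Proof.
move=> q1 nu0 sg1 za bz side.
have [ab|ba] := leP a b; last first.
  by rewrite set_itv_ge ?integral_set0 ?lee_fin ?majorant_bound_ge0// bnd_simp -ltNge.
have -> : (\int[mu]_(x in `[a, b]) (majorant z nu x `^ q)%:E =
    \int[mu]_(x in `[a, b]) ((1 + sg / nu * (x - z)) `^ (- q))%:E)%E.
  apply: eq_integral => x; rewrite inE/= in_itv/= => xI.
  by rewrite (majorant_powE q nu0 sg1)// side.
apply: (integral_antiderivative_le (F := primitive_majorant q sg z nu)).
- exact: majorant_bound_ge0.
- by move=> x xI; apply: primitive_majorantP => //; exact: side.
have sga := side a; rewrite lexx ab in sga; have {}sga := sga isT.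
have sgb := side b; rewrite lexx ab in sgb; have {}sgb := sgb isT.
have sgE : sg = 1 \/ sg = -1.
  by move/eqP: sg1; rewrite sqrf_eq1 => /orP[]/eqP->; [left|right].
have bnd (x : R) : 0 <= sg * (x - z) -> z - 1 <= x <= z + 1 ->
    1 <= 1 + sg / nu * (x - z) <= 1 + nu^-1.
  move=> h xI; have -> : sg / nu * (x - z) = sg * (x - z) / nu by ring.
  rewrite lerDl lerD2l divr_ge0 ?(ltW nu0)//= ler_pdivrMr// mulVf ?gt_eqF//.
  by case: sgE => ->; lra.
have /andP[a1 a2] := bnd a sga ltac:(lra).
have /andP[b1 b2] := bnd b sgb ltac:(lra).
rewrite /primitive_majorant /majorant_bound; have [_|q1'] := eqVneq q 1.
  have l0 (u : R) : 1 <= u -> u <= 1 + nu^-1 -> 0 <= nu * ln u <= nu * ln (1 + nu^-1).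
    move=> u1 u2; rewrite mulr_ge0 ?ln_ge0 ?(ltW nu0)//= ler_pM2l// ler_ln ?posrE//.
      exact: lt_le_trans ltr01 u1.
    exact: lt_le_trans ltr01 (le_trans u1 u2).
  have := l0 _ a1 a2; have := l0 _ b1 b2.
  by case: sgE => ->; rewrite ?mul1r ?mulN1r ?mulNr; lra.
have q1s : 0 < q - 1 by rewrite subr_gt0 lt_neqAle eq_sym q1' q1.
have c0 : 0 < nu / (q - 1) by rewrite divr_gt0.
have -> : nu / (1 - q) = - (nu / (q - 1)) by rewrite -(opprB q 1) invrN mulrN.
have l0 (u : R) : 1 <= u -> 0 <= nu / (q - 1) * u `^ (1 - q) <= nu / (q - 1).
  move=> u1; rewrite mulr_ge0 ?(ltW c0) ?powR_ge0//= ler_piMr ?(ltW c0)//.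
  rewrite -(opprB q 1) powRN invf_le1 ?powR_gt0 ?(lt_le_trans ltr01)//.
  by have := @ler_powR _ u u1 0 (q - 1) (ltW q1s); rewrite powRr0.
have := l0 _ a1; have := l0 _ b1.
by case: sgE => ->; rewrite ?mul1r ?mulN1r ?opprK ?mulNr; lra.
Qed.

Lemma integral_majorant q z nu : 1 <= q -> 0 < nu -> 0 <= z <= 1 ->
  (\int[mu]_(x in `]0%R, 1%R[) (majorant z nu x `^ q)%:E <= (2 * majorant_bound q nu)%:E)%E.
Proof.
move=> q1 nu0 /andP[z0 z1].
have pos (x : R) : (0 <= (majorant z nu x `^ q)%:E)%E by rewrite lee_fin powR_ge0.
apply: (@le_trans _ _ (\int[mu]_(x in `[0%R, z] `|` `]z, 1%R]) (majorant z nu x `^ q)%:E)%E).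
  apply: ge0_subset_integral => //; first exact: measurableU.
    by apply: measurable_majorant_pow => //; exact: measurableU.
  move=> x /=; rewrite !in_itv/= => /andP[x0 x1].
  by have [xz|zx] := leP x z; [left|right]; rewrite ltW.
rewrite ge0_integral_setU//; last 2 first.
  by apply: measurable_majorant_pow => //; exact: measurableU.
  rewrite disj_set2E; apply/eqP/seteqP; split => x //=.
  by rewrite !in_itv/= => -[/andP[_ xz] /andP[zx _]]; move: xz; rewrite leNgt zx.
rewrite mulr_natl mulr2n EFinD; apply: leeD.
  apply: (integral_majorant_side (sg := -1)) => //; try lra.
  by move=> x xI; lra.
apply: le_trans (_ : (\int[mu]_(x in `[z, 1%R]) (majorant z nu x `^ q)%:E <= _)%E).
  apply: ge0_subset_integral => //; first exact: measurable_majorant_pow.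
  by apply: subset_itv; rewrite bnd_simp.
apply: (integral_majorant_side (sg := 1)) => //; try lra.
by move=> x xI; lra.
Qed.

Lemma norm_upper_bound q nu z1 z2 K f g : 1 <= q -> 0 < nu -> 0 < K ->
  0 <= z1 <= 1 -> 0 <= z2 <= 1 -> measurable_fun `](0 : R), 1[ (fun x => f x - g x) ->
  (forall x : R, 0 < x < 1 -> `|f x - g x| <= K * majorant z1 nu x \/
                              `|f x - g x| <= K * majorant z2 nu x) ->
  (Lq_dist01 q f g <= (K * (4 * majorant_bound q nu) `^ q^-1)%:E)%E.
Proof.
move=> q1 nu0 K0 z1I z2I mE bnd; have q0 : 0 < q by exact: lt_le_trans q1.
have qn0 : q != 0 by rewrite gt_eqF.
rewrite Lq_dist01E//.
have mb0 : 0 <= 4 * majorant_bound q nu by rewrite mulr_ge0// majorant_bound_ge0.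
have mEq : measurable_fun `](0 : R), 1[ (EFin \o (fun x => `|f x - g x| `^ q)).
  apply/measurable_EFinP.
  apply: (measurableT_comp (measurable_powR q)).
  exact: measurableT_comp mE.
have I1 : (\int[mu]_(x in `]0%R, 1%R[) (`|f x - g x| `^ q)%:E <=
    (K `^ q * (4 * majorant_bound q nu))%:E)%E.
  pose h z (x : R) := (majorant z nu x `^ q)%:E.
  (* The pointwise alternative between two centres is replaced by the sum of both powers, which is
     integrable term by term. *)
  apply: (@le_trans _ _ (\int[mu]_(x in `]0%R, 1%R[) ((K `^ q)%:E * (h z1 x + h z2 x)))%E).
    apply: ge0_le_integral => //.
    - apply: emeasurable_funM => //; apply: emeasurable_funD; exact: measurable_majorant_pow.
    - move=> x /=; rewrite in_itv/= => xI; rewrite /h -EFinD -EFinM lee_fin mulrDr.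
      have M z : 0 <= majorant z nu x by rewrite ltW// majorant_gt0.
      have P0 z : 0 <= K `^ q * majorant z nu x `^ q by rewrite mulr_ge0 ?powR_ge0.
      have one z : `|f x - g x| <= K * majorant z nu x ->
          `|f x - g x| `^ q <= K `^ q * majorant z nu x `^ q.
        move=> le; rewrite -powRM ?(ltW K0)//; apply: (ge0_ler_powR (ltW q0)) => //.
        by rewrite nnegrE mulr_ge0// ltW.
      have := P0 z1; have := P0 z2.
      by case: (bnd x xI) => /one; lra.
  rewrite ge0_integralZl_EFin ?powR_ge0//; last 2 first.
  - by move=> x _; rewrite adde_ge0// lee_fin powR_ge0.
  - by apply: emeasurable_funD; exact: measurable_majorant_pow.
  rewrite EFinM; apply: lee_wpmul2l; first by rewrite lee_fin powR_ge0.
  rewrite ge0_integralD//; last 4 first.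
  - by move=> x _; rewrite lee_fin powR_ge0.
  - exact: measurable_majorant_pow.
  - by move=> x _; rewrite lee_fin powR_ge0.
  - exact: measurable_majorant_pow.
  have -> : 4 * majorant_bound q nu = 2 * majorant_bound q nu + 2 * majorant_bound q nu by ring.
  by rewrite EFinD; apply: leeD; exact: integral_majorant.
apply: (@le_trans _ _ ((K `^ q * (4 * majorant_bound q nu))%:E `^ q^-1)%E).
  apply: gt0_ler_poweR => //; first by rewrite invr_ge0 ltW.
  - rewrite in_itv/= leey andbT; apply: integral_ge0 => x _.
    by rewrite lee_fin powR_ge0.
  - by rewrite in_itv/= leey andbT lee_fin mulr_ge0// powR_ge0.
rewrite poweR_EFin lee_fin powRM ?powR_ge0// -powRrM mulfV// powRr1//.
exact: ltW.
Qed.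

Lemma norm_lower_bound q (a b c : R) f g : 1 <= q -> 0 <= a -> a < b -> b <= 1 -> 0 < c ->
  measurable_fun `](0 : R), 1[ (fun x => f x - g x) ->
  (forall x : R, a < x < b -> c <= `|f x - g x|) ->
  ((c * (b - a) `^ q^-1)%:E <= Lq_dist01 q f g)%E.
Proof.
move=> q1 a0 ab b1 c0 mE bnd; have q0 : 0 < q by exact: lt_le_trans q1.
have qn0 : q != 0 by rewrite gt_eqF.
rewrite Lq_dist01E//.
have mEq : measurable_fun `](0 : R), 1[ (EFin \o (fun x => `|f x - g x| `^ q)).
  apply/measurable_EFinP.
  apply: (measurableT_comp (measurable_powR q)).
  exact: measurableT_comp mE.
have sub : `]a, b[%classic `<=` `]0%R, 1%R[%classic.
  by apply: subset_itv; rewrite bnd_simp.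
have I1 : ((c `^ q * (b - a))%:E <= \int[mu]_(x in `]0%R, 1%R[) (`|f x - g x| `^ q)%:E)%E.
  apply: (@le_trans _ _ (\int[mu]_(x in `]a, b[) (`|f x - g x| `^ q)%:E)%E); last first.
    by apply: ge0_subset_integral => // x _; rewrite lee_fin powR_ge0.
  have -> : ((c `^ q * (b - a))%:E = \int[mu]_(x in `]a, b[) (cst (c `^ q)%:E x))%E.
    by rewrite integral_cst//= lebesgue_measure_itv/= lte_fin ab -EFinD EFinM.
  apply: ge0_le_integral => //.
  - by move=> x _; rewrite lee_fin powR_ge0.
  - exact: measurable_funS mEq.
  - move=> x /=; rewrite in_itv/= => xI; rewrite lee_fin.
    apply: (ge0_ler_powR (ltW q0)); rewrite ?nnegrE ?(ltW c0)//.
    exact: bnd.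
apply: (@le_trans _ _ ((c `^ q * (b - a))%:E `^ q^-1)%E); last first.
  apply: gt0_ler_poweR => //; first by rewrite invr_ge0 ltW.
  - by rewrite in_itv/= leey andbT lee_fin mulr_ge0 ?powR_ge0// subr_ge0 ltW.
  - rewrite in_itv/= leey andbT; apply: integral_ge0 => x _.
    by rewrite lee_fin powR_ge0.
rewrite poweR_EFin lee_fin powRM ?powR_ge0 ?subr_ge0 ?(ltW ab)// -powRrM mulfV// powRr1//.
exact: ltW.
Qed.

Lemma norm1_majorant_lower_bound (e c nu z : R) f g : 0 < e <= 1 -> 0 < c -> 0 < nu ->
  z = 0 \/ z = 1 -> measurable_fun `](0 : R), 1[ (fun x => f x - g x) ->
  (forall x : R, 0 < x < 1 -> `|x - z| <= e -> c * majorant z nu x <= `|f x - g x|) ->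
  ((c * (nu * ln (1 + e / nu)))%:E <= Lq_dist01 1 f g)%E.
Proof.
move=> /andP[e0 e1] c0 nu0 zE mE bnd.
rewrite Lq_dist01E ?oner_neq0// invr1 poweRe1; last first.
  by apply: integral_ge0 => x _; rewrite lee_fin powR_ge0.
have mEq : measurable_fun `](0 : R), 1[ (EFin \o (fun x => `|f x - g x| `^ 1)).
  apply/measurable_EFinP.
  apply: (measurableT_comp (measurable_powR 1)).
  exact: measurableT_comp mE.
have [sg [a [b [sg1 ab a0 [b1 side] [near ptE]]]]] : exists sg a b : R, [/\ sg ^+ 2 = 1, a < b, 0 <= a,
   b <= 1 /\ (forall x, a <= x <= b -> 0 <= sg * (x - z)) &
   (forall x, a <= x <= b -> `|x - z| <= e) /\
   primitive_majorant 1 sg z nu b - primitive_majorant 1 sg z nu a = nu * ln (1 + e / nu)].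
  case: zE => ->.
    exists 1, 0, e; split=> //; first by rewrite expr1n.
    - by split=> // x /andP[x0 _]; rewrite subr0 mul1r.
    - split; first by move=> x /andP[x0 xe]; rewrite subr0 ger0_norm.
      rewrite /primitive_majorant eqxx !subr0 mulr0 addr0 ln1 mulr0 subr0 !mul1r.
      by rewrite mulrC [nu^-1 * _]mulrC mulrC.
  exists (-1), (1 - e), 1; split=> //.
  - by rewrite sqrrN expr1n.
  - by rewrite ltrBlDr ltrDl.
  - by rewrite subr_ge0.
  - by split=> // x /andP[_ x1]; rewrite mulN1r opprB subr_ge0.
  - split; first by move=> x /andP[x0 x1]; rewrite ler0_norm ?subr_le0//; lra.
    rewrite /primitive_majorant eqxx subrr mulr0 addr0 ln1 mulr0 sub0r.
    have -> : -1 / nu * (1 - e - 1) = e / nu by ring.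
    by ring.
have I0 : (\int[mu]_(x in `[a, b]) (majorant z nu x `^ 1)%:E = (nu * ln (1 + e / nu))%:E)%E.
  have -> : (\int[mu]_(x in `[a, b]) (majorant z nu x `^ 1)%:E =
      \int[mu]_(x in `[a, b]) ((1 + sg / nu * (x - z)) `^ (- 1))%:E)%E.
    apply: eq_integral => x; rewrite inE/= in_itv/= => xI.
    by rewrite (majorant_powE 1 nu0 sg1)// side.
  rewrite (@integral_antiderivativeE _ (primitive_majorant 1 sg z nu) a b ab) ?ptE//.
  by move=> x xI; apply: primitive_majorantP => //; exact: side.
rewrite EFinM -I0 (@integral_itv_bndoo _ a b _ true false); last first.
  exact: measurable_majorant_pow.
rewrite -ge0_integralZl_EFin ?(ltW c0)//; last 2 first.
- by move=> x _; rewrite lee_fin powR_ge0.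
- exact: measurable_majorant_pow.
have sub : `]a, b[%classic `<=` `]0%R, 1%R[%classic.
  by apply: subset_itv; rewrite bnd_simp.
apply: (@le_trans _ _ (\int[mu]_(x in `]a, b[) (`|f x - g x| `^ 1)%:E)%E); last first.
  by apply: ge0_subset_integral => // x _; rewrite lee_fin powR_ge0.
apply: ge0_le_integral => //.
- by move=> x _; rewrite -EFinM lee_fin mulr_ge0 ?powR_ge0// ltW.
- by apply: emeasurable_funM => //; exact: measurable_majorant_pow.
- exact: measurable_funS mEq.
- move=> x xab; have xI := sub x xab.
  rewrite /= in_itv/= in xI; rewrite /= in_itv/= in xab.
  rewrite -EFinM lee_fin !powRr1 ?(ltW (majorant_gt0 _ _ _))//.
  apply: bnd => //; apply: near; case/andP: xab => ? ?; by rewrite !ltW.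
Qed.

End Integrals.

(** * From pointwise error profiles to convergence rates *)

Section Rates.
Context {R : realType}.
Implicit Types (f : R -> R -> R) (g : R -> R).

(** Two centres are allowed because a double layer produces errors at both ends; a shock uses its
    location twice. *)
Definition upper_profile (f : R -> R -> R) (g : R -> R) : Prop :=
  exists K z1 z2 : R, [/\ 0 < K, 0 <= z1 <= 1, 0 <= z2 <= 1 &
    forall nu x, 0 < nu <= 1 -> 0 < x < 1 ->
      `|f nu x - g x| <= K * majorant z1 nu x \/ `|f nu x - g x| <= K * majorant z2 nu x].

(** The interval may move with [nu]: at a shock, the side on which the viscous density is far from
    the step depends on [nu]. *)
Definition lower_profile (f : R -> R -> R) (g : R -> R) : Prop :=
  exists2 c : R, 0 < c & forall nu, 0 < nu <= 1 -> exists a : R,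
    [/\ 0 <= a, a + c * nu <= 1 &
        forall x, 0 < x < 1 -> a < x < a + c * nu -> c <= `|f nu x - g x|].

(** The variant needed in L^1: an error of fixed size over a length of order nu would yield only the
    order nu, and the logarithm comes from the whole tail of the majorant. *)
Definition lower_profile1 (f : R -> R -> R) (g : R -> R) : Prop :=
  exists c e nu1 z : R, [/\ 0 < c, 0 < e <= 1, 0 < nu1 <= 1, z = 0 \/ z = 1 &
    forall nu x, 0 < nu < nu1 -> 0 < x < 1 -> `|x - z| <= e ->
      c * majorant z nu x <= `|f nu x - g x|].

Definition measurable_error (f : R -> R -> R) (g : R -> R) : Prop :=
  forall nu, 0 < nu -> measurable_fun `](0 : R), 1[ (fun x => f nu x - g x).

Lemma upper_profile_rate f g q : measurable_error f g -> upper_profile f g -> 1 < q ->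
  upper_rate (fun nu => Lq_dist01 q (f nu) g) (fun nu => nu `^ q^-1).
Proof.
move=> mf [K [z1 [z2 [K0 z1I z2I bnd]]]] q1.
have q10 : 0 < q - 1 by rewrite subr_gt0.
exists (K * (4 / (q - 1)) `^ q^-1); first by rewrite mulr_gt0// powR_gt0// divr_gt0.
near=> nu.
have nu0 : 0 < nu by near: nu; exact: nbhs_right_gt.
have nu1 : nu < 1 by near: nu; exact: nbhs_right_lt.
have bnd' (x : R) : 0 < x < 1 -> `|f nu x - g x| <= K * majorant z1 nu x \/
    `|f nu x - g x| <= K * majorant z2 nu x.
  by apply: bnd; rewrite nu0 ltW.
apply: le_trans (norm_upper_bound (ltW q1) nu0 K0 z1I z2I (mf nu nu0) bnd') _.
rewrite lee_fin /majorant_bound gt_eqF// -mulrA ler_pM2l//.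
rewrite (_ : 4 * (nu / (q - 1)) = (4 / (q - 1)) * nu); last by ring.
by rewrite powRM// ?(ltW nu0)// divr_ge0// ltW.
Unshelve. all: by end_near. Qed.

Lemma upper_profile_rate1 f g : measurable_error f g -> upper_profile f g ->
  upper_rate (fun nu => Lq_dist01 1 (f nu) g) (fun nu => nu * `|ln nu|).
Proof.
move=> mf [K [z1 [z2 [K0 z1I z2I bnd]]]].
exists (K * 8); first by rewrite mulr_gt0.
near=> nu.
have nu0 : 0 < nu by near: nu; exact: nbhs_right_gt.
have nu1 : nu < 2^-1 by near: nu; apply: nbhs_right_lt; rewrite invr_gt0.
have bnd' (x : R) : 0 < x < 1 -> `|f nu x - g x| <= K * majorant z1 nu x \/
    `|f nu x - g x| <= K * majorant z2 nu x.
  by apply: bnd; lra.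
apply: le_trans (norm_upper_bound (lexx 1) nu0 K0 z1I z2I (mf nu nu0) bnd') _.
rewrite lee_fin /majorant_bound eqxx invr1.
have t2 : 2 < nu^-1 by rewrite -[2]invrK ltf_pV2 ?posrE ?invr_gt0.
have tp : 0 < nu^-1 by rewrite invr_gt0.
have lnu : ln nu <= 0 by apply: ln_le0; lra.
(* For nu < 1/2 one has 1 + nu^-1 <= nu^-2. *)
have ln1 : ln (1 + nu^-1) <= 2 * - ln nu.
  have -> : 2 * - ln nu = ln (nu^-1 * nu^-1).
    by rewrite lnM ?posrE// lnV ?posrE//; ring.
  have p1 : 0 < 1 + nu^-1 by lra.
  rewrite ler_ln ?posrE ?mulr_gt0//.
  have : nu^-1 * 2 <= nu^-1 * nu^-1 by rewrite ler_pM2l// ltW.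
  by lra.
have ln0 : 0 <= ln (1 + nu^-1) by rewrite ln_ge0// lerDl ltW.
rewrite powRr1; last by rewrite !mulr_ge0// ltW.
rewrite ler0_norm// -mulrA ler_pM2l//.
have : nu * ln (1 + nu^-1) <= nu * (2 * - ln nu) by rewrite ler_pM2l.
by lra.
Unshelve. all: by end_near. Qed.

Lemma lower_profile_rate f g q : measurable_error f g -> lower_profile f g -> 1 < q ->
  lower_rate (fun nu => Lq_dist01 q (f nu) g) (fun nu => nu `^ q^-1).
Proof.
move=> mf [c c0 bnd] q1.
exists (c * c `^ q^-1); first by rewrite mulr_gt0// powR_gt0.
near=> nu.
have nu0 : 0 < nu by near: nu; exact: nbhs_right_gt.
have nu1 : nu < 1 by near: nu; exact: nbhs_right_lt.
have [a [a0 a1 H]] := bnd nu ltac:(by rewrite nu0 ltW).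
have cn0 : 0 < c * nu by rewrite mulr_gt0.
have H' (x : R) : a < x < a + c * nu -> c <= `|f nu x - g x|.
  by move=> xI; apply: H => //; lra.
have := norm_lower_bound (ltW q1) a0 (_ : a < a + c * nu) a1 c0 (mf nu nu0) H'.
rewrite ltrDl cn0 => /(_ isT); apply: le_trans.
rewrite lee_fin (addrC a) addrK powRM ?(ltW c0) ?(ltW nu0)//.
by rewrite mulrA.
Unshelve. all: by end_near. Qed.

Lemma lower_profile1_rate f g : measurable_error f g -> lower_profile1 f g ->
  lower_rate (fun nu => Lq_dist01 1 (f nu) g) (fun nu => nu * `|ln nu|).
Proof.
move=> mf [c [e [nu1 [z [c0 /andP[e0 e1] /andP[nu10 nu11] zE bnd]]]]].
exists (c / 2); first by rewrite divr_gt0.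
near=> nu.
have nu0 : 0 < nu by near: nu; exact: nbhs_right_gt.
have nuu : nu < nu1 by near: nu; exact: nbhs_right_lt.
have nue : nu < e * e by near: nu; apply: nbhs_right_lt; rewrite mulr_gt0.
have H (x : R) : 0 < x < 1 -> `|x - z| <= e -> c * majorant z nu x <= `|f nu x - g x|.
  by apply: bnd; rewrite nu0.
have eI : 0 < e <= 1 by rewrite e0.
apply: le_trans (norm1_majorant_lower_bound eI c0 nu0 zE (mf nu nu0) H).
have lnu : ln nu <= 0 by apply: ln_le0; lra.
have p1 : 0 < e / nu by rewrite divr_gt0.
(* The choice nu < e^2 gives nu^-1 <= (e / nu)^2. *)
have key : - ln nu <= 2 * ln (1 + e / nu).
  rewrite -lnV ?posrE//.
  have -> : 2 * ln (1 + e / nu) = ln ((1 + e / nu) * (1 + e / nu)).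
    by rewrite lnM ?posrE ?addr_gt0//; ring.
  rewrite ler_ln ?posrE ?invr_gt0 ?mulr_gt0 ?addr_gt0//.
  apply: le_trans (_ : e / nu * (e / nu) <= _); last by apply: ler_pM; lra.
  have -> : e / nu * (e / nu) = (e * e / nu) * nu^-1 by ring.
  rewrite -[leLHS]mul1r ler_pM2r ?invr_gt0//.
  by rewrite ler_pdivlMr// mul1r ltW.
rewrite lee_fin ler0_norm//.
have -> : c / 2 * (nu * - ln nu) = c * (nu * (2^-1 * - ln nu)) by ring.
rewrite ler_pM2l// ler_pM2l//; lra.
Unshelve. all: by end_near. Qed.

(** Carries estimates from densities to velocities, since r -> m / r is bi-Lipschitz on a compact
    range of densities ([quotient_compare]). *)
Lemma profile_transfer f g (f' : R -> R -> R) (g' : R -> R) (k K : R) : 0 < k -> 0 < K ->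
  (forall nu x, 0 < nu <= 1 -> 0 < x < 1 ->
     k * `|f nu x - g x| <= `|f' nu x - g' x| <= K * `|f nu x - g x|) ->
  [/\ upper_profile f g -> upper_profile f' g',
      lower_profile f g -> lower_profile f' g' &
      lower_profile1 f g -> lower_profile1 f' g'].
Proof.
move=> k0 K0 H; split.
- move=> [C [z1 [z2 [C0 z1I z2I bnd]]]]; exists (K * C), z1, z2; split=> //.
    by rewrite mulr_gt0.
  move=> nu x nuI xI; have /andP[_ h] := H nu x nuI xI.
  by case: (bnd nu x nuI xI) => h'; [left|right]; apply: le_trans h _;
    rewrite -mulrA ler_pM2l.
- move=> [c c0 bnd]; exists (Num.min c (k * c)); first by rewrite lt_min c0 mulr_gt0.
  set c' := Num.min _ _; have c'c : c' <= c by rewrite ge_min lexx.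
  move=> nu nuI; have [a [a0 a1 ax]] := bnd nu nuI; exists a.
  have /andP[nu0 _] := nuI; have le : c' * nu <= c * nu by rewrite ler_pM2r.
  split=> //; first by lra.
  move=> x xI xa; have /andP[h _] := H nu x nuI xI; apply: le_trans h.
  apply: le_trans (_ : k * c <= _); first by rewrite ge_min lexx orbT.
  by rewrite ler_pM2l//; apply: ax => //; lra.
- move=> [c [e [nu1 [z [c0 eI nu1I zE bnd]]]]]; exists (k * c), e, nu1, z; split=> //.
    by rewrite mulr_gt0.
  move=> nu x nuI xI xz; have nuI' : 0 < nu <= 1 by lra.
  have /andP[h _] := H nu x nuI' xI; apply: le_trans h.
  by rewrite -mulrA ler_pM2l//; exact: bnd.
Qed.

Lemma quotient_compare (m lo hi a b : R) : 0 < m -> 0 < lo -> lo <= a <= hi -> lo <= b <= hi ->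
  m / hi ^+ 2 * `|a - b| <= `|m / a - m / b| <= m / lo ^+ 2 * `|a - b|.
Proof.
move=> m0 lo0 /andP[la ah] /andP[lb bh].
have a0 := lt_le_trans lo0 la; have b0 := lt_le_trans lo0 lb.
have hi0 := lt_le_trans a0 ah.
have -> : m / a - m / b = (m / (a * b)) * (b - a) by field; rewrite !gt_eqF.
have p0 : 0 < m / (a * b) by apply: divr_gt0 => //; exact: mulr_gt0.
rewrite normrM (gtr0_norm p0) (distrC b) !expr2.
apply/andP; split; apply: ler_wpM2r => //; rewrite ler_pM2l// lef_pV2 ?posrE ?mulr_gt0//.
  by apply: ler_pM => //; exact: ltW.
by apply: ler_pM => //; exact: ltW.
Qed.

Lemma measurable_step (x0 A B : R) :
  measurable_fun `](0 : R), 1[ (fun x : R => if x < x0 then A else B).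
Proof.
apply: measurable_funTS; apply: measurable_fun_ifT => //.
exact: measurable_fun_ltr.
Qed.

Lemma measurable_error_step f (x0 A B : R) :
  (forall nu, 0 < nu -> forall x, {for x, continuous (f nu)}) ->
  measurable_error f (fun x => if x < x0 then A else B).
Proof.
move=> cf nu nu0; apply: measurable_funB; last exact: measurable_step.
by apply: measurable_funTS; apply: continuous_measurable_fun => x; exact: cf.
Qed.

(** At the left end, or at the right one if lo = a, the boundary value differs from [a], and the
    speed bound keeps [y] away from [a] over a length of order nu. *)
Lemma crossing_lower_layer g th (lo hi a gm gM tM : R) : lo < hi -> lo <= a <= hi -> 0 < gm ->
  (forall r, lo <= r <= hi -> gm <= g r <= gM /\ 0 <= th r <= tM) ->
  exists2 c : R, 0 < c & forall nu d y, 0 < nu <= 1 -> crossing g th lo hi nu d y ->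
    exists b : R, [/\ 0 <= b, b + c * nu <= 1 &
      forall x, 0 < x < 1 -> b < x < b + c * nu -> c <= `|y x - a|].
Proof.
move=> lohi aI gm0 gth.
have [/andP[g1 g2] /andP[t1 t2]] := gth lo ltac:(by rewrite lexx ltW).
pose C := gM * ((hi - lo) / gm + tM).
have C0 : 0 < C.
  rewrite mulr_gt0 ?(lt_le_trans gm0 (le_trans g1 g2))//.
  by rewrite ltr_pwDl ?divr_gt0 ?subr_gt0// (le_trans t1).
have [la|al] := ltP lo a.
  pose eta := (a - lo) / 2; have eta0 : 0 < eta by rewrite /eta; lra.
  pose c := Num.min 1 (Num.min eta (eta / C)).
  have c1 : c <= 1 by rewrite ge_min lexx.
  have c2 : c <= eta by rewrite !ge_min lexx orbT.
  have c3 : c <= eta / C by rewrite !ge_min lexx !orbT.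
  have c0 : 0 < c by rewrite !lt_min ltr01 eta0 divr_gt0.
  exists c => // nu d y nuI cr; have [_ [y0 y1] _ _ _] := cr; have /andP[nu0 nu1] := nuI.
  have cn : c * nu <= c by rewrite ler_piMr// ltW.
  exists 0; rewrite add0r; split=> //; first by lra.
  move=> x xI /andP[x0 xc]; apply: le_trans c2 _.
  have lip := @crossing_speed _ _ _ _ _ _ _ _ _ _ _ cr nuI gm0 gth x 0 ltac:(lra) ltac:(lra).
  apply: (lipschitz_gap C0 nu0 lip).
    by rewrite y0 ltr0_norm ?subr_lt0// /eta; lra.
  rewrite subr0 gtr0_norm//; apply: le_trans (ltW xc) _.
  by rewrite ler_pM2r.
have ah : a < hi by apply: le_lt_trans lohi.
pose eta := (hi - a) / 2; have eta0 : 0 < eta by rewrite /eta; lra.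
pose c := Num.min 1 (Num.min eta (eta / C)).
have c1 : c <= 1 by rewrite ge_min lexx.
have c2 : c <= eta by rewrite !ge_min lexx orbT.
have c3 : c <= eta / C by rewrite !ge_min lexx !orbT.
have c0 : 0 < c by rewrite !lt_min ltr01 eta0 divr_gt0.
exists c => // nu d y nuI cr; have [_ [y0 y1] _ _ _] := cr; have /andP[nu0 nu1] := nuI.
have cn : c * nu <= c by rewrite ler_piMr// ltW.
exists (1 - c * nu); rewrite subrK subr_ge0; split=> //; first by lra.
move=> x xI /andP[x0 xc]; apply: le_trans c2 _.
have lip := @crossing_speed _ _ _ _ _ _ _ _ _ _ _ cr nuI gm0 gth x 1 ltac:(lra) ltac:(lra).
apply: (lipschitz_gap C0 nu0 lip).
  by rewrite y1 gtr0_norm ?subr_gt0// /eta; lra.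
rewrite ltr0_norm ?subr_lt0// opprB; apply: le_trans (_ : c * nu <= _); first by lra.
by rewrite ler_pM2r.
Qed.

(** Whatever y x0 is, it differs from one of the two one-sided values of the step by at least half
    the jump; the error persists on that side of [x0]. *)
Lemma crossing_lower_shock g th (lo hi x0 gm gM tM : R) : lo < hi -> 0 < x0 < 1 -> 0 < gm ->
  (forall r, lo <= r <= hi -> gm <= g r <= gM /\ 0 <= th r <= tM) ->
  exists2 c : R, 0 < c & forall nu d y, 0 < nu <= 1 -> crossing g th lo hi nu d y ->
    exists b : R, [/\ 0 <= b, b + c * nu <= 1 &
      forall x, 0 < x < 1 -> b < x < b + c * nu -> c <= `|y x - if x < x0 then lo else hi|].
Proof.
move=> lohi /andP[x00 x01] gm0 gth.
have [/andP[g1 g2] /andP[t1 t2]] := gth lo ltac:(by rewrite lexx ltW).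
pose C := gM * ((hi - lo) / gm + tM).
have C0 : 0 < C.
  rewrite mulr_gt0 ?(lt_le_trans gm0 (le_trans g1 g2))//.
  by rewrite ltr_pwDl ?divr_gt0 ?subr_gt0// (le_trans t1).
pose eta := (hi - lo) / 4; have eta0 : 0 < eta by rewrite /eta; lra.
pose c := Num.min (Num.min x0 (1 - x0)) (Num.min eta (eta / C)).
have c1 : c <= x0 by rewrite !ge_min lexx.
have c1' : c <= 1 - x0 by rewrite !ge_min lexx orbT.
have c2 : c <= eta by rewrite !ge_min lexx !orbT.
have c3 : c <= eta / C by rewrite !ge_min lexx !orbT.
have c0 : 0 < c by rewrite !lt_min x00 subr_gt0 x01 eta0 divr_gt0.
exists c => // nu d y nuI cr; have /andP[nu0 nu1] := nuI.
have cnu : c * nu <= c by rewrite ler_piMr// ltW.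
have lip x : 0 < x < 1 -> `|y x - y x0| <= C / nu * `|x - x0|.
  by move=> xI; apply: (crossing_speed cr nuI gm0 gth); lra.
have c3n : c * nu <= eta / C * nu by rewrite ler_pM2r.
have [ym|my] := leP (y x0) ((lo + hi) / 2).
  exists x0; split; [by lra|by lra|].
  move=> x xI /andP[xl xr]; rewrite ltNge (ltW xl)/=; apply: le_trans c2 _.
  apply: (lipschitz_gap C0 nu0 (lip x xI)).
    by rewrite ler0_norm /eta; lra.
  by rewrite gtr0_norm ?subr_gt0//; lra.
exists (x0 - c * nu); split; [by lra|by lra|].
move=> x xI /andP[xl xr]; have xx0 : x < x0 by lra.
rewrite xx0; apply: le_trans c2 _.
apply: (lipschitz_gap C0 nu0 (lip x xI)).
  by rewrite ger0_norm /eta; lra.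
by rewrite ltr0_norm ?subr_lt0//; lra.
Qed.

End Rates.

(** * Families of crossings indexed by the viscosity *)

Section CrossingFamilies.
Context {R : realType}.
Implicit Types (g th : R -> R).

Lemma crossing_family g th (A lo a hi B L : R) :
  A < lo -> lo < hi -> hi < B -> lo <= a <= hi -> 0 < L ->
  (forall r, lo <= r <= hi -> {for r, continuous g} /\ {for r, continuous th}) ->
  (forall r, lo <= r <= hi -> 0 < g r) ->
  (forall r, lo <= r <= hi -> 0 <= th r <= L * `|r - a|) ->
  exists (d : R -> R) (y : R -> R -> R), forall nu, 0 < nu ->
    crossing g th lo hi nu (d nu) (y nu) /\ forall x, A < y nu x < B.
Proof.
move=> Alo lohi hiB aI L0 cgth g0 thL.
have : forall nu, exists dy : R * (R -> R), 0 < nu ->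
    crossing g th lo hi nu dy.1 dy.2 /\ forall x, A < dy.2 x < B.
  move=> nu; have [nu0|_] := ltP 0 nu; last by exists (0, fun=> 0).
  have [d [y [d0 yE yi yAB dy]]] := increasing_two_point_solution Alo lohi hiB aI nu0 L0 cgth g0 thL.
  exists (d, y) => _; split; last by move=> x; have [] := yAB x.
  by split=> // x; have [] := yAB x.
move=> /choice[dy H]; exists (fun nu => (dy nu).1), (fun nu => (dy nu).2) => nu nu0.
exact: H.
Qed.

Lemma layer_profiles g th (lo hi a gm gM tM k : R) (d : R -> R) (y : R -> R -> R) :
  lo < hi -> lo <= a <= hi -> 0 < gm -> 0 < k ->
  (forall r, lo <= r <= hi -> gm <= g r <= gM /\ 0 <= th r <= tM) ->
  (forall r, lo <= r <= hi -> k * (r - a) ^+ 2 <= th r) ->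
  (forall nu, 0 < nu -> crossing g th lo hi nu (d nu) (y nu)) ->
  [/\ upper_profile y (fun=> a), lower_profile y (fun=> a) &
    forall C, 0 < C -> (forall r, lo <= r <= hi -> th r <= C * (r - a) ^+ 2) ->
      lower_profile1 y (fun=> a)].
Proof.
move=> lohi aI gm0 k0 gth quad cr; have gk0 : 0 < gm * k by rewrite mulr_gt0.
have gk r : lo <= r <= hi -> 0 < g r /\ gm * k * (r - a) ^+ 2 <= g r * th r.
  move=> rI; have [/andP[g1 _] _] := gth r rI; split; first exact: lt_le_trans g1.
  rewrite -mulrA; apply: ler_pM => //; [exact: ltW|by rewrite mulr_ge0 ?sqr_ge0// ltW|].
  exact: quad.
split.
- exists (Num.max (hi - lo) (gm * k)^-1), 0, 1; split; rewrite ?lexx ?ler01//.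
    by rewrite lt_max subr_gt0 lohi.
  move=> nu x /andP[nu0 _] /andP[x0 x1].
  by apply: (crossing_layer_upper (cr nu nu0) nu0 gk0 aI gk); rewrite !ltW.
- have [c c0 H] := crossing_lower_layer lohi aI gm0 gth.
  exists c => // nu nuI; apply: (H nu (d nu) (y nu) nuI); apply: cr.
  by case/andP: nuI.
- move=> C C0 thC; pose kap := gm * Num.min 1 k.
  have kap0 : 0 < kap by rewrite mulr_gt0// lt_min ltr01.
  pose Cd := (pi / kap) ^+ 2; have Cd0 : 0 < Cd by rewrite exprn_gt0// divr_gt0// pi_gt0.
  have dle nu : 0 < nu -> d nu <= Cd * nu ^+ 2.
    move=> nu0; apply: (crossing_parameter_quadratic (cr nu nu0) nu0 kap0 (a := a)) => r rI.
    have [d0 _ _ _ _] := cr nu nu0; have [/andP[g1 _] /andP[t0 _]] := gth r rI.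
    rewrite -mulrA; apply: ler_pM => //; first exact: ltW.
      by rewrite mulr_ge0 ?addr_ge0 ?sqr_ge0 ?(ltW d0)// le_min ler01 ltW.
    rewrite mulrDr; apply: lerD.
      by rewrite ler_piMl ?(ltW d0)// ge_min lexx.
    apply: le_trans (quad r rI); apply: ler_wpM2r; first exact: sqr_ge0.
    by rewrite ge_min lexx orbT.
  have gM0 : 0 < gM.
    have [/andP[g1 g2] _] := gth lo ltac:(by rewrite lexx ltW).
    exact: lt_le_trans gm0 (le_trans g1 g2).
  have bnd r : lo <= r <= hi -> 0 <= g r <= gM /\ 0 <= th r <= C * (r - a) ^+ 2.
    move=> rI; have [/andP[g1 g2] /andP[t1 _]] := gth r rI.
    by rewrite g2 t1 thC// (le_trans (ltW gm0)).
  (* The lower estimate is taken at an end whose boundary value differs from [a]: the left one if lo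
     < a, otherwise the right one after reflection. *)
  have [la|al] := ltP lo a.
    have [|c [e [nu1 [c0 eI nuI H]]]] :=
      @crossing_characteristic_lower_left _ g th lo hi a gM C Cd la gM0 C0 Cd0.
      by move=> r rI; apply: bnd; lra.
    exists c, e, nu1, 0; split=> //; first by left.
    move=> nu x nuI' /andP[x0 x1]; rewrite subr0 ger0_norm ?(ltW x0)// => xe.
    have nu0 : 0 < nu by case/andP: nuI'.
    by apply: (H nu _ _ nuI' (cr nu nu0) (dle nu nu0)); rewrite (ltW x0).
  have ah : - hi < - a by rewrite ltrN2; exact: le_lt_trans lohi.
  have [|c [e [nu1 [c0 eI nuI H]]]] := @crossing_characteristic_lower_left _
      (fun v => g (- v)) (fun v => th (- v)) (- hi) (- lo) (- a) gM C Cd ah gM0 C0 Cd0.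
    move=> r rI; have -> : (r - - a) ^+ 2 = (- r - a) ^+ 2 by ring.
    by apply: bnd; lra.
  exists c, e, nu1, 1; split=> //; first by right.
  move=> nu x nuI' xI xe; have nu0 : 0 < nu by case/andP: nuI'.
  have := H nu _ _ nuI' (crossing_reflect (cr nu nu0)) (dle nu nu0) (1 - x).
  rewrite subKr /majorant subr0 distrC.
  have -> : `|- y nu x - - a| = `|y nu x - a| by rewrite -opprD normrN.
  apply; move: xe; rewrite ler0_norm ?subr_le0; last by case/andP: xI => _ /ltW.
  by rewrite opprB; case/andP: xI => x0 x1; lra.
Qed.

Lemma profiles_flip (y : R -> R -> R) (a : R) :
  let y' nu x := y nu (1 - x) in
  [/\ upper_profile y (fun=> a) -> upper_profile y' (fun=> a),
      lower_profile y (fun=> a) -> lower_profile y' (fun=> a) &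
      lower_profile1 y (fun=> a) -> lower_profile1 y' (fun=> a)].
Proof.
move=> y'; have maj (z nu x : R) : majorant z nu (1 - x) = majorant (1 - z) nu x.
  by rewrite /majorant -normrN; congr (_ / (_ + `|_|)); ring.
split.
- move=> [K [z1 [z2 [K0 z1I z2I H]]]]; exists K, (1 - z1), (1 - z2); split=> //; try lra.
  by move=> nu x nuI xI; rewrite -!maj; apply: H => //; lra.
- move=> [c c0 H]; exists c => // nu nuI; have [b [b0 b1 bx]] := H nu nuI.
  exists (1 - b - c * nu); split; [by lra|by lra|].
  by move=> x xI xb; apply: bx; lra.
- move=> [c [e [nu1 [z [c0 eI nuI zE H]]]]]; exists c, e, nu1, (1 - z); split=> //.
    by case: zE => ->; rewrite ?subr0 ?subrr; [right|left].
  move=> nu x nuI' xI xz; rewrite -maj; apply: H => //; first by lra.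
  by move: xz; rewrite -normrN; congr (`|_| <= _); ring.
Qed.

End CrossingFamilies.

(** * Convergence in each type of configuration *)

(** The viscous part of the theorem, isolated so that each type of configuration can be treated
    separately; [s] enters only through the characteristic condition for sharpness in L^1. *)
Definition convergence (R : realType) (p : R -> R) (rho0 u0 u1 : R) (s : seq R) : Prop :=
  let m := rho0 * u0 in
  let rho1 := m / u1 in
    exists rho u : R -> R -> R,
      (forall nu : R, 0 < nu ->
         viscous_steady_solution p nu rho0 u0 u1 (rho nu) (u nu) /\
         (forall rho' u' : R -> R,
            viscous_steady_solution p nu rho0 u0 u1 rho' u' ->
            forall x : R, 0 <= x <= 1 ->
              rho' x = rho nu x /\ u' x = u nu x)) /\
      exists (z : seq R) (r v : R -> R),
        [/\ forall nu : R, 0 < nu ->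
              inviscid_solution p m nu rho0 rho1 z r v,
            forall q : R, 1 < q ->
              upper_rate (fun nu => Lq_dist01 q (rho nu) r)
                         (fun nu => nu `^ q^-1) /\
              upper_rate (fun nu => Lq_dist01 q (u nu) v)
                         (fun nu => nu `^ q^-1),
            upper_rate (fun nu => Lq_dist01 1 (rho nu) r)
                       (fun nu => nu * `|ln nu|) /\
            upper_rate (fun nu => Lq_dist01 1 (u nu) v)
                       (fun nu => nu * `|ln nu|),
            rho0 != rho1 -> forall q : R, 1 < q ->
              lower_rate (fun nu => Lq_dist01 q (rho nu) r)
                         (fun nu => nu `^ q^-1) /\
              lower_rate (fun nu => Lq_dist01 q (u nu) v)
                         (fun nu => nu `^ q^-1) &
            rho0 != rho1 ->
            (exists2 a : R, s = [:: a] & characteristic p m a) ->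
              lower_rate (fun nu => Lq_dist01 1 (rho nu) r)
                         (fun nu => nu * `|ln nu|) /\
              lower_rate (fun nu => Lq_dist01 1 (u nu) v)
                         (fun nu => nu * `|ln nu|)].

Section Convergence.
Context {R : realType} {p : R -> R} {rho0 u0 u1 : R}.
Hypotheses (hp : pressure_law p) (rho0_gt0 : 0 < rho0) (u0_gt0 : 0 < u0) (u1_gt0 : 0 < u1).

Local Notation m := (rho0 * u0).
Local Notation rho1 := (m / u1).
Local Notation P := (psi p m).
Local Notation D := (dpsi p m).
Local Notation flux := (fun r : R => r ^+ 2 / m).

Let m0 : 0 < m. Proof. exact: mulr_gt0. Qed.
Let rho1_gt0 : 0 < rho1. Proof. exact: divr_gt0. Qed.

(** Reduces every case to pointwise estimates on densities. The limit is always written as a step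
    function, with A = B when there is no shock. *)
Lemma convergence_of_profiles (s z : seq R) (x0 A B lo hi : R) (rho : R -> R -> R) :
  0 < lo -> lo <= A <= hi -> lo <= B <= hi ->
  (forall nu, 0 < nu -> viscous_steady_solution p nu rho0 u0 u1 (rho nu) (fun x => m / rho nu x)) ->
  (forall nu, 0 < nu -> forall x, 0 < rho nu x /\ {for x, continuous (rho nu)}) ->
  (forall nu x, 0 < nu <= 1 -> 0 < x < 1 -> lo <= rho nu x <= hi) ->
  let r x := if x < x0 then A else B in
  (forall nu, 0 < nu -> inviscid_solution p m nu rho0 rho1 z r (fun x => m / r x)) ->
  upper_profile rho r -> (rho0 != rho1 -> lower_profile rho r) ->
  (rho0 != rho1 -> (exists2 a : R, s = [:: a] & characteristic p m a) ->
    lower_profile1 rho r) ->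
  convergence p rho0 u0 u1 s.
Proof.
move=> lo0 AI BI visc rhoc rhoI r invisc up low low1.
have hi0 : 0 < hi by case/andP: AI => h1 h2; exact: lt_le_trans lo0 (le_trans h1 h2).
pose u nu x := m / rho nu x; pose v x := m / r x.
have rI x : lo <= r x <= hi by rewrite /r; case: ifP.
have k0 : 0 < m / hi ^+ 2 by rewrite divr_gt0// exprn_gt0.
have K0 : 0 < m / lo ^+ 2 by rewrite divr_gt0// exprn_gt0.
have [tup tlow tlow1] := profile_transfer (f := rho) (g := r) (f' := u) (g' := v) k0 K0
  (fun nu x nuI xI => quotient_compare m0 lo0 (rhoI nu x nuI xI) (rI x)).
have me : measurable_error rho r.
  by apply: measurable_error_step => nu nu0 x; have [] := rhoc nu nu0 x.
have meu : measurable_error u v.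
  have -> : v = (fun x => if x < x0 then m / A else m / B).
    by apply/funext => x; rewrite /v /r; case: ifP.
  apply: measurable_error_step => nu nu0 x; have [rp rc] := rhoc nu nu0 x.
  by apply: cvgM; [exact: cvg_cst|apply: cvgV => //; rewrite gt_eqF].
exists rho, u; split.
  move=> nu nu0; split; first exact: visc.
  move=> rho' u' H; exact: (viscous_steady_unique hp rho0_gt0 u0_gt0 nu0 (visc nu nu0) H).
exists z, r, v; split=> //.
- move=> q q1; split; first exact: upper_profile_rate.
  by apply: upper_profile_rate => //; exact: tup.
- split; first exact: upper_profile_rate1.
  by apply: upper_profile_rate1 => //; exact: tup.
- move=> neq q q1; split; first by apply: lower_profile_rate => //; exact: low.
  by apply: lower_profile_rate => //; apply: tlow; exact: low.
- move=> neq ch; split; first by apply: lower_profile1_rate => //; exact: low1.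
  by apply: lower_profile1_rate => //; apply: tlow1; exact: low1.
Qed.

Let inviscid_const (a x0 : R) nu : 0 < nu -> steady_states p m rho0 rho1 [:: a] ->
  inviscid_solution p m nu rho0 rho1 [::] (fun x => if x < x0 then a else a)
    (fun x => m / (if x < x0 then a else a)).
Proof.
move=> nu0 conf; exists [:: a]; split=> //.
  by apply/(limiting_configurationP hp m0).
by move=> x _ _; rewrite if_same.
Qed.

Lemma flux_bounds lo hi r : 0 < lo -> lo <= r <= hi ->
  lo ^+ 2 / m <= r ^+ 2 / m <= hi ^+ 2 / m.
Proof.
move=> lo0 /andP[lr rh]; have r0 := lt_le_trans lo0 lr; have hi0 := lt_le_trans r0 rh.
rewrite !ler_pM2r ?invr_gt0//.
by rewrite !ler_pXn2r ?nnegrE ?(ltW lo0) ?(ltW r0) ?(ltW hi0)// lr rh.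
Qed.

Lemma flux_continuous r : {for r, continuous flux}.
Proof.
by apply: cvgM; [apply: (@cvgM _ _ _ _ id id); exact: cvg_id|exact: cvg_cst].
Qed.

Let const_step (a : R) : (fun x : R => if x < 0 then a else a) = (fun=> a).
Proof. by apply/funext => x; rewrite if_same. Qed.

Lemma convergence_constant : rho0 = rho1 -> steady_states p m rho0 rho1 [:: rho0] ->
  convergence p rho0 u0 u1 [:: rho0].
Proof.
move=> E conf.
apply: (@convergence_of_profiles [:: rho0] [::] 0 rho0 rho0 rho0 rho0 (fun _ _ => rho0)) => //;
  rewrite ?lexx//.
- move=> nu nu0; apply: (viscous_steady_of_profile hp rho0_gt0 u0_gt0 u1_gt0 nu0 (b := P rho0)) => //.
  + by move=> x; split=> //; exact: cvg_cst.
  + by move=> x _; rewrite subrr !mulr0; exact: is_derive1_cst.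
- by move=> nu _ x; split=> //; exact: cvg_cst.
- by move=> nu nu0; exact: (inviscid_const 0 nu0 conf).
- rewrite const_step; exists 1, 0, 0; split; rewrite ?lexx ?ler01// => nu x /andP[nu0 _] _.
  by left; rewrite subrr normr0 mul1r ltW// majorant_gt0.
- by rewrite -E eqxx.
- by rewrite -E eqxx.
Qed.

(** Here [a] is the end with the larger value of psi, and b = P a + d. By the chord inequality the
    gap is at least linear in the distance to [a], hence at least quadratic on the bounded interval.
    The L^1 sharpness clause is vacuous, since a characteristic [a] would minimize psi. *)
Lemma convergence_increasing_layer (a : R) : rho0 < rho1 ->
  (a = rho0 /\ P rho1 < P rho0) \/ (a = rho1 /\ P rho0 < P rho1) ->
  steady_states p m rho0 rho1 [:: a] -> convergence p rho0 u0 u1 [:: a].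
Proof.
move=> lohi aE conf.
have aI : rho0 <= a <= rho1 by case: aE => [[-> _]|[-> _]]; rewrite lexx ltW.
have a0 : 0 < a by case/andP: aI => h _; exact: lt_le_trans h.
pose W := rho1 - rho0; have W0 : 0 < W by rewrite subr_gt0.
have [k k0 quad] : exists2 k, 0 < k & forall r, rho0 <= r <= rho1 -> k * (r - a) ^+ 2 <= P a - P r.
  have gen De r e : 0 < De -> 0 <= e -> e <= W -> W * (P a - P r) >= e * De ->
      De / W ^+ 2 * e ^+ 2 <= P a - P r.
    move=> De0 e0 eW h; rewrite -(ler_pM2l W0); apply: le_trans h.
    have -> : W * (De / W ^+ 2 * e ^+ 2) = e * De * (e / W) by field; rewrite gt_eqF.
    by rewrite ler_piMr ?mulr_ge0 ?(ltW De0)// ler_pdivrMr// mul1r.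
  case: aE => [[aE Pl]|[aE Pl]]; rewrite aE in gen *.
    exists ((P rho0 - P rho1) / W ^+ 2); first by rewrite divr_gt0 ?subr_gt0// exprn_gt0.
    move=> r /andP[lr rh]; have ch := psi_chord (m := m) hp rho0_gt0 lr rh.
    by apply: gen; rewrite ?subr_gt0 ?subr_ge0// /W; lra.
  exists ((P rho1 - P rho0) / W ^+ 2); first by rewrite divr_gt0 ?subr_gt0// exprn_gt0.
  move=> r /andP[lr rh]; have ch := psi_chord (m := m) hp rho0_gt0 lr rh.
  have -> : (r - rho1) ^+ 2 = (rho1 - r) ^+ 2 by ring.
  by apply: gen; rewrite ?subr_gt0 ?subr_ge0// /W; lra.
have [L L0 HL] := psi_lipschitz hp m0 rho0_gt0 (ltW lohi).
pose th r := P a - P r.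
have th0 r : rho0 <= r <= rho1 -> 0 <= th r.
  by move=> /quad; apply: le_trans; rewrite mulr_ge0 ?sqr_ge0// ltW.
have thL r : rho0 <= r <= rho1 -> 0 <= th r <= L * `|r - a|.
  move=> rI; rewrite th0//=; apply: le_trans (ler_norm _) _.
  by rewrite /th distrC; exact: HL.
have A0 : rho0 / 2 < rho0 by rewrite ltr_pdivrMr// ltr_pMr// ltr1n.
have B0 : rho1 < rho1 + 1 by rewrite ltrDl.
have cgth r : rho0 <= r <= rho1 -> {for r, continuous flux} /\ {for r, continuous th}.
  move=> /andP[lr _]; split; first exact: flux_continuous.
  by apply: cvgB; [exact: cvg_cst|exact: (continuous_psi hp (lt_le_trans rho0_gt0 lr))].
have g0 r : rho0 <= r <= rho1 -> 0 < flux r.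
  by move=> /andP[lr _]; rewrite divr_gt0// exprn_gt0// (lt_le_trans rho0_gt0).
have [d [y H]] := crossing_family A0 lohi B0 aI L0 cgth g0 thL.
have yp nu x : 0 < nu -> 0 < y nu x.
  by move=> /H[_ /(_ x)/andP[h _]]; apply: lt_trans h; rewrite divr_gt0.
have gm0 : 0 < rho0 ^+ 2 / m by rewrite divr_gt0// exprn_gt0.
have gth r : rho0 <= r <= rho1 ->
    rho0 ^+ 2 / m <= flux r <= rho1 ^+ 2 / m /\ 0 <= th r <= L * W.
  move=> rI; split; first exact: flux_bounds.
  have /andP[h1 h2] := thL r rI; rewrite h1/=; apply: le_trans h2 _.
  by rewrite ler_pM2l// /W ler_norml; lra.
have [up low _] := layer_profiles lohi aI gm0 k0 gth quad (fun nu nu0 => (H nu nu0).1).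
apply: (@convergence_of_profiles [:: a] [::] 0 a a rho0 rho1 y) => //.
- move=> nu nu0; have [[d0 [y0 y1] _ cy dy] _] := H nu nu0.
  apply: (viscous_steady_of_profile hp rho0_gt0 u0_gt0 u1_gt0 nu0 (b := P a + d nu)) => //.
    by move=> x; split; [exact: yp|exact: cy].
  by move=> x xI; apply: (is_derive1_eq (dy x xI)); rewrite /th; ring.
- by move=> nu nu0 x; have [[_ _ _ cy _] _] := H nu nu0; split; [exact: yp|exact: cy].
- move=> nu x /andP[nu0 _] xI; apply: (crossing_range (H nu nu0).1).
  by case/andP: xI => /ltW-> /ltW->.
- by move=> nu nu0; exact: (inviscid_const 0 nu0 conf).
- by rewrite const_step.
- by rewrite const_step.
- move=> _ [a' [aa'] /(characteristicP hp m0)]; rewrite -aa' => /(_ a0) Da; exfalso.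
  have h1 := psi_tangent_le (m := m) hp a0 rho0_gt0.
  have h2 := psi_tangent_le (m := m) hp a0 rho1_gt0.
  by rewrite Da !mul0r !addr0 in h1 h2; case: aE => [[aE]|[aE]]; rewrite aE in h1 h2; lra.
Qed.

(** Here b = P a - d lies below the minimum of psi on the interval, the density decreases, and
    reflection of x gives a crossing. At the minimizer the first-order term D a (r - a) is
    nonnegative, so the gap is at least the explicit remainder in [psi_tangent]. *)
Lemma convergence_decreasing (a : R) : rho1 < rho0 -> rho1 <= a <= rho0 ->
  (a < rho0 -> 0 <= D a) -> (rho1 < a -> D a <= 0) ->
  steady_states p m rho0 rho1 [:: a] -> convergence p rho0 u0 u1 [:: a].
Proof.
move=> lohi aI Da1 Da2 conf.
have a0 : 0 < a by case/andP: aI => h _; exact: lt_le_trans h.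
pose W := rho0 - rho1; have W0 : 0 < W by rewrite subr_gt0.
pose k := m ^+ 2 / (rho0 * a ^+ 2).
have k0 : 0 < k by rewrite divr_gt0 ?mulr_gt0 ?exprn_gt0.
pose th r := P r - P a.
have quad r : rho1 <= r <= rho0 -> k * (r - a) ^+ 2 <= th r.
  move=> /andP[lr rh]; have r0 := lt_le_trans rho1_gt0 lr.
  have h := psi_tangent (m := m) hp a0 r0.
  have sgn : 0 <= D a * (r - a).
    have [ra|ra|->] := ltgtP r a; last by rewrite subrr mulr0.
      by apply: mulr_le0; [apply: Da2; exact: le_lt_trans ra|rewrite subr_le0 ltW].
    by apply: mulr_ge0; [apply: Da1; exact: lt_le_trans rh|rewrite subr_ge0 ltW].
  have kle : k * (r - a) ^+ 2 <= m ^+ 2 * (r - a) ^+ 2 / (r * a ^+ 2).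
    rewrite /k mulrAC; apply: ler_wpM2l; first by rewrite mulr_ge0 ?sqr_ge0.
    by rewrite lef_pV2 ?posrE ?mulr_gt0 ?exprn_gt0// ler_pM2r ?exprn_gt0.
  by rewrite /th; lra.
have [L L0 HL] := psi_lipschitz hp m0 rho1_gt0 (ltW lohi).
have th0 r : rho1 <= r <= rho0 -> 0 <= th r.
  by move=> /quad; apply: le_trans; rewrite mulr_ge0 ?sqr_ge0// ltW.
have thL r : rho1 <= r <= rho0 -> 0 <= th r <= L * `|r - a|.
  by move=> rI; rewrite th0//=; apply: le_trans (ler_norm _) _; exact: HL.
have A0 : rho1 / 2 < rho1 by rewrite ltr_pdivrMr// ltr_pMr// ltr1n.
have B0 : rho0 < rho0 + 1 by rewrite ltrDl.
have cgth r : rho1 <= r <= rho0 -> {for r, continuous flux} /\ {for r, continuous th}.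
  move=> /andP[lr _]; split; first exact: flux_continuous.
  by apply: cvgB; [exact: (continuous_psi hp (lt_le_trans rho1_gt0 lr))|exact: cvg_cst].
have g0 r : rho1 <= r <= rho0 -> 0 < flux r.
  by move=> /andP[lr _]; rewrite divr_gt0// exprn_gt0// (lt_le_trans rho1_gt0).
have [d [y H]] := crossing_family A0 lohi B0 aI L0 cgth g0 thL.
have yp nu x : 0 < nu -> 0 < y nu x.
  by move=> /H[_ /(_ x)/andP[h _]]; apply: lt_trans h; exact: divr_gt0.
have gm0 : 0 < rho1 ^+ 2 / m by rewrite divr_gt0// exprn_gt0.
have gth r : rho1 <= r <= rho0 ->
    rho1 ^+ 2 / m <= flux r <= rho0 ^+ 2 / m /\ 0 <= th r <= L * W.
  move=> rI; split; first exact: flux_bounds.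
  have /andP[h1 h2] := thL r rI; rewrite h1/=; apply: le_trans h2 _.
  by rewrite ler_pM2l// /W ler_norml; lra.
have [up low low1] := layer_profiles lohi aI gm0 k0 gth quad (fun nu nu0 => (H nu nu0).1).
have [fup flow flow1] := profiles_flip y a.
have dflip (x : R) : is_derive x 1 (fun t : R => 1 - t) (0 - 1).
  exact: (is_derive1B (is_derive1_cst 1 x) (is_derive1_id x)).
have cflip (nu x : R) : 0 < nu -> {for x, continuous (fun x : R => y nu (1 - x))}.
  move=> nu0; have [[_ _ _ cy _] _] := H nu nu0.
  exact: (@continuous_comp _ _ _ (fun x : R => 1 - x) (y nu) x
    (is_derive1_continuous (dflip x)) (cy (1 - x))).
apply: (@convergence_of_profiles [:: a] [::] 0 a a rho1 rho0 (fun nu x => y nu (1 - x))) => //.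
- move=> nu nu0; have [[d0 [y0 y1] _ cy dy] _] := H nu nu0.
  apply: (viscous_steady_of_profile hp rho0_gt0 u0_gt0 u1_gt0 nu0 (b := P a - d nu)) => //.
  + by move=> x; split; [exact: yp|exact: cflip].
  + by rewrite subr0.
  + by rewrite subrr.
  + move=> x xI; have xI' : 0 <= 1 - x <= 1 by lra.
    have d2 : is_derive x 1 (fun x => y nu (1 - x)) _ :=
      @is_derive1_comp _ (y nu) (fun t => 1 - t) x _ _ (dy _ xI') (dflip x).
    by apply: (is_derive1_eq d2); rewrite /th; ring.
- by move=> nu nu0 x; split; [exact: yp|exact: cflip].
- move=> nu x /andP[nu0 _] xI; apply: (crossing_range (H nu nu0).1); lra.
- by move=> nu nu0; exact: (inviscid_const 0 nu0 conf).
- by rewrite const_step; exact: fup.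
- by rewrite const_step => _; exact: flow.
- move=> _ [a' [aa'] /(characteristicP hp m0)]; rewrite -aa' => /(_ a0) Da.
  have [C C0 HC] := psi_quadratic_upper hp m0 rho1_gt0 aI.
  rewrite const_step; apply: flow1; apply: (low1 C C0) => r /HC.
  by rewrite Da mul0r subr0 => /andP[].
Qed.

(** Here b = P rho0 + d, and the gap vanishes at both ends with slopes - D rho0 and D rho1, which
    are positive by the Lax condition. These slopes and the weights rho0^2 / m and rho1^2 / m
    determine the position found in [crossing_shock]. *)
Lemma convergence_shock : rho0 < rho1 -> P rho0 = P rho1 ->
  steady_states p m rho0 rho1 [:: rho0; rho1] -> convergence p rho0 u0 u1 [:: rho0; rho1].
Proof.
move=> lohi PE conf.
have aI : rho0 <= rho0 <= rho1 by rewrite lexx ltW.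
have bI : rho0 <= rho1 <= rho1 by rewrite lexx ltW.
have /andP[D0 D1] := dpsi_of_shock hp m0 rho0_gt0 lohi PE.
pose c := (rho0 + rho1) / 2; have lc : rho0 < c by rewrite /c; lra.
have ch : c < rho1 by rewrite /c; lra.
have Pc : P c < P rho0 by have := psi_between hp m0 rho0_gt0 lc ch; rewrite -PE maxxx.
pose W := rho1 - rho0; have W0 : 0 < W by rewrite subr_gt0.
(* The chord slope from the midpoint to either end, the same on both sides because psi takes equal
   values at the two ends. *)
pose k := (P rho0 - P c) / (c - rho0).
have cl0 : 0 < c - rho0 by rewrite subr_gt0.
have k0 : 0 < k by rewrite divr_gt0// subr_gt0.
have kc : k * (c - rho0) = P rho0 - P c by rewrite /k divfK// gt_eqF.
pose th r := P rho0 - P r.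
have c0 := lt_trans rho0_gt0 lc.
have kL r : rho0 <= r <= c -> k * (r - rho0) <= th r.
  move=> /andP[lr rc]; have := psi_chord (m := m) hp rho0_gt0 lr rc => h.
  rewrite -(ler_pM2l cl0) (_ : (c - rho0) * (k * (r - rho0)) = (k * (c - rho0)) * (r - rho0)); last by ring.
  by rewrite kc /th; lra.
have kR r : c <= r <= rho1 -> k * (rho1 - r) <= th r.
  move=> /andP[cr rh]; have := psi_chord (m := m) hp c0 cr rh => h.
  have cE : rho1 - c = c - rho0 by rewrite /c; lra.
  rewrite -(ler_pM2l cl0) (_ : (c - rho0) * (k * (rho1 - r)) = (k * (c - rho0)) * (rho1 - r)); last by ring.
  by rewrite kc /th -cE; rewrite -PE in h; lra.
have th0 r : rho0 <= r <= rho1 -> 0 <= th r.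
  move=> rI; have [rc|cr] := leP r c.
    by apply: le_trans (kL r _); [rewrite mulr_ge0 ?(ltW k0)//; lra|lra].
  by apply: le_trans (kR r _); [rewrite mulr_ge0 ?(ltW k0)//; lra|lra].
have [L L0 HL] := psi_lipschitz hp m0 rho0_gt0 (ltW lohi).
have thL r : rho0 <= r <= rho1 -> 0 <= th r <= L * `|r - rho0|.
  move=> rI; rewrite th0//=; apply: le_trans (ler_norm _) _.
  by rewrite /th distrC; exact: HL.
have A0 : rho0 / 2 < rho0 by rewrite ltr_pdivrMr// ltr_pMr// ltr1n.
have B0 : rho1 < rho1 + 1 by rewrite ltrDl.
have cgth r : rho0 <= r <= rho1 -> {for r, continuous flux} /\ {for r, continuous th}.
  move=> /andP[lr _]; split; first exact: flux_continuous.
  by apply: cvgB; [exact: cvg_cst|exact: (continuous_psi hp (lt_le_trans rho0_gt0 lr))].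
have g0 r : rho0 <= r <= rho1 -> 0 < flux r.
  by move=> /andP[lr _]; rewrite divr_gt0// exprn_gt0// (lt_le_trans rho0_gt0).
have [d [y H]] := crossing_family A0 lohi B0 aI L0 cgth g0 thL.
have yp nu x : 0 < nu -> 0 < y nu x.
  by move=> /H[_ /(_ x)/andP[h _]]; apply: lt_trans h; rewrite divr_gt0.
have gm0 : 0 < rho0 ^+ 2 / m by rewrite divr_gt0// exprn_gt0.
have gth r : rho0 <= r <= rho1 ->
    rho0 ^+ 2 / m <= flux r <= rho1 ^+ 2 / m /\ 0 <= th r <= L * W.
  move=> rI; split; first exact: flux_bounds.
  have /andP[h1 h2] := thL r rI; rewrite h1/=; apply: le_trans h2 _.
  by rewrite ler_pM2l// /W ler_norml; lra.
pose Cg := 2 * rho1 / m.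
have Cg0 : 0 < Cg by rewrite divr_gt0// mulr_gt0.
have gLip r t : rho0 <= r <= rho1 -> rho0 <= t <= rho1 -> `|flux r - flux t| <= Cg * `|r - t|.
  move=> rI tI; have -> : flux r - flux t = (r + t) / m * (r - t) by ring.
  have p1 : 0 < (r + t) / m by rewrite divr_gt0//; have := rho0_gt0; lra.
  rewrite normrM (gtr0_norm p1); apply: ler_wpM2r => //.
  by rewrite ler_pM2r ?invr_gt0//; lra.
have [C1 C10 HC1] := psi_quadratic_upper hp m0 rho0_gt0 aI.
have [C2 C20 HC2] := psi_quadratic_upper hp m0 rho0_gt0 bI.
pose Ct := C1 + C2; have Ct0 : 0 < Ct by rewrite addr_gt0.
have ND0 : 0 < - D rho0 by rewrite oppr_gt0.
have HLeft r : rho0 <= r <= c -> [/\ rho0 ^+ 2 / m <= flux r,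
    `|flux r - flux rho0| <= Cg * (r - rho0), k * (r - rho0) <= th r &
    `|th r - - D rho0 * (r - rho0)| <= Ct * (r - rho0) ^+ 2].
  move=> rI; have rI' : rho0 <= r <= rho1 by lra.
  have [/andP[g1 _] _] := gth r rI'; have /andP[q1 q2] := HC1 r rI'.
  split=> //; last 1 first.
  - have q3 : 0 <= C2 * (r - rho0) ^+ 2 by rewrite mulr_ge0 ?sqr_ge0// ltW.
    by rewrite /th /Ct mulrDl ler_norml; lra.
  - by have := gLip r rho0 rI' aI; rewrite (@ger0_norm _ (r - rho0)) ?subr_ge0//; case/andP: rI.
  - exact: kL.
have HRight r : c <= r <= rho1 -> [/\ rho0 ^+ 2 / m <= flux r,
    `|flux r - flux rho1| <= Cg * (rho1 - r), k * (rho1 - r) <= th r &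
    `|th r - D rho1 * (rho1 - r)| <= Ct * (rho1 - r) ^+ 2].
  move=> rI; have rI' : rho0 <= r <= rho1 by lra.
  have [/andP[g1 _] _] := gth r rI'; have /andP[q1 q2] := HC2 r rI'.
  split=> //; last 1 first.
  - have q3 : 0 <= C1 * (r - rho1) ^+ 2 by rewrite mulr_ge0 ?sqr_ge0// ltW.
    have -> : (rho1 - r) ^+ 2 = (r - rho1) ^+ 2 by ring.
    have -> : th r - D rho1 * (rho1 - r) = - (P r - P rho1 - D rho1 * (r - rho1)).
      by rewrite /th PE; ring.
    rewrite normrN ger0_norm//; apply: le_trans q2 _.
    by rewrite [leRHS]mulrDl lerDr.
  - by have := gLip r rho1 rI' bI; rewrite (@ler0_norm _ (r - rho1)) ?opprB ?subr_le0//; case/andP: rI.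
  - exact: kR.
have [x0 [K [x0I K0 HK]]] := crossing_shock ND0 D1 k0 gm0 (ltW Cg0) (ltW Ct0) lc ch HLeft HRight.
have [cl cl0' Hlow] := crossing_lower_shock lohi x0I gm0 gth.
apply: (@convergence_of_profiles _ [:: x0] x0 rho0 rho1 rho0 rho1 y) => //.
- move=> nu nu0; have [[d0 [y0 y1] _ cy dy] _] := H nu nu0.
  apply: (viscous_steady_of_profile hp rho0_gt0 u0_gt0 u1_gt0 nu0 (b := P rho0 + d nu)) => //.
    by move=> x; split; [exact: yp|exact: cy].
  by move=> x xI; apply: (is_derive1_eq (dy x xI)); rewrite /th; ring.
- by move=> nu nu0 x; have [[_ _ _ cy _] _] := H nu nu0; split; [exact: yp|exact: cy].
- move=> nu x /andP[nu0 _] xI; apply: (crossing_range (H nu nu0).1).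
  by case/andP: xI => /ltW-> /ltW->.
- move=> nu nu0; exists [:: rho0; rho1]; split=> //.
  + by apply/(limiting_configurationP hp m0).
  + by move=> w; rewrite inE => /eqP->.
  + move=> x xI; rewrite inE => xx0; split=> //=; rewrite addn0.
    have [lt|gt|E] := ltgtP x x0 => //.
    by rewrite E eqxx in xx0.
- exists K, x0, x0; have x0I' : 0 <= x0 <= 1 by case/andP: x0I => /ltW-> /ltW->.
  split=> // nu x nuI xI; left; have /andP[nu0 _] := nuI.
  apply: (HK nu (d nu) (y nu) nuI (H nu nu0).1).
  by case/andP: xI => /ltW-> /ltW->.
- move=> _; exists cl => // nu nuI; have /andP[nu0 _] := nuI.
  exact: (Hlow nu (d nu) (y nu) nuI (H nu nu0).1).
- by move=> _ [a' aE].
Qed.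

End Convergence.

(** * Assembly of the four cases *)

Unset Implicit Arguments.
Set Strict Implicit.
Set Printing Implicit Defensive.

Theorem proposition4p1 (R : realType) (p : R -> R) (rho0 u0 u1 : R)
    (hp : pressure_law p)
    (hrho0 : 0 < rho0) (hu0 : 0 < u0) (hu1 : 0 < u1) :
  let m := rho0 * u0 in
  let rho1 := m / u1 in
  exists s : seq R,
    (* the unique limiting steady configuration, and its possible types *)
    (forall nu : R, 0 < nu ->
       [/\ limiting_configuration p m nu rho0 rho1 s,
           forall s' : seq R,
             limiting_configuration p m nu rho0 rho1 s' -> s' = s &
           [\/ single_boundary_layer p m nu rho0 rho1 s,
               single_interior_shock p m nu rho0 rho1 s |
               double_boundary_layer p m nu rho0 rho1 s]]) /\
    (* the inviscid solution is unique up to the shock location, which is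
       arbitrary *)
    (forall nu : R, 0 < nu ->
       (forall z : seq R,
          (exists r v : R -> R, inviscid_solution p m nu rho0 rho1 z r v) <->
          (size s = 1%N /\ z = [::] \/
           size s = 2%N /\ exists2 y : R, 0 < y < 1 & z = [:: y])) /\
       (forall (z : seq R) (r v r' v' : R -> R),
          inviscid_solution p m nu rho0 rho1 z r v ->
          inviscid_solution p m nu rho0 rho1 z r' v' ->
          forall x : R, 0 < x < 1 -> x \notin z ->
            r' x = r x /\ v' x = v x)) /\
    (* the unique viscous steady solution, and its convergence *)
    exists rho u : R -> R -> R,
      (forall nu : R, 0 < nu ->
         viscous_steady_solution p nu rho0 u0 u1 (rho nu) (u nu) /\
         (forall rho' u' : R -> R,
            viscous_steady_solution p nu rho0 u0 u1 rho' u' ->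
            forall x : R, 0 <= x <= 1 ->
              rho' x = rho nu x /\ u' x = u nu x)) /\
      exists (z : seq R) (r v : R -> R),
        [/\ forall nu : R, 0 < nu ->
              inviscid_solution p m nu rho0 rho1 z r v,
            forall q : R, 1 < q ->
              upper_rate (fun nu => Lq_dist01 q (rho nu) r)
                         (fun nu => nu `^ q^-1) /\
              upper_rate (fun nu => Lq_dist01 q (u nu) v)
                         (fun nu => nu `^ q^-1),
            upper_rate (fun nu => Lq_dist01 1 (rho nu) r)
                       (fun nu => nu * `|ln nu|) /\
            upper_rate (fun nu => Lq_dist01 1 (u nu) v)
                       (fun nu => nu * `|ln nu|),
            (* sharpness in L^q: all data but those of a constant solution *)
            rho0 != rho1 -> forall q : R, 1 < q ->
              lower_rate (fun nu => Lq_dist01 q (rho nu) r)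
                         (fun nu => nu `^ q^-1) /\
              lower_rate (fun nu => Lq_dist01 q (u nu) v)
                         (fun nu => nu `^ q^-1) &
            (* sharpness in L^1: nonconstant data with characteristic interior state *)
            rho0 != rho1 ->
            (exists2 a : R, s = [:: a] & characteristic p m a) ->
              lower_rate (fun nu => Lq_dist01 1 (rho nu) r)
                         (fun nu => nu * `|ln nu|) /\
              lower_rate (fun nu => Lq_dist01 1 (u nu) v)
                         (fun nu => nu * `|ln nu|)].
Proof.
have m0 : 0 < rho0 * u0 by exact: mulr_gt0.
have rho10 : 0 < rho0 * u0 / u1 by exact: divr_gt0.
move=> m rho1.
have [s conf] := steady_states_exist hp m0 hrho0 rho10.
exists s; split; last split.
- move=> nu nu0; split.
  + exact/(limiting_configurationP hp m0 s nu0 hrho0 rho10).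
  + move=> s' /(limiting_configurationP hp m0 s' nu0 hrho0 rho10).
    exact: (steady_states_unique hp m0 hrho0 rho10 conf).
  + exact: (steady_states_type hp m0 nu0 hrho0 rho10 conf).
- move=> nu nu0; split.
    by move=> z; exact: (inviscid_solution_positions hp m0 z nu0 hrho0 rho10 conf).
  move=> z r v r' v' H H'.
  exact: (inviscid_solution_unique hp m0 nu0 hrho0 rho10 H H').
- suff : convergence p rho0 u0 u1 s by [].
  have conf' := conf.
  case: conf => [[LR c1 E]|[LR c1 E]|[LR c1 E]|[a [aI E a1 a2]]]; rewrite E in conf' *.
  + by apply: convergence_increasing_layer => //; left.
  + by apply: convergence_increasing_layer => //; right.
  + exact: convergence_shock.
  (* When the two boundary densities agree, the interval is a point and the viscous solution is
     constant; otherwise the density decreases strictly from one end to the other. *)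
  + case/andP: (aI) => ra ar; have [E1|neq] := eqVneq rho1 rho0; last first.
      by apply: convergence_decreasing => //; rewrite lt_neqAle neq (le_trans ra ar).
    have aE : a = rho0 by apply: le_anti; rewrite ar -E1 ra.
    by rewrite aE in conf' *; apply: convergence_constant.
Qed.
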